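(* Let $m,n\in\mathbf{N}_0$, let $\mu$ be a partition of $m$ and $\lambda$ a partition of $mn$. If $n^\star\in\mathbf{N}$, $\lambda^\star$ is a partition of $mn^\star$ and $\langle s_{(n^\star)}\circ s_\mu,\, s_{\lambda^\star}\rangle\ge 1$ then \[ \langle s_{(n+n^\star)}\circ s_\mu,\, s_{\lambda+\lambda^\star}\rangle\ \ge\ \langle s_{(n)}\circ s_\mu,\, s_\lambda\rangle. \]
   Context: $\mathbf{N}=\{1,2,\ldots\}$, $\mathbf{N}_0=\mathbf{N}\cup\{0\}$. $s_\lambda$ is the Schur function labelled by the partition $\lambda$; $\circ$ is the plethysm product of symmetric functions ($f\circ s_\mu$ is obtained from $f(x_1,x_2,\ldots)$ by substituting for its variables the monomials $x^t$, where $t$ ranges over all semistandard $\mu$-tableaux with positive integer entries). $\langle\cdot,\cdot\rangle$ is the Hall inner product, for which Schur functions are orthonormal. For partitions $\alpha,\beta$, $(\alpha+\beta)_i=\alpha_i+\beta_i$ for each $i$, where parts beyond the last are taken to be $0$. *)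

(* Defs.v *)
From HB Require Import structures.
From mathcomp Require Import all_boot all_order all_algebra.
From mathcomp Require Import finmap.
From mathcomp Require Import boolp classical_sets functions cardinality fsbigop.
From mathcomp Require Import monalg.

Set Implicit Arguments.
Unset Strict Implicit.
Unset Printing Implicit Defensive.

Import Order.TTheory GRing.Theory Num.Theory.
Local Open Scope classical_set_scope.
Local Open Scope ring_scope.

Definition is_part (s : seq nat) : bool := sorted geq s && (0%N \notin s).

Record part : predArgType := Part { parts :> seq nat; _ : is_part parts }.
HB.instance Definition _ := [isSub for parts].
HB.instance Definition _ := [Countable of part by <:].

Definition psize (la : part) : nat := sumn la.

Fact rowpart_subproof (n : nat) : is_part (nseq (0 < n) n).
Proof. by case: n. Qed.

(* The one-row partition (n); it is the empty partition for n = 0. *)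
Definition rowpart (n : nat) : part := Part (rowpart_subproof n).

Definition add_parts (a b : seq nat) : seq nat :=
  mkseq (fun i => nth 0 a i + nth 0 b i)%N (maxn (size a) (size b)).

Lemma part_nth_geq (a : part) i : (nth 0 a i.+1 <= nth 0 a i)%N.
Proof.
case: a => s /= /andP[sd _]; case: (ltnP i.+1 (size s)) => hi.
  by move/(sortedP 0%N): sd => /(_ _ hi).
by rewrite (nth_default 0%N hi).
Qed.

Lemma part_nth_gt0 (a : part) i : (0 < nth 0 a i)%N = (i < size a)%N.
Proof.
case: a => s /= /andP[_ z]; case: (ltnP i (size s)) => hi.
  by rewrite lt0n; apply: contraNneq z => <-; apply: mem_nth.
by rewrite (nth_default 0%N hi).
Qed.

Fact padd_subproof (a b : part) : is_part (add_parts a b).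
Proof.
apply/andP; split.
  apply/(sortedP 0%N) => i; rewrite size_mkseq => hi.
  by rewrite !nth_mkseq ?(ltnW hi) //= leq_add ?part_nth_geq.
apply/negP => /(nthP 0%N)[i]; rewrite size_mkseq => hi.
rewrite nth_mkseq // => /eqP; rewrite addn_eq0 !eqn0Ngt !part_nth_gt0.
by move: hi; rewrite leq_max; case/orP => ->; rewrite ?andbF.
Qed.

Definition padd (a b : part) : part := Part (padd_subproof a b).

(* Tableau entries and variables are indexed from 0: the entry i stands for the
   positive integer i + 1. *)

(* For consecutive rows r, s of a diagram of partition shape, size s <= size r,
   so that zip pairs every box of s with the box above it. *)
Definition column_strict (r s : seq nat) : bool :=
  all (fun p => p.1 < p.2)%N (zip r s).

Definition is_ssyt (la : part) (t : seq (seq nat)) : bool :=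
  [&& map size t == la, all (sorted leq) t & sorted column_strict t].

Record ssyt (la : part) : predArgType :=
  SSYT { rows :> seq (seq nat); _ : is_ssyt la rows }.
HB.instance Definition _ la := [isSub for @rows la].
HB.instance Definition _ la := [Countable of ssyt la by <:].

(* Coefficient functions of formal power series in the variables x_i, i : nat. *)
Definition pseries : Type := {cmonom nat} -> int.

Definition tabmonom (la : part) (t : ssyt la) : {cmonom nat} :=
  \big[mmul/mone]_(i <- flatten t) ucm i.

(* The support of this sum is finite for every exponent b. *)
Definition schur (la : part) : pseries :=
  fun b => \sum_(t \in [set t : ssyt la | tabmonom t = b]) (1 : int).

(** Plethysm.  The variable of f of index [pickle t] is replaced by x^t for
    every semistandard mu-tableau t, and every variable whose index is not of
    this form by 0.  For a symmetric function f the choice of the injective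
    labelling [pickle] is immaterial.  An exponent a in the variables indexed by
    tableaux contributes the coefficient of f at a, relabelled, to the
    monomial \prod_t (x^t)^(a t); the sum below has finite support as soon as
    f has bounded degree. *)

Definition relabel (mu : part) (a : {cmonom (ssyt mu)}) : {cmonom nat} :=
  \big[mmul/mone]_(t <- finsupp a) expcmn (ucm (choice.pickle t)) (a t).

Definition substmonom (mu : part) (a : {cmonom (ssyt mu)}) : {cmonom nat} :=
  \big[mmul/mone]_(t <- finsupp a) expcmn (tabmonom t) (a t).

Definition plethysm (f : pseries) (mu : part) : pseries :=
  fun b => \sum_(a \in [set a : {cmonom (ssyt mu)} | substmonom a = b])
             f (relabel a).

(** Hall inner product, on the integral span of the Schur functions, which is the
    ring of symmetric functions.  The coordinates of a symmetric function are
    unique ([schur_expansion_inj]), and the Schur functions are orthonormal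
    ([hall_schur]).  The coordinates of a series outside the span are set to 0. *)

Definition schur_expansion (f : pseries) (c : {malg int[part]}) : Prop :=
  forall b, f b = \sum_(la <- msupp c) c@_la * schur la b.

Definition schur_coords (f : pseries) : {malg int[part]} :=
  xget 0 [set c | schur_expansion f c].

Definition hall (f g : pseries) : int :=
  \sum_(la <- msupp (schur_coords f)) (schur_coords f)@_la * (schur_coords g)@_la.

(** Unitriangularity of the Schur functions: if la maximises [cmwt K] on a
    finite set of partitions, then the only Schur function labelled by this set
    in which x^la occurs is that of la. *)

Lemma expcmE (I : choiceType) (m : {cmonom I}) k i :
  expcmn m k i = (m i * k)%N.
Proof.
have -> : expcmn m k = iterop k mmul m mone by [].
rewrite Monoid.iteropE; elim: k => [|k IHk] /=; first by rewrite cm1 muln0.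
by rewrite cmM IHk mulnS.
Qed.

Lemma cm_prodE (I : choiceType) (T : Type) (r : seq T) (F : T -> {cmonom I}) i :
  (\big[mmul/mone]_(x <- r) F x) i = (\sum_(x <- r) F x i)%N.
Proof. by elim/big_rec2: _ => [|x n m _ <-]; rewrite ?cm1 ?cmM. Qed.

Lemma tabmonomE (la : part) (t : ssyt la) i :
  tabmonom t i = count_mem i (flatten t).
Proof.
rewrite /tabmonom cm_prodE -sum1_count [RHS]big_mkcond /=.
by apply: eq_bigr => j _; rewrite cmU; case: eqP.
Qed.

Definition partmonom (la : part) : {cmonom nat} :=
  \big[mmul/mone]_(i <- iota 0 (size la)) expcmn (ucm i) (nth 0%N la i).

Lemma partmonomE (la : part) i : partmonom la i = nth 0%N la i.
Proof.
rewrite /partmonom cm_prodE.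
rewrite (eq_bigr (fun j => if j == i then nth 0%N la i else 0%N)); last first.
  by move=> j _; rewrite expcmE cmU; case: eqP => [->|]; rewrite ?mul1n ?mul0n.
rewrite -big_mkcond /= big_const_seq count_uniq_mem ?iota_uniq // mem_iota.
rewrite add0n leq0n /=; case: (ltnP i (size la)) => hi /=; first by rewrite addn0.
by rewrite (nth_default 0%N hi).
Qed.

Lemma partmonom_inj : injective partmonom.
Proof.
move=> la nu e.
have en i : nth 0%N la i = nth 0%N nu i by rewrite -!partmonomE e.
apply/val_inj/(@eq_from_nth _ 0%N) => [|i _]; last exact: en.
apply/eqP; rewrite eqn_leq; apply/andP; split; rewrite leqNgt.
  by rewrite -part_nth_gt0 en part_nth_gt0 ltnn.
by rewrite -part_nth_gt0 -en part_nth_gt0 ltnn.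
Qed.

Lemma ssyt_size (la : part) (t : ssyt la) i :
  size (nth [::] t i) = nth 0%N la i.
Proof.
case: t => t /= /and3P[/eqP <- _ _].
case: (ltnP i (size t)) => hi; first by rewrite (nth_map [::]).
by rewrite !nth_default ?size_map.
Qed.

Lemma ssyt_row_leq (la : part) (t : ssyt la) i j :
  (j < nth 0 la i)%N -> (i <= nth 0 (nth [::] t i) j)%N.
Proof.
elim: i j => // i IHi j hj.
have hj' : (j < nth 0 la i)%N := leq_trans hj (part_nth_geq la i).
apply: leq_ltn_trans (IHi j hj') _.
have hi : (i.+1 < size t)%N.
  rewrite ltnNge; apply/negP => hi; move: hj.
  by rewrite -(ssyt_size t) (nth_default [::] hi).
have: column_strict (nth [::] t i) (nth [::] t i.+1).
  case: t hi {IHi} => t /= /and3P[_ _ /(sortedP [::])] h hi; exact: h.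
move/(all_nthP (0%N, 0%N)) => /(_ j).
by rewrite size_zip !ssyt_size leq_min hj hj' nth_zip_cond size_zip
           !ssyt_size leq_min hj hj' => /(_ isT).
Qed.

Definition cmwt (K : nat) (b : {cmonom nat}) : nat :=
  (\sum_(i < K) b i * (K - i))%N.

Lemma cmwt_tab K (la : part) (t : ssyt la) : (size la <= K)%N ->
  (cmwt K (tabmonom t) <= cmwt K (partmonom la)
     ?= iff [forall i : 'I_K, [forall j : 'I_(nth 0 la i),
               nth 0 (nth [::] t i) j == i :> nat]])%N.
Proof.
move=> hK.
have -> : cmwt K (tabmonom t) =
    (\sum_(i < K) \sum_(j < nth 0 la i) (K - nth 0 (nth [::] t i) j))%N.
  have -> : cmwt K (tabmonom t) = (\sum_(e <- flatten t) (K - e))%N.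
    rewrite /cmwt.
    rewrite (eq_bigr (fun i : 'I_K =>
        \sum_(e <- flatten t) (e == i) * (K - i))%N); last first.
      move=> i _; rewrite tabmonomE -sum1_count big_distrl big_mkcond /=.
      by apply: eq_bigr => e _; case: eqP.
    rewrite exchange_big /=; apply: eq_bigr => e _.
    case: (ltnP e K) => he.
      rewrite (bigD1 (Ordinal he)) //= eqxx mul1n big1 ?addn0 // => i.
      by rewrite -val_eqE /= eq_sym => /negbTE ->; rewrite mul0n.
    rewrite big1; first by apply/esym/eqP; rewrite subn_eq0.
    move=> i _; case: eqP => [ei|]; last by rewrite mul0n.
    by move: he; rewrite ei leqNgt ltn_ord.
  rewrite big_flatten /=.
  have hs : size t = size la by case: t => t /= /and3P[/eqP <- _ _]; rewrite size_map.
  rewrite (big_nth [::]) hs big_mkord.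
  rewrite (big_ord_widen K (fun i => \sum_(e <- nth [::] t i) (K - e))%N hK).
  rewrite big_mkcond; apply: eq_bigr => i _.
  rewrite (big_nth 0%N) big_mkord ssyt_size; case: ifPn => // hi.
  by rewrite -leqNgt in hi; rewrite (nth_default 0%N hi) big_ord0.
have -> : cmwt K (partmonom la) = (\sum_(i < K) \sum_(j < nth 0 la i) (K - i))%N.
  by apply: eq_bigr => i _; rewrite partmonomE sum_nat_const card_ord.
apply: leqif_sum => i _; apply: leqif_sum => j _.
have h := ssyt_row_leq t (ltn_ord j); split; first exact: leq_sub2l.
have := ltn_ord i; move: h; move: (nth 0%N _ _) => e h hi.
apply/eqP/eqP => [E|->//]; move: h; rewrite leq_eqVlt.
by case/orP => [/eqP->//|/(ltn_sub2l hi)]; rewrite E ltnn.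
Qed.

Lemma ssyt_extremal K (la nu : part) (t : ssyt nu) :
  (size nu <= K)%N -> (cmwt K (partmonom nu) <= cmwt K (partmonom la))%N ->
  tabmonom t = partmonom la ->
  nu = la /\ rows t = mkseq (fun i => nseq (nth 0%N nu i) i) (size nu).
Proof.
move=> hK hle e; have := cmwt_tab t hK; rewrite e => h.
have /forallP ht : [forall i : 'I_K, [forall j : 'I_(nth 0 nu i),
    nth 0 (nth [::] t i) j == i :> nat]]%N by rewrite -(geq_leqif h).
have hs : size t = size nu.
  by case: (t) => t' /= /and3P[/eqP <- _ _]; rewrite size_map.
have et : rows t = mkseq (fun i => nseq (nth 0%N nu i) i) (size nu).
  apply: (@eq_from_nth _ [::]) => [|i]; rewrite ?size_mkseq // hs => hi.
  rewrite nth_mkseq //; apply: (@eq_from_nth _ 0%N) => [|j].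
    by rewrite size_nseq ssyt_size.
  rewrite ssyt_size => hj; rewrite nth_nseq hj.
  by have /forallP/(_ (Ordinal hj))/eqP := ht (Ordinal (leq_trans hi hK)).
split=> //; apply: partmonom_inj; rewrite -e; apply/eqP/cmP => i.
rewrite partmonomE tabmonomE et count_flatten -map_comp sumnE big_map.
rewrite (eq_bigr (fun k => if k == i then nth 0%N nu i else 0%N)); last first.
  move=> k _ /=; rewrite count_nseq /= eq_sym.
  by case: eqP => [->|]; rewrite ?mul1n ?mul0n.
rewrite -big_mkcond /= big_const_seq count_uniq_mem ?iota_uniq // mem_iota.
rewrite add0n leq0n /=; case: (ltnP i (size nu)) => hi /=; first by rewrite addn0.
by rewrite (nth_default 0%N hi).
Qed.

Fact highest_subproof (la : part) :
  is_ssyt la (mkseq (fun i => nseq (nth 0%N la i) i) (size la)).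
Proof.
apply/and3P; split.
- apply/eqP/(@eq_from_nth _ 0%N) => [|i]; rewrite size_map size_mkseq // => hi.
  by rewrite (nth_map [::]) ?size_mkseq // nth_mkseq // size_nseq.
- apply/allP => r /mapP[i _ ->]; apply/(sortedP 0%N) => j.
  by rewrite size_nseq => hj; rewrite !nth_nseq hj (ltnW hj).
- apply/(sortedP [::]) => i; rewrite size_mkseq => hi.
  rewrite !nth_mkseq ?(ltnW hi) //; apply/(all_nthP (0%N, 0%N)) => j.
  rewrite nth_zip_cond size_zip !size_nseq => hj; rewrite hj /= !nth_nseq.
  by move: hj; rewrite leq_min => /andP[-> ->].
Qed.

Definition highest (la : part) : ssyt la := SSYT (highest_subproof la).

Lemma highestE (la : part) : tabmonom (highest la) = partmonom la.
Proof.
apply/eqP/cmP => i.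
rewrite partmonomE tabmonomE count_flatten -map_comp sumnE big_map.
rewrite (eq_bigr (fun k => if k == i then nth 0%N la i else 0%N)); last first.
  move=> k _ /=; rewrite count_nseq /= eq_sym.
  by case: eqP => [->|]; rewrite ?mul1n ?mul0n.
rewrite -big_mkcond /= big_const_seq count_uniq_mem ?iota_uniq // mem_iota.
rewrite add0n leq0n /=; case: (ltnP i (size la)) => hi /=; first by rewrite addn0.
by rewrite (nth_default 0%N hi).
Qed.

Lemma schur_extremal K (la nu : part) :
  (size nu <= K)%N -> (cmwt K (partmonom nu) <= cmwt K (partmonom la))%N ->
  schur nu (partmonom la) = (nu == la)%:R.
Proof.
move=> hK hle; rewrite /schur; case: eqP => [e|ne]; last first.
  rewrite (_ : [set t | _] = set0) ?fsbig_set0 //.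
  by rewrite -subset0 => t /= /(ssyt_extremal hK hle)[].
rewrite (_ : [set t | _] = [set highest nu]) ?fsbig_set1 //.
apply/seteqP; split=> t /=; last by move=> ->; rewrite highestE e.
by move=> /(ssyt_extremal hK hle)[_ h]; apply/val_inj.
Qed.

Lemma schur_expansion0 (c : {malg int[part]}) :
  schur_expansion (fun=> 0) c -> c = 0.
Proof.
move=> hc; case: (fset_0Vmem (msupp c)) => [c0|[la0 h0]].
  by apply/malgP => la; rewrite mcoeff0 mcoeff_outdom // c0 in_fset0.
pose K := \max_(la <- msupp c) size la.
pose W la := cmwt K (partmonom la).
have [la hla hmax] : exists2 la, la \in msupp c &
    forall nu, nu \in msupp c -> (W nu <= W la)%N.
  have [la _ /(_ _ isT) h] :=
    @arg_maxnP (msupp c) (FSetSub h0) xpredT (fun x => W (val x)) isT.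
  exists (val la) => [|nu hnu]; first exact: valP.
  by have := h (FSetSub hnu).
have hK nu : nu \in msupp c -> (size nu <= K)%N.
  by move=> hnu; rewrite /K (big_fsetD1 nu) //= leq_maxl.
have := hc (partmonom la).
rewrite (big_fsetD1 la) //= (schur_extremal (hK _ hla)) //.
rewrite eqxx mulr1 big_seq big1 ?addr0 => [/esym/eqP|nu].
  by move: hla; rewrite -mcoeff_neq0 => /negbTE ->.
rewrite in_fsetD1 => /andP[ne hnu].
by rewrite (schur_extremal (hK _ hnu)) ?hmax // (negbTE ne) mulr0.
Qed.

Lemma schur_expansion_inj f (c d : {malg int[part]}) :
  schur_expansion f c -> schur_expansion f d -> c = d.
Proof.
move=> hc hd; apply/eqP; rewrite -subr_eq0; apply/eqP/schur_expansion0 => b.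
have wid (e : {malg int[part]}) (E : {fset part}) : (msupp e `<=` E)%fset ->
    \sum_(la <- msupp e) e@_la * schur la b = \sum_(la <- E) e@_la * schur la b.
  move=> he; apply: big_fset_incl => // la _ /mcoeff_outdom ->.
  by rewrite mul0r.
pose E := (msupp c `|` msupp d `|` msupp (c - d))%fset.
rewrite (wid _ E) ?fsubsetUr //.
under eq_bigr => la _ do rewrite mcoeffB mulrBl.
have hcE : (msupp c `<=` E)%fset by rewrite /E -fsetUA fsubsetUl.
have hdE : (msupp d `<=` E)%fset by rewrite /E fsetUAC fsubsetUr.
by rewrite sumrB -(wid c E hcE) -(wid d E hdE) -hc -hd subrr.
Qed.

Lemma schur_coordsP f c : schur_expansion f c -> schur_coords f = c.
Proof.
move=> hc; apply: (schur_expansion_inj _ hc).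
exact: (@xgetPex _ 0 [set c | schur_expansion f c] (ex_intro _ c hc)).
Qed.

Lemma hall_schur la nu : hall (schur la) (schur nu) = (la == nu)%:R.
Proof.
have e p : schur_coords (schur p) = << p >>%R.
  apply: schur_coordsP => b.
  by rewrite msuppU oner_eq0 big_seq_fset1 mcoeffU eqxx mul1r.
by rewrite /hall !e msuppU oner_eq0 big_seq_fset1 !mcoeffU eqxx mul1r eq_sym.
Qed.

(* Main.v *)
Require Import Defs.
From HB Require Import structures.
From mathcomp Require Import all_boot all_order all_fingroup all_algebra.
From mathcomp Require Import finmap.
From mathcomp Require Import boolp classical_sets functions cardinality fsbigop.
From mathcomp Require Import -(notations) monalg.
From mathcomp Require Import mpoly.
From mathcomp Require Import ring lra zify.

Set Implicit Arguments.
Unset Strict Implicit.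
Unset Printing Implicit Defensive.

Import Order.TTheory GRing.Theory Num.Theory.
Local Open Scope ring_scope.

Local Notation "m # s" := [multinom m (s i) | i < _]
  (at level 40, left associativity, format "m # s").

(** Let N be large and let W be the polynomial representation of gl_N with
    character s_mu.  Then s_(n) o s_mu is the character of Sym^n W, and the
    coefficient of s_la in it is the dimension of the space of highest weight
    vectors of weight la in Sym^n W.  Now Sym W is a polynomial ring on which
    gl_N acts by derivations.  Hence the product of highest weight vectors of
    weights la and la' and degrees n and n' is a highest weight vector of weight
    la + la' and degree n + n'; and multiplication by a fixed nonzero vector is
    injective, because a polynomial ring is a domain.  This is
    [rank_hwproj_mul], and it is the whole proof once multiplicities are known to
    be dimensions ([hall_plethysm]).

    Multiplicities as dimensions.  With a the Vandermonde alternant, the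
    coefficient of s_l in a symmetric polynomial F is the coefficient
    [altcoeff l F] of x^(l + delta) in a F.  For a representation of gl_N and a
    matrix Q commuting with the action, let X_Q be the generating function of the
    traces of Q on the weight spaces.  Cyclicity of the trace shows that replacing
    Q by Q C, where C is the Casimir element, acts on a X_Q as a Laplacian with
    shifted eigenvalues ([casimir_alt], [altcoeff_casimir]).  On highest weight
    vectors C takes a value which is strictly increasing for the dominance order
    on dominant weights ([above_casval]).  So some polynomial q in C kills
    every weight space above l and does not vanish at the value of C belonging
    to l.  Up to a scalar, q(C) is then the projection of the weight space of l
    onto its highest weight vectors ([hwproj]), and in the coefficient at
    l + delta of a X_(Q q(C)) a single term survives, which gives
    tr (Q hwproj) = altcoeff l X_Q ([trace_hwproj]).

    Tableaux.  A sign-reversing involution gives Pieri's rule ([pieri]).  It shows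
    that altcoeff l of a product of complete homogeneous polynomials h_(a_i) is
    the number of semistandard tableaux of shape l and content a
    ([altcoeff_homogeneous_prod], [count_ptab]).  Two consequences follow: Schur
    polynomials are symmetric, since the product does not depend on the order of
    its factors ([schur_symmetric]), and altcoeff l s_nu is 1 if nu = l and 0
    otherwise ([altcoeff_schur]), since the number of matrices with given row and
    column sums is symmetric in the two margins.  So altcoeff computes coordinates
    in the Schur basis ([hall_altcoeff]).

    The representation W.  Let gl_N act on the left and on the right on the
    polynomials of degree |mu| in an N x N matrix of variables.  W is the image of
    the projection onto the highest weight vectors of weight mu for the right
    action; it is stable under the left action.  The weight space of a for the
    left action has right character the product of the h_(a_i), so by the trace
    formula and Pieri's rule the multiplicity of the weight a in W is the number
    of tableaux of shape mu and content a ([card_schurmod]). *)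

(** * Alternants and Euler operators *)

Definition delta (N : nat) : 'X_{1..N} := [multinom (N - i.+1)%N | i < N].

(** Locked, because a determinant unfolds to a sum and the rewrite rules for
    sums would see through it. *)
HB.lock Definition alt (N : nat) : {mpoly rat[N]} :=
  \det (\matrix_(i < N, j < N) 'X_i ^+ delta N j).

Section Alternant.

Variable N : nat.
Implicit Types (p q : {mpoly rat[N]}) (m l k : 'X_{1..N}).

Local Notation delta := (delta N).
Local Notation alt := (alt N).

(** For F = sum_nu c_nu s_nu this is c_l, since a s_nu is the alternant with
    leading exponent nu + delta.  The definition makes sense for every F. *)
Definition altcoeff l p : rat := (alt * p)@_(l + delta).

Lemma mcoeffXM m p k :
  ('X_[m] * p)@_k = if (m <= k)%MM then p@_(k - m) else 0.
Proof.
case: ifP => [le_mk|/negP not_le].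
  by rewrite mulrC -{1}(submK le_mk) addmC mcoeffMX.
apply/eqP; rewrite mcoeff_eq0; apply/negP => /msuppM_le.
case/allpairsP=> -[m1 m2] /= [].
rewrite msuppX inE => /eqP-> _ e; apply: not_le.
by rewrite e lem_addr.
Qed.

Lemma alt_sum : alt = \sum_(s : 'S_N) (-1) ^+ s *: 'X_[(delta#s)].
Proof.
rewrite unlock; apply: eq_bigr => s _; rewrite -signr_odd; set b := odd _.
rewrite -mul_mpolyC rmorphXn rmorphN1 signr_odd; congr (_ * _).
rewrite mpolyXE_id; apply: eq_bigr => i _.
by rewrite mxE mnmE.
Qed.

Lemma mcoeff_altM p k : (alt * p)@_k =
  \sum_(s : 'S_N) (-1) ^+ s * (if (delta#s <= k)%MM then p@_(k - delta#s) else 0).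
Proof.
rewrite alt_sum mulr_suml raddf_sum /=; apply: eq_bigr => s _.
by rewrite -scalerAl mcoeffZ mcoeffXM.
Qed.

Lemma msym_alt (t : 'S_N) : msym t alt = (-1) ^+ t *: alt.
Proof.
rewrite {1}alt_sum raddf_sum /= alt_sum scaler_sumr.
rewrite (reindex_inj (mulgI t)) /=; apply: eq_bigr => s _.
rewrite msymZ msymX scalerA odd_permM signr_addb; congr (_ *: 'X_[_]).
by rewrite mpermM mpermKV.
Qed.

Definition euler i p : {mpoly rat[N]} := 'X_i * p^`M(i).

Lemma mcoeff_euler i p k : (euler i p)@_k = (k i)%:R * p@_k.
Proof.
rewrite /euler mcoeffXM lep1mP.
case: eqP => [->|/eqP nz] /=; first by rewrite mul0r.
have le : (U_(i) <= k)%MM by rewrite lep1mP.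
rewrite mcoeff_deriv submK // mulr_natl; congr (_ *+ _).
by rewrite mnmBE mnm1E eqxx subn1 prednK // lt0n.
Qed.

Lemma eulerX i m : euler i 'X_[m] = (m i)%:R *: 'X_[m].
Proof.
apply/mpolyP => k; rewrite mcoeff_euler mcoeffZ mcoeffX.
by case: eqP => [->|]; rewrite ?mulr0.
Qed.

Lemma eulerM i p q : euler i (p * q) = euler i p * q + p * euler i q.
Proof. by rewrite /euler mderivM; ring. Qed.

Lemma eulerD i : {morph euler i : p q / p + q}.
Proof. by move=> p q; rewrite /euler mderivD mulrDr. Qed.

Lemma eulerB i : {morph euler i : p q / p - q}.
Proof. by move=> p q; rewrite /euler mderivB mulrBr. Qed.

Lemma eulerZ i c p : euler i (c *: p) = c *: euler i p.
Proof. by rewrite /euler mderivZ scalerAr. Qed.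

Lemma euler_prod i (I : eqType) (r : seq I) (F : I -> {mpoly rat[N]}) : uniq r ->
  euler i (\prod_(x <- r) F x) =
  \sum_(x <- r) (\prod_(y <- r | y != x) F y) * euler i (F x).
Proof.
elim: r => [|x r IHr] /=.
  by rewrite !big_nil /euler -mpolyC1 mderivC mulr0.
case/andP=> xr ur; rewrite !big_cons eulerM IHr // eqxx /=.
congr (_ + _).
  rewrite mulrC; congr (_ * _).
  rewrite big_seq [RHS]big_seq_cond; apply: eq_bigl => y.
  by case: (boolP (y \in r)) => //= yr; rewrite (memPn xr).
rewrite mulr_sumr; apply: eq_big_seq => y yr.
by rewrite big_cons ifT ?mulrA //; apply: contraNneq xr => ->.
Qed.

Definition posroots : seq ('I_N * 'I_N) :=
  [seq b : 'I_N * 'I_N <- enum {: 'I_N * 'I_N} | (b.1 < b.2)%N].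

Definition rootpoly (b : 'I_N * 'I_N) : {mpoly rat[N]} := 'X_b.1 - 'X_b.2.

Lemma mem_posroots i j : ((i, j) \in posroots) = (i < j)%N.
Proof. by rewrite mem_filter mem_enum andbT. Qed.

Lemma posroots_uniq : uniq posroots.
Proof. by rewrite filter_uniq ?enum_uniq. Qed.

Lemma alt_prod : alt = \prod_(b <- posroots) rootpoly b.
Proof.
pose V : 'M[{mpoly rat[N]}]_N := Vandermonde N (\row_j 'X_(rev_ord j)).
(* Reversing rows, columns and variables brings the exponents into the
   decreasing order of delta. *)
have altV : alt = \det V.
  rewrite -det_tr unlock.
  have sN : injective (@rev_ord N) := rev_ord_inj.
  pose s := perm sN.
  rewrite (_ : (\matrix_(i, j) _) = row_perm s (col_perm s V^T)).
    rewrite row_permE col_permE !det_mulmx !det_perm odd_permV.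
    by rewrite mulrCA -signr_addb addbb mulr1.
  by apply/matrixP => i j; rewrite !mxE !permE mnmE /= rev_ordK.
rewrite altV det_Vandermonde big_filter big_enum_cond /=.
rewrite pair_big_dep /=.
pose h (b : 'I_N * 'I_N) := (rev_ord b.2, rev_ord b.1).
have hK : involutive h by case=> i j; rewrite /h /= !rev_ordK.
rewrite (reindex_inj (inv_inj hK)) /=; apply: eq_big => [[i j]|[i j] _] /=.
  by have := ltn_ord i; have := ltn_ord j; lia.
by rewrite !mxE /rootpoly /= !rev_ordK.
Qed.

Definition cofactorpoly (b : 'I_N * 'I_N) := \prod_(y <- posroots | y != b) rootpoly y.

Lemma alt_cofactor b : b \in posroots -> alt = cofactorpoly b * rootpoly b.
Proof.
by move=> hb; rewrite alt_prod (bigD1_seq b) ?posroots_uniq //= mulrC.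
Qed.

(** The logarithmic derivative of the product formula, with the denominator
    cleared. *)
Lemma euler_alt i : euler i alt =
  \sum_(b <- posroots)
    cofactorpoly b * ((b.1 == i)%:R *: 'X_b.1 - (b.2 == i)%:R *: 'X_b.2).
Proof.
rewrite alt_prod euler_prod ?posroots_uniq //; apply: eq_bigr => b _.
by rewrite /rootpoly eulerB !eulerX !mnm1E.
Qed.

Definition normsq m : nat := \sum_i m i ^ 2.

(** Every exponent of the alternant is a permutation of delta. *)
Lemma laplace_alt : \sum_i euler i (euler i alt) = (normsq delta)%:R *: alt.
Proof.
have linE i : {morph euler i : p q / p + q} := @eulerD i.
rewrite alt_sum scaler_sumr.
rewrite (eq_bigr (fun i => \sum_(s : 'S_N) (-1) ^+ s *: ((delta (s i) ^ 2)%:R *: 'X_[(delta#s)]))).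
  rewrite exchange_big /=; apply: eq_bigr => s _.
  rewrite -scaler_sumr -scaler_suml scalerA mulrC -scalerA; congr (_ *: (_ *: _)).
  rewrite -natr_sum; congr (_%:R); rewrite /normsq [RHS](reindex_inj (@perm_inj _ s)) /=.
  by apply: eq_bigr => i _; rewrite !mnmE.
move=> i _.
have e0 : euler i 0 = 0 by rewrite /euler mderiv0 mulr0.
rewrite (big_morph _ (linE i) e0) (big_morph _ (linE i) e0).
apply: eq_bigr => s _; rewrite !eulerZ eulerX eulerZ eulerX.
by congr (_ *: _); rewrite scalerA -natrM mulnn mnmE.
Qed.

Lemma mcoeff_laplace p k :
  (\sum_i euler i (euler i p))@_k = (normsq k)%:R * p@_k.
Proof.
rewrite raddf_sum /= natr_sum mulr_suml; apply: eq_bigr => i _.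
by rewrite !mcoeff_euler mulrA -natrM mulnn.
Qed.

(** Here p is a twisted character and Y i j the generating function of the
    traces of E_ij E_ji on weight spaces; the hypothesis sums such traces along
    the root string of e_i - e_j, with the denominator 1 - x_j / x_i cleared.
    After multiplication by the alternant, the first-order terms become the
    cross terms in the expansion of the Laplacian of a product, because
    x_i / (x_i - x_j) is a term of the logarithmic derivative of the alternant. *)
Lemma casimir_alt p (Y : 'I_N -> 'I_N -> {mpoly rat[N]}) :
    (forall i j : 'I_N, (i < j)%N ->
       'X_i * Y i j = 'X_j * (Y i j + euler i p - euler j p)) ->
  alt * (\sum_i euler i (euler i p)
         + (\sum_(b <- posroots) (Y b.1 b.2 + euler b.1 p)) *+ 2)
  = \sum_i euler i (euler i (alt * p)) - (normsq delta)%:R *: (alt * p).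
Proof.
move=> hY.
(* The terms of first order, root by root. *)
have cross : alt * (\sum_(b <- posroots) (Y b.1 b.2 + euler b.1 p)) =
             \sum_i euler i alt * euler i p.
  rewrite (eq_bigr (fun i => \sum_(b <- posroots) cofactorpoly b *
    ((b.1 == i)%:R *: 'X_b.1 - (b.2 == i)%:R *: 'X_b.2) * euler i p)); last first.
    by move=> i _; rewrite euler_alt mulr_suml.
  rewrite exchange_big /= mulr_sumr big_seq [RHS]big_seq.
  apply: eq_bigr => -[i j] hb /=; rewrite (alt_cofactor hb).
  have lt_ij : (i < j)%N by rewrite -mem_posroots.
  have -> : \sum_c cofactorpoly (i, j) *
      ((i == c)%:R *: 'X_i - (j == c)%:R *: 'X_j) * euler c p =
      cofactorpoly (i, j) * ('X_i * euler i p - 'X_j * euler j p).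
    rewrite (eq_bigr (fun c => cofactorpoly (i, j) * ((i == c)%:R *: ('X_i * euler c p))
       - cofactorpoly (i, j) * ((j == c)%:R *: ('X_j * euler c p)))); last first.
      by move=> k _; rewrite -mulrA mulrBl mulrBr -!scalerAl.
    rewrite sumrB mulrBr; congr (_ - _).
      rewrite (bigD1 i) //= eqxx scale1r big1 ?addr0 // => k.
      by rewrite eq_sym => /negbTE->; rewrite scale0r mulr0.
    rewrite (bigD1 j) //= eqxx scale1r big1 ?addr0 // => k.
    by rewrite eq_sym => /negbTE->; rewrite scale0r mulr0.
  rewrite -mulrA; congr (_ * _); rewrite /rootpoly /=.
  by rewrite mulrDr mulrBl (hY _ _ lt_ij); ring.
rewrite mulrDr mulrnAr cross.
have -> : \sum_i euler i (euler i (alt * p)) =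
   (\sum_i euler i (euler i alt)) * p + (\sum_i euler i alt * euler i p) *+ 2
   + alt * \sum_i euler i (euler i p).
  rewrite mulr_suml mulr_sumr -sumrMnl -!big_split /=; apply: eq_bigr => i _.
  by rewrite !eulerM eulerD !eulerM; ring.
by rewrite laplace_alt -scalerAl; ring.
Qed.

End Alternant.

(** * Representations of gl_N and the Casimir element *)

(** In a full rank factorization A = B C of an idempotent, C B = 1. *)
Lemma mxtrace_idempotent d (A : 'M[rat]_d) : A *m A = A -> \tr A = (\rank A)%:R.
Proof.
move=> AA; rewrite -{1}(mulmx_base A) mxtrace_mulC.
suff -> : row_base A *m col_base A = 1%:M by rewrite mxtrace1.
apply: (row_free_inj (row_base_free A)); apply/(row_full_inj (col_base_full A)).
by rewrite mul1mx mulmxA mulmxA mulmx_base -mulmxA mulmx_base.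
Qed.

(** A representation of gl_N in a basis of weight vectors; only polynomial
    weights occur below.  Matrices act on row vectors, so that the left factor of
    a product acts first: this is why [glE_rel] has the opposite sign from the
    bracket of elementary matrices. *)
Record glmod (N d : nat) := GlMod {
  glE : 'I_N -> 'I_N -> 'M[rat]_d;
  glw : 'I_d -> 'X_{1..N};
  glE_rel : forall i j k l : 'I_N, glE i j *m glE k l - glE k l *m glE i j =
    (i == l)%:R *: glE k j - (k == j)%:R *: glE i l;
  glE_diag : forall i, glE i i = diag_mx (\row_k (glw k i)%:R) }.

Section PositiveRoots.
Variables (N : nat) (V : zmodType).

Lemma sum_offdiag (G : 'I_N -> 'I_N -> V) :
  \sum_i \sum_j G i j = \sum_i G i i + \sum_(b <- posroots N) (G b.1 b.2 + G b.2 b.1).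
Proof.
rewrite pair_big /= (bigID (fun b : 'I_N * 'I_N => b.1 == b.2)) /=; congr (_ + _).
  rewrite (reindex_onto (fun i => (i, i)) (fun b : 'I_N * 'I_N => b.1)) /=.
    by apply: eq_big => // i; rewrite !eqxx.
  by case=> i j /= /eqP->.
rewrite big_filter big_enum_cond /= big_split /=.
rewrite (bigID (fun b : 'I_N * 'I_N => b.1 < b.2)%N) /=; congr (_ + _).
  by apply: eq_bigl => -[i j] /=; rewrite -val_eqE /=; lia.
rewrite (reindex_inj (h := fun b => (b.2, b.1))) /=; last by move=> [a b] [c e] [-> ->].
by apply: eq_bigl => -[i j] /=; rewrite -val_eqE /=; lia.
Qed.

Lemma sum_posroots1 (F : 'I_N -> V) :
  \sum_(b <- posroots N) F b.1 = \sum_i F i *+ delta N i.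
Proof.
rewrite big_filter big_enum_cond /=.
rewrite -(pair_big_dep xpredT (fun i j : 'I_N => i < j)%N (fun i j => F i)) /=.
apply: eq_bigr => i _; rewrite sumr_const; congr (_ *+ _); rewrite mnmE.
by rewrite -sum1_card -(big_geq_mkord i.+1 N xpredT (fun=> 1%N)) sum_nat_const_nat muln1.
Qed.

Lemma sum_posroots_sym (F : 'I_N -> V) :
  \sum_(b <- posroots N) (F b.1 + F b.2) = \sum_i F i *+ N.-1.
Proof.
have := sum_offdiag (fun i _ => F i).
rewrite (eq_bigr (fun i => F i *+ N.-1 + F i)) => [|i _]; last first.
  rewrite sumr_const card_ord -mulrSr prednK //; exact: leq_trans (ltn_ord i).
rewrite big_split /= addrC => /addrI; exact: esym.
Qed.

End PositiveRoots.

Section GlModule.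

Variables (N d : nat) (M : glmod N d).
Local Notation E := (glE M).
Local Notation w := (glw M).
Local Notation delta := (delta N).
Implicit Types (A Q : 'M[rat]_d) (v : 'rV[rat]_d).

Lemma glE_swap i j : E j i *m E i j = E i j *m E j i + E i i - E j j.
Proof.
have := glE_rel M i j j i; rewrite !eqxx !scale1r => h.
by rewrite -addrA -[E i i - _]opprB -h opprB addrC subrK.
Qed.

Lemma mulmx_glE_diag r (A : 'M_(r, d)) i k l : (A *m E i i) k l = A k l * (w l i)%:R.
Proof.
rewrite glE_diag mxE (bigD1 l) //= big1 ?addr0 => [|c /negbTE nc].
  by rewrite !mxE eqxx mulr1n.
by rewrite !mxE nc mulr0n mulr0.
Qed.

Lemma glE_diag_mulmx A i k l : (E i i *m A) k l = (w k i)%:R * A k l.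
Proof.
rewrite glE_diag mxE (bigD1 k) //= big1 ?addr0 => [|c]; last rewrite eq_sym => /negbTE nc.
  by rewrite !mxE eqxx mulr1n.
by rewrite !mxE nc mulr0n mul0r.
Qed.

(** The bracket of E_aa with E_ij forces the weight to change by e_i - e_j. *)
Lemma glE_shift i j k l : E i j k l != 0 -> (w l + U_(j) = w k + U_(i))%MM.
Proof.
move=> nz; apply/mnmP => a; rewrite !mnmDE !mnm1E.
have subE (A B : 'M[rat]_d) : (A - B) k l = A k l - B k l by rewrite !mxE.
have scaleE c (A : 'M[rat]_d) : (c *: A) k l = c * A k l by rewrite mxE.
have := congr1 (fun A : 'M_d => A k l) (glE_rel M a a i j).
rewrite /= !subE !scaleE glE_diag_mulmx mulmx_glE_diag.
have -> : (a == j)%:R * E i a k l = (j == a)%:R * E i j k l.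
  by rewrite eq_sym; case: eqP => [->|]; rewrite ?mul0r.
have -> : (i == a)%:R * E a j k l = (i == a)%:R * E i j k l.
  by case: eqP => [->|]; rewrite ?mul0r.
rewrite [_ * (_)%:R]mulrC -!mulrBl => /(mulIf nz) h.
by apply/eqP; rewrite -(eqr_nat rat) !natrD; apply/eqP; lra.
Qed.

(** A matrix commuting with the diagonal elements preserves weight spaces. *)
Lemma glE_diag_comm_weight A a b :
  (forall i, A *m E i i = E i i *m A) -> A a b != 0 -> w b = w a.
Proof.
move=> cA nz; apply/mnmP => i; have := congr1 (fun B : 'M_d => B a b) (cA i).
rewrite /= glE_diag_mulmx mulmx_glE_diag mulrC => /(mulIf nz) h.
by apply/eqP; rewrite -(eqr_nat rat) h.
Qed.

Definition wproj (l : 'X_{1..N}) : 'M[rat]_d := diag_mx (\row_k (w k == l)%:R).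

Lemma wproj_comm A (l : 'X_{1..N}) :
  (forall i, A *m E i i = E i i *m A) -> A *m wproj l = wproj l *m A.
Proof.
move=> cA; apply/matrixP => a b; rewrite mul_mx_diag mul_diag_mx !mxE mulrC.
have [->|nz] := eqVneq (A a b) 0; first by rewrite !mulr0.
by rewrite (glE_diag_comm_weight cA nz).
Qed.

Lemma wproj_mul (l l' : 'X_{1..N}) :
  wproj l *m wproj l' = if l == l' then wproj l else 0.
Proof.
rewrite mulmx_diag; case: eqP => [<-|ne].
  by congr diag_mx; apply/rowP => k; rewrite !mxE; case: eqP => _; rewrite ?mulr1 ?mulr0.
rewrite (_ : \row_k _ = 0) ?raddf0 //; apply/rowP => k; rewrite !mxE.
by case: eqP => [->|_]; rewrite ?mul0r // mul1r; case: eqP.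
Qed.

(** The coefficient at m is the trace of A on the weight space of m; for A = 1
    this is the character. *)
Definition wgen A : {mpoly rat[N]} := \sum_k A k k *: 'X_[w k].

Lemma wgenD A Q : wgen (A + Q) = wgen A + wgen Q.
Proof. by rewrite -big_split; apply: eq_bigr => k _; rewrite mxE scalerDl. Qed.

Lemma wgenZ c A : wgen (c *: A) = c *: wgen A.
Proof. by rewrite scaler_sumr; apply: eq_bigr => k _; rewrite mxE scalerA. Qed.

Lemma wgenB A Q : wgen (A - Q) = wgen A - wgen Q.
Proof. by rewrite -scaleN1r wgenD wgenZ scaleN1r. Qed.

Lemma wgen_sum (I : Type) (r : seq I) (F : I -> 'M_d) :
  wgen (\sum_(i <- r) F i) = \sum_(i <- r) wgen (F i).
Proof.
apply: (big_morph wgen wgenD); rewrite /wgen big1 // => k _.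
by rewrite mxE scale0r.
Qed.

Lemma mcoeff_wgen A m : (wgen A)@_m = \sum_(k | w k == m) A k k.
Proof.
rewrite raddf_sum [RHS]big_mkcond; apply: eq_bigr => k _ /=.
by rewrite mcoeffZ mcoeffX; case: eqP; rewrite ?mulr1 ?mulr0.
Qed.

Lemma wgen_diag A i : wgen (A *m E i i) = euler i (wgen A).
Proof.
apply/mpolyP => m; rewrite mcoeff_euler !mcoeff_wgen mulr_sumr.
by apply: eq_bigr => k /eqP <-; rewrite mulmx_glE_diag mulrC.
Qed.

(** Cyclicity of the trace: E_ij moves the weight by e_i - e_j, and the
    variables record the shift. *)
Lemma wgen_cyclic A i j : 'X_j * wgen (A *m E i j) = 'X_i * wgen (E i j *m A).
Proof.
rewrite !mulr_sumr.
rewrite (eq_bigr (fun k => \sum_l (A k l * E i j l k) *: 'X_[w k + U_(j)])); last first.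
  by move=> k _; rewrite mxE -scalerAr scaler_suml mulrC -mpolyXD.
rewrite exchange_big /=; apply: eq_bigr => l _.
rewrite mxE -scalerAr scaler_suml mulrC -mpolyXD; apply: eq_bigr => k _.
have [->|nz] := eqVneq (E i j l k) 0; first by rewrite mulr0 mul0r !scale0r.
by rewrite (glE_shift nz) mulrC.
Qed.

Definition centralises A := forall i j, A *m E i j = E i j *m A.

(** The multiple of the central element sum_i E_ii makes the eigenvalues
    involve delta = (N - 1, ..., 0) in place of half the sum of the positive
    roots. *)
Definition casimir : 'M[rat]_d :=
  \sum_i \sum_j E i j *m E j i + \sum_i E i i *+ N.-1.

Lemma casimirE : casimir =
  \sum_i E i i *m E i i + (\sum_(b <- posroots N) (E b.1 b.2 *m E b.2 b.1 + E b.1 b.1)) *+ 2.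
Proof.
rewrite /casimir sum_offdiag -addrA; congr (_ + _).
rewrite -sum_posroots_sym -big_split /= -sumrMnl; apply: eq_bigr => -[i j] _ /=.
by rewrite glE_swap mulr2n; apply/matrixP => a b; rewrite !mxE; ring.
Qed.

Lemma casimir_central : centralises casimir.
Proof.
move=> k l; apply/eqP; rewrite -subr_eq0; apply/eqP.
rewrite mulmxDl mulmxDr opprD addrACA.
have -> : (\sum_i E i i *+ N.-1) *m E k l - E k l *m (\sum_i E i i *+ N.-1) = 0.
  rewrite sumrMnl -!scaler_nat -scalemxAl -scalemxAr -scalerBr.
  rewrite mulmx_suml mulmx_sumr -sumrB.
  rewrite (eq_bigr (fun i => (i == l)%:R *: E k i - (k == i)%:R *: E i l)) => [|i _].
    rewrite sumrB (bigD1 l) //= [X in _ - X](bigD1 k) //= !eqxx !scale1r.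
    rewrite !big1 ?addr0 ?subrr ?scaler0 // => i.
      by rewrite eq_sym => /negbTE->; rewrite scale0r.
    by move/negbTE->; rewrite scale0r.
  by rewrite glE_rel.
rewrite addr0 mulmx_suml mulmx_sumr -sumrB.
rewrite (eq_bigr (fun i => \sum_j (E i j *m ((j == l)%:R *: E k i - (k == i)%:R *: E j l)
   + ((i == l)%:R *: E k j - (k == j)%:R *: E i l) *m E j i))); last first.
  move=> i _; rewrite mulmx_suml mulmx_sumr -sumrB; apply: eq_bigr => j _.
  by rewrite -!glE_rel mulmxBl mulmxBr !mulmxA addrA subrK.
have s1 : \sum_i \sum_j E i j *m ((j == l)%:R *: E k i) = \sum_i E i l *m E k i.
  apply: eq_bigr => i _; rewrite (bigD1 l) //= eqxx scale1r big1 ?addr0 // => j /negbTE->.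
  by rewrite scale0r mulmx0.
have s2 : \sum_i \sum_j E i j *m ((k == i)%:R *: E j l) = \sum_j E k j *m E j l.
  rewrite (bigD1 k) //= [X in _ + X]big1 ?addr0 => [|i]; last rewrite eq_sym => /negbTE nk.
    by apply: eq_bigr => j _; rewrite eqxx scale1r.
  by rewrite big1 // => j _; rewrite nk scale0r mulmx0.
have s3 : \sum_i \sum_j ((i == l)%:R *: E k j) *m E j i = \sum_j E k j *m E j l.
  rewrite (bigD1 l) //= [X in _ + X]big1 ?addr0 => [|i /negbTE nk].
    by apply: eq_bigr => j _; rewrite eqxx scale1r.
  by rewrite big1 // => j _; rewrite nk scale0r mul0mx.
have s4 : \sum_i \sum_j ((k == j)%:R *: E i l) *m E j i = \sum_i E i l *m E k i.
  apply: eq_bigr => i _; rewrite (bigD1 k) //= eqxx scale1r big1 ?addr0 // => j.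
  by rewrite eq_sym => /negbTE->; rewrite scale0r mul0mx.
rewrite (eq_bigr (fun i => (\sum_j E i j *m ((j == l)%:R *: E k i)
     - \sum_j E i j *m ((k == i)%:R *: E j l))
   + (\sum_j ((i == l)%:R *: E k j) *m E j i - \sum_j ((k == j)%:R *: E i l) *m E j i))).
  by rewrite big_split /= !sumrB s1 s2 s3 s4 addrC subrKA subrr.
by move=> i _; rewrite -!sumrB -big_split; apply: eq_bigr => j _; rewrite mulmxBl mulmxBr.
Qed.

Definition casval (l : 'X_{1..N}) : rat := (normsq (l + delta))%:R - (normsq delta)%:R.

(** As Q commutes with the action, cyclicity of the trace and the bracket of
    E_ij with E_ji give the recursion needed by [casimir_alt]. *)
Lemma altcoeff_casimir Q l : centralises Q ->
  altcoeff l (wgen (Q *m casimir)) = casval l * altcoeff l (wgen Q).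
Proof.
move=> cQ; pose Y i j := wgen (Q *m E i j *m E j i).
have hY i j : 'X_i * Y i j = 'X_j * (Y i j + euler i (wgen Q) - euler j (wgen Q)).
  rewrite /Y wgen_cyclic mulmxA -cQ -mulmxA glE_swap mulmxBr mulmxDr wgenB wgenD.
  by rewrite !wgen_diag mulmxA.
rewrite /altcoeff casimirE mulmxDr mulr2n mulmxDr -mulr2n mulmx_sumr.
rewrite wgenD mulr2n wgenD -mulr2n mulmx_sumr !wgen_sum.
rewrite [X in X + _](eq_bigr (fun i => euler i (euler i (wgen Q)))); last first.
  by move=> i _; rewrite mulmxA !wgen_diag.
rewrite [X in X *+ 2](eq_bigr (fun b => Y b.1 b.2 + euler b.1 (wgen Q))); last first.
  by move=> b _; rewrite mulmxDr wgenD wgen_diag mulmxA.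
rewrite (casimir_alt (fun i j _ => hY i j)) mcoeffB mcoeff_laplace mcoeffZ.
by rewrite -mulrBl.
Qed.

(** Polynomials in the Casimir element, given by their roots. *)
Definition casprod (cs : seq rat) : 'M[rat]_d :=
  foldr (fun c A => (casimir - c%:M) *m A) 1%:M cs.

Definition casprodval (cs : seq rat) (l : 'X_{1..N}) : rat := \prod_(c <- cs) (casval l - c).

Lemma casprod_cat cs cs' : casprod (cs ++ cs') = casprod cs *m casprod cs'.
Proof. by elim: cs => [|c cs IH] /=; rewrite ?mul1mx // IH mulmxA. Qed.

Lemma casprod_comm A cs : centralises A -> A *m casprod cs = casprod cs *m A.
Proof.
move=> cA; have cC : A *m casimir = casimir *m A.
  rewrite mulmxDl mulmxDr; congr (_ + _); rewrite mulmx_sumr mulmx_suml.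
    apply: eq_bigr => i _; rewrite mulmx_sumr mulmx_suml; apply: eq_bigr => j _.
    by rewrite mulmxA cA -mulmxA cA mulmxA.
  by apply: eq_bigr => i _; rewrite -!scaler_nat -scalemxAr -scalemxAl cA.
elim: cs => [|c cs IH] /=; first by rewrite mulmx1 mul1mx.
by rewrite mulmxA mulmxBr cC scalar_mxC -mulmxBl -!mulmxA IH.
Qed.

Lemma casprod_central cs : centralises (casprod cs).
Proof.
move=> i j; elim: cs => [|c cs IH] /=; first by rewrite mulmx1 mul1mx.
by rewrite -mulmxA IH !mulmxA mulmxBl mulmxBr casimir_central -scalar_mxC.
Qed.

Lemma altcoeff_casprod Q cs l : centralises Q ->
  altcoeff l (wgen (Q *m casprod cs)) = casprodval cs l * altcoeff l (wgen Q).
Proof.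
move=> cQ; elim: cs Q cQ => [|c cs IH] Q cQ /=.
  by rewrite mulmx1 /casprodval big_nil mul1r.
have cQ' : centralises (Q *m (casimir - c%:M)).
  move=> i j; rewrite -mulmxA mulmxBl casimir_central -scalar_mxC -mulmxBr.
  by rewrite [LHS]mulmxA cQ mulmxA.
rewrite mulmxA IH // /casprodval big_cons mulmxBr wgenB /altcoeff mulrBr mcoeffB.
rewrite -[X in X - _]/(altcoeff l _) altcoeff_casimir // mul_mx_scalar wgenZ.
by rewrite -scalerAr mcoeffZ -/(altcoeff l _); ring.
Qed.


Definition has_weight v (l : 'X_{1..N}) := forall k, v 0 k != 0 -> w k = l.

Definition highest_weight v (l : 'X_{1..N}) :=
  has_weight v l /\ forall i j : 'I_N, (i < j)%N -> v *m E i j = 0.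

Lemma has_weight_diag v l i : has_weight v l -> v *m E i i = (l i)%:R *: v.
Proof.
move=> hv; apply/rowP => k; rewrite glE_diag mul_mx_diag !mxE mulrC.
by have [->|/hv->//] := eqVneq (v 0 k) 0; rewrite !mulr0.
Qed.

Lemma casval_posroots l :
  casval l = \sum_i (l i)%:R ^+ 2 + (\sum_(b <- posroots N) (l b.1)%:R) *+ 2.
Proof.
rewrite (sum_posroots1 (fun i => (l i)%:R : rat)) -sumrMnl -big_split /=.
rewrite /casval /normsq !natr_sum -sumrB; apply: eq_bigr => i _.
by rewrite mnmDE !natrX natrD; ring.
Qed.

Lemma highest_weight_casimir v l : highest_weight v l ->
  v *m casimir = casval l *: v.
Proof.
move=> [hv ev]; rewrite casimirE mulmxDr mulr2n mulmxDr -mulr2n !mulmx_sumr.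
rewrite casval_posroots scalerDl scaler_suml; congr (_ + _).
  apply: eq_bigr => i _; rewrite mulmxA (has_weight_diag _ hv) -scalemxAl.
  by rewrite (has_weight_diag _ hv) scalerA.
rewrite -scalerMnl scaler_suml; congr (_ *+ 2).
apply: eq_big_seq => -[i j]; rewrite mem_posroots /= => lt_ij.
by rewrite mulmxDr mulmxA ev // mul0mx add0r (has_weight_diag _ hv).
Qed.

Lemma highest_weight_casprod v l cs : highest_weight v l ->
  v *m casprod cs = casprodval cs l *: v.
Proof.
move=> hv; elim: cs => [|c cs IH] /=; first by rewrite mulmx1 /casprodval big_nil scale1r.
rewrite mulmxA mulmxBr (highest_weight_casimir hv) mul_mx_scalar -scalerBl.
by rewrite -scalemxAl IH scalerA /casprodval big_cons.
Qed.

Definition dominant (l : 'X_{1..N}) := forall i j : 'I_N, (i < j)%N -> (l j <= l i)%N.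

(** The argument of sl_2: if l_i < l_j then no power of E_ji kills v, because
    E_ij maps its images back to nonzero multiples; but the entry i of the weight
    decreases at each step and has to stay nonnegative. *)
Lemma highest_weight_dominant v l : v != 0 -> highest_weight v l -> dominant l.
Proof.
move=> nzv [hv ev] i j lt_ij; rewrite leqNgt; apply/negP => lt_l.
have neq_ij : (i == j) = false by apply/negbTE; rewrite -val_eqE neq_ltn lt_ij.
(* u n is the image of v under the n-th power of E_ji. *)
pose u n := iter n (mulmx^~ (E j i)) v.
have wu n k : u n 0 k != 0 -> (w k i + n = l i)%N /\ (w k j = l j + n)%N.
  elim: n k => [|n IH] k /=; first by move/hv->; rewrite !addn0.
  move=> nz; have [a nza] : exists a, u n 0 a * E j i a k != 0.
    apply/existsP; apply: contra_neqT nz => /existsPn h.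
    by rewrite mxE big1 // => a _; have := h a; rewrite negbK => /eqP.
  have [va ea] : u n 0 a != 0 /\ E j i a k != 0.
    by move: nza; rewrite mulf_eq0 negb_or => /andP.
  have [h1 h2] := IH _ va; have /mnmP h := glE_shift ea.
  have := h i; have := h j; rewrite !mnmDE !mnm1E !eqxx neq_ij eq_sym neq_ij.
  by lia.
have du n : u n *m E i i - u n *m E j j = ((l i)%:R - (l j)%:R - n%:R *+ 2) *: u n.
  apply/rowP => k.
  have -> : (u n *m E i i - u n *m E j j) 0 k = (u n *m E i i) 0 k - (u n *m E j j) 0 k.
    by rewrite [LHS]mxE [X in _ + X]mxE.
  rewrite !mulmx_glE_diag [RHS]mxE.
  have [->|/wu[h1 h2]] := eqVneq (u n 0 k) 0; first by rewrite !mul0r mulr0 subr0.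
  by rewrite -h1 h2 !natrD mulr2n; ring.
have eu n : u n.+1 *m E i j = (n.+1%:R * ((l i)%:R - (l j)%:R - n%:R)) *: u n.
  elim: n => [|n IH].
    rewrite /= -mulmxA glE_swap mulmxBr mulmxDr mulmxA ev // mul0mx add0r.
    by rewrite (du 0%N) /=; congr (_ *: _); ring.
  rewrite (_ : u n.+2 = u n.+1 *m E j i) // -mulmxA glE_swap mulmxBr mulmxDr mulmxA IH -addrA du.
  rewrite -scalemxAl [u n *m _]/(u n.+1) -scalerDl; congr (_ *: _).
  by rewrite -[n.+2]addn2 -[n.+1]addn1 !natrD; ring.
have nzu n : u n != 0.
  elim: n => [|n IH]; first exact: nzv.
  apply: contra_neq IH => u0; have := eu n; rewrite u0 mul0mx => /esym/eqP.
  rewrite scaler_eq0 mulf_eq0 pnatr_eq0 /= => /orP[|/eqP//].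
  rewrite -addrA -opprD -natrD subr_eq0 eqr_nat => /eqP h.
  by move: lt_l; rewrite h ltnNge leq_addr.
have [k nzk] : exists k, u (l i).+1 0 k != 0.
  apply/existsP; apply: contraNT (nzu (l i).+1) => /existsPn h.
  by apply/eqP/rowP => k; rewrite [RHS]mxE; apply/eqP; have := h k; rewrite negbK.
by have [h _] := wu _ _ nzk; lia.
Qed.

End GlModule.

(** * The projection onto highest weight vectors *)

Section Dominance.
Variable N : nat.
Implicit Types l m : 'X_{1..N}.
Local Notation delta := (delta N).

(** m - l is a nonzero sum of positive roots e_i - e_j with multiplicities n i j. *)
Definition above l m := exists n : 'I_N -> 'I_N -> nat,
  [/\ forall i j : 'I_N, n i j != 0%N -> (i < j)%N,
      exists i j, n i j != 0%N &
      forall i, (m i + \sum_j n j i = l i + \sum_j n i j)%N].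

Lemma sum_root (i j p : 'I_N) :
  (\sum_q ((q == i) && (p == j)) = (p == j))%N /\
  (\sum_q ((p == i) && (q == j)) = (p == i))%N.
Proof.
split; first by rewrite (bigD1 i) //= eqxx big1 ?addn0 // => q /negbTE->.
by rewrite (bigD1 j) //= eqxx andbT big1 ?addn0 // => q /negbTE->; rewrite andbF.
Qed.

Lemma above_root l m (i j : 'I_N) c : (i < j)%N -> (0 < c)%N ->
  (forall p, m p + (p == j) * c = l p + (p == i) * c)%N -> above l m.
Proof.
move=> lt_ij c_gt0 h; exists (fun p q => ((p == i) && (q == j)) * c)%N; split.
- by move=> p q; case: andP => // -[/eqP-> /eqP->].
- by exists i, j; rewrite !eqxx mul1n -lt0n.
by move=> p; rewrite -!big_distrl /= (sum_root i j p).1 (sum_root i j p).2 h.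
Qed.

Lemma above_raise l m m' (i j : 'I_N) : (i < j)%N -> above l m ->
  (m' + U_(j) = m + U_(i))%MM -> above l m'.
Proof.
move=> lt_ij [n [n_pos [a [b nab]] hn]] hm.
exists (fun p q => n p q + ((p == i) && (q == j)))%N; split.
- move=> p q; rewrite addn_eq0 negb_and => /orP[/n_pos//|].
  by case: andP => // -[/eqP-> /eqP->].
- by exists a, b; rewrite addn_eq0 negb_and nab.
move=> p; have := hn p; rewrite !big_split /=.
rewrite (sum_root i j p).1 (sum_root i j p).2.
have /mnmP/(_ p) := hm; rewrite !mnmDE !mnm1E [j == p]eq_sym [i == p]eq_sym.
lia.
Qed.

(** The difference of the two values is <m - l, m + l + 2 delta>, and
    m + l + 2 delta is strictly decreasing. *)
Lemma above_casval l m : dominant l -> dominant m -> above l m ->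
  casval l < casval m.
Proof.
move=> dl dm [n [n_pos [a [b nab]] hn]]; rewrite -subr_gt0.
pose y i : rat := (m i)%:R + (l i)%:R + (delta i)%:R *+ 2.
have e i : (m i)%:R - (l i)%:R = \sum_j (n i j)%:R - \sum_j (n j i)%:R :> rat.
  have := congr1 (fun k => k%:R : rat) (hn i); rewrite !natrD !natr_sum; lra.
have -> : casval m - casval l = \sum_i \sum_j (n i j)%:R * (y i - y j).
  have -> : casval m - casval l = \sum_i ((m i)%:R - (l i)%:R) * y i.
    rewrite /casval opprB addrA subrK /normsq !natr_sum -sumrB.
    by apply: eq_bigr => i _; rewrite !mnmDE !natrX !natrD /y; ring.
  rewrite (eq_bigr (fun i => \sum_j (n i j)%:R * y i - \sum_j (n j i)%:R * y i)).
    rewrite sumrB [X in _ - X]exchange_big -sumrB; apply: eq_bigr => i _.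
    by rewrite -sumrB; apply: eq_bigr => j _; rewrite mulrBr.
  by move=> i _; rewrite e mulrBl !mulr_suml.
have yE (i j : 'I_N) : (i < j)%N -> y j < y i.
  move=> lt_ij; rewrite /y.
  have h1 : (l j)%:R <= (l i)%:R :> rat by rewrite ler_nat dl.
  have h2 : (m j)%:R <= (m i)%:R :> rat by rewrite ler_nat dm.
  have h3 : (delta j)%:R < (delta i)%:R :> rat.
    by rewrite ltr_nat !mnmE; have := ltn_ord j; lia.
  by lra.
have pos i j : 0 <= (n i j)%:R * (y i - y j).
  have [->|/n_pos/yE h] := eqVneq (n i j) 0%N; first by rewrite mul0r.
  by rewrite mulr_ge0 ?ler0n ?subr_ge0 ?ltW.
rewrite (bigD1 a) //= (bigD1 b) //= -addrA ltr_pwDl //.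
  by rewrite mulr_gt0 ?ltr0n ?lt0n ?subr_gt0 ?yE ?n_pos.
by rewrite addr_ge0 ?sumr_ge0 // => i _; rewrite sumr_ge0.
Qed.

(** delta - s delta is the sum of the positive roots that s inverts. *)
Lemma delta_perm_above l (s : 'S_N) : s != 1%g -> (delta#s <= l + delta)%MM ->
  above l (l + delta - delta#s)%MM.
Proof.
move=> ns /mnm_lepP le; exists (fun i j : 'I_N => (i < j) && (s j < s i) : nat)%N.
have key (i : 'I_N) : (s i + \sum_(j < N) ((j < i) && (s i < s j)) =
              i + \sum_(j < N) ((i < j) && (s j < s i)))%N.
  have cnt (k : 'I_N) : (\sum_(j < N) (j < k) = k)%N.
    transitivity (\sum_(j < k) 1)%N; last by rewrite sum1_card card_ord.
    rewrite (big_ord_widen N (fun=> 1%N)) 1?ltnW // [RHS]big_mkcond.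
    by apply: eq_bigr => j _; case: ltnP.
  have e1 : (\sum_(j < N) (s j < s i) = s i)%N by rewrite -[RHS]cnt [RHS](reindex_perm s).
  have e2 := cnt i.
  rewrite -{1}e1 -[X in (_ = X + _)%N]e2 -!big_split /=; apply: eq_bigr => j _.
  have : (s j == s i :> nat) = (j == i :> nat) by rewrite !val_eqE (inj_eq perm_inj).
  by lia.
split.
- by move=> i j; case: andP => // -[].
- suff /existsP[i /existsP[j ij]] : [exists i : 'I_N, exists j : 'I_N, (i < j) && (s j < s i)]%N.
    by exists i, j; rewrite ij.
  apply: contraNT ns => /existsPn h.
  have z (i j : 'I_N) : ((i < j) && (s j < s i))%N = false.
    by have /existsPn/(_ j)/negbTE := h i.
  apply/eqP/permP => i; rewrite perm1; apply: val_inj => /=.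
  have := key i; rewrite !big1 ?addn0 // => j _; last by rewrite z.
  by rewrite z.
move=> i; have := key i; have := le i; rewrite !(mnmBE, mnmDE, mnmE) /=.
by have := ltn_ord i; have := ltn_ord (s i); lia.
Qed.

End Dominance.

Section Projector.

Variables (N d : nat) (M : glmod N d) (l : 'X_{1..N}).
Hypothesis dom_l : dominant l.
Local Notation E := (glE M).
Local Notation w := (glw M).
Local Notation delta := (delta N).

(** A weight function which strictly increases along positive roots; it serves
    as a measure for induction. *)
Definition height (m : 'X_{1..N}) : nat := (\sum_i m i * (N - i))%N.

Lemma height_raise m m' (i j : 'I_N) : (i < j)%N ->
  (m' + U_(j) = m + U_(i))%MM -> (height m < height m')%N.
Proof.
move=> lt_ij hm; have hD p q : height (p + q) = (height p + height q)%N.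
  by rewrite -big_split; apply: eq_bigr => k _; rewrite mnmDE mulnDl.
have hU k : height U_(k) = (N - k)%N.
  rewrite /height (bigD1 k) //= mnm1E eqxx mul1n big1 ?addn0 // => k'.
  by rewrite mnm1E eq_sym => /negbTE->.
have := congr1 height hm; rewrite !hD !hU.
by have := ltn_ord j; lia.
Qed.

Definition other_casvals : seq rat := [seq c <- [seq casval (w k) | k : 'I_d] | c != casval l].

Definition casval_seq t : seq rat := flatten (nseq t other_casvals).

Lemma casprodval_casval_seq t : casprodval (casval_seq t) l != 0.
Proof.
rewrite /casprodval prodf_seq_neq0; apply/allP => c /=.
case/flattenP => cs; rewrite mem_nseq => /andP[_ /eqP->].
by rewrite mem_filter subr_eq0 eq_sym => /andP[].
Qed.

(** Induction from the top.  If every higher weight space is already killed by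
    a product of factors C - c, then that product maps a vector of weight above
    l to a highest weight vector.  On it C is a scalar, different from the value
    at l, and hence among the factors applied next. *)
Lemma casprod_kill t k : above l (w k) ->
  (\max_a height (w a) < height (w k) + t)%N -> row k (casprod M (casval_seq t)) = 0.
Proof.
elim: t k => [|t IH] k ab ht.
  by have := leq_bigmax (F := fun a => height (w a)) k; rewrite leqNgt -[height _]addn0 ht.
rewrite [casval_seq _]/= casprod_cat casprod_comm; last exact: casprod_central.
set u := row k (casprod M (casval_seq t)).
rewrite row_mul -/u.
have hu : highest_weight M u (w k).
  split=> [a|i j lt_ij].
    rewrite mxE; apply: glE_diag_comm_weight => i; exact: casprod_central.
  rewrite -row_mul casprod_central row_mul; apply/rowP => b.
  rewrite mxE big1 ?mxE // => a _; rewrite mxE.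
  have [->|nz] := eqVneq (E i j k a) 0; first by rewrite mul0r.
  have sh := glE_shift nz.
  have -> : casprod M (casval_seq t) a b = row a (casprod M (casval_seq t)) 0 b by rewrite mxE.
  rewrite IH ?mxE ?mulr0 //; first exact: above_raise sh.
  by have := height_raise lt_ij sh; lia.
have [->|nzu] := eqVneq u 0; first by rewrite mul0mx.
rewrite (highest_weight_casprod _ hu) (_ : casprodval _ _ = 0) ?scale0r //.
have dk := highest_weight_dominant nzu hu.
apply/eqP; rewrite /casprodval prodf_seq_eq0; apply/hasP.
exists (casval (w k)); last by rewrite /= subrr.
rewrite mem_filter gt_eqF ?above_casval //=.
exact: fintype.image_f.
Qed.

Definition killing_seq := casval_seq (\max_a height (w a)).+1.

(** The projection onto the weight space of l, followed by a polynomial in the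
    Casimir element with value 1 on highest weight vectors of weight l. *)
Definition hwproj : 'M[rat]_d := (casprodval killing_seq l)^-1 *:
  (wproj M l *m casprod M killing_seq).

Lemma casprod_above k : above l (w k) -> row k (casprod M killing_seq) = 0.
Proof. by move=> ab; apply: casprod_kill; rewrite // addnS ltnS leq_addl. Qed.

Lemma hwprojE k : row k hwproj =
  if w k == l then (casprodval killing_seq l)^-1 *: row k (casprod M killing_seq) else 0.
Proof.
rewrite /hwproj /wproj mul_diag_mx; apply/rowP => a; rewrite 4!mxE.
by case: ifP => _; rewrite ?mul1r 1?mul0r ?mulr0 !mxE.
Qed.

Lemma hwproj_id v : highest_weight M v l -> v *m hwproj = v.
Proof.
move=> hv; rewrite -scalemxAr mulmxA.
have -> : v *m wproj M l = v.
  apply/rowP => k; rewrite mul_mx_diag !mxE.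
  by have [->|/(proj1 hv)->] := eqVneq (v 0 k) 0; rewrite ?mul0r // eqxx mulr1.
rewrite (highest_weight_casprod _ hv) scalerA mulVf ?scale1r //.
exact: casprodval_casval_seq.
Qed.

(** If i < j then E_ij maps the weight space of l to weights above l, where the
    product of factors C - c vanishes. *)
Lemma row_hwproj k : highest_weight M (row k hwproj) l.
Proof.
rewrite hwprojE; case: eqP => [wk|_]; last first.
  by split=> [a|i j _]; rewrite ?mxE ?eqxx // mul0mx.
split=> [a|i j lt_ij].
  rewrite !mxE mulf_eq0 negb_or -wk => /andP[_].
  apply: glE_diag_comm_weight => i; exact: casprod_central.
rewrite -scalemxAl -row_mul casprod_central row_mul.
apply/rowP => b; rewrite !mxE big1 ?mulr0 // => a _; rewrite mxE.
have [->|nz] := eqVneq (E i j k a) 0; first by rewrite mul0r.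
have -> : casprod M killing_seq a b = row a (casprod M killing_seq) 0 b by rewrite mxE.
rewrite casprod_above ?mxE ?mulr0 //.
have /mnmP sh := glE_shift nz; rewrite wk in sh.
apply: (above_root lt_ij (ltn0Sn 0)) => p; have := sh p.
by rewrite !mnmDE !mnm1E !muln1 [j == p]eq_sym [i == p]eq_sym.
Qed.

Lemma hwproj_comm A : centralises M A -> A *m hwproj = hwproj *m A.
Proof.
move=> cA; rewrite -scalemxAr -scalemxAl mulmxA; congr (_ *: _).
by rewrite wproj_comm // -!mulmxA casprod_comm.
Qed.

Lemma hwproj_idem : hwproj *m hwproj = hwproj.
Proof. by apply/row_matrixP => k; rewrite row_mul hwproj_id //; apply: row_hwproj. Qed.

(** In the expansion of the alternant, every permutation other than 1 leads to
    a weight above l, where the product of factors C - c vanishes. *)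
Lemma trace_hwproj Q : centralises M Q -> \tr (Q *m hwproj) = altcoeff l (wgen M Q).
Proof.
move=> cQ; have nz := casprodval_casval_seq (\max_a height (w a)).+1.
(* Both sides are multiplied by the value of the product of factors C - c. *)
apply: (mulfI nz); rewrite -altcoeff_casprod //.
rewrite -scalemxAr mxtraceZ mulrA divff // mul1r.
rewrite mulmxA mxtrace_mulC mulmxA.
rewrite -casprod_comm // -/killing_seq.
set q := Q *m _.
rewrite /altcoeff mcoeff_altM (bigD1 1%g) //= big1 ?addr0 => [|s ns]; last first.
  case: ifP => [le|_]; last by rewrite mulr0.
  rewrite mcoeff_wgen big1 ?mulr0 // => k /eqP wk.
  rewrite /q casprod_comm // mxE big1 // => a _.
  have -> : casprod M killing_seq k a = row k (casprod M killing_seq) 0 a by rewrite mxE.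
  by rewrite casprod_above ?mxE ?mul0r // wk; apply: delta_perm_above.
have -> : delta#(1%g : 'S_N) = delta by apply/mnmP => i; rewrite mnmE perm1.
rewrite odd_perm1 mul1r lem_addl addmK mcoeff_wgen /mxtrace [RHS]big_mkcond.
apply: eq_bigr => k _ /=; rewrite mul_mx_diag !mxE.
by case: eqP => _; rewrite ?mulr1 ?mulr0.
Qed.

Lemma rank_hwproj : (\rank hwproj)%:R = altcoeff l (wgen M 1%:M).
Proof.
rewrite -trace_hwproj => [|i j]; last by rewrite mul1mx mulmx1.
by rewrite mul1mx mxtrace_idempotent ?hwproj_idem.
Qed.

Lemma sub_hwprojP v : reflect (highest_weight M v l) (v <= hwproj)%MS.
Proof.
apply: (iffP idP) => [/submxP[u ->]|hv]; last by rewrite -(hwproj_id hv) submxMl.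
rewrite mulmx_sum_row; split=> [a|i j lt_ij].
  rewrite summxE => nz; have [k nzk] : exists k, (u 0 k *: row k hwproj) 0 a != 0.
    apply/existsP; apply: contraNT nz => /existsPn h.
    by rewrite big1 // => k _; apply/eqP; have := h k; rewrite negbK.
  by move: nzk; rewrite mxE mulf_eq0 negb_or => /andP[_]; apply: (proj1 (row_hwproj k)).
rewrite mulmx_suml big1 // => k _.
by rewrite -scalemxAl (proj2 (row_hwproj k)) // scaler0.
Qed.

End Projector.

(** * Symmetric powers *)

Section SymmetricPower.

Variable M : nat.
Implicit Types (A B : 'M[rat]_M) (p q : {mpoly rat[M]}).

(** The image of the variable of index s. *)
Definition linform A (s : 'I_M) : {mpoly rat[M]} := \sum_t A s t *: 'X_t.

Definition derivation A p : {mpoly rat[M]} := \sum_s linform A s * p^`M(s).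

Lemma derivationD A : {morph derivation A : p q / p + q}.
Proof.
by move=> p q; rewrite -big_split; apply: eq_bigr => s _; rewrite mderivD mulrDr.
Qed.

Lemma derivationZ A c p : derivation A (c *: p) = c *: derivation A p.
Proof.
by rewrite scaler_sumr; apply: eq_bigr => s _; rewrite mderivZ scalerAr.
Qed.

Lemma derivation0 A : derivation A 0 = 0.
Proof. by rewrite /derivation big1 // => s _; rewrite mderiv0 mulr0. Qed.

Lemma derivation_sum A (I : Type) (r : seq I) (F : I -> {mpoly rat[M]}) :
  derivation A (\sum_(i <- r) F i) = \sum_(i <- r) derivation A (F i).
Proof. exact: (big_morph _ (derivationD A) (derivation0 A)). Qed.

Lemma derivationM A p q :
  derivation A (p * q) = derivation A p * q + p * derivation A q.
Proof.
rewrite mulr_suml mulr_sumr -big_split; apply: eq_bigr => s _ /=.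
by rewrite mderivM; ring.
Qed.

Lemma derivation_lin A B (c : rat) p :
  derivation (A + c *: B) p = derivation A p + c *: derivation B p.
Proof.
rewrite scaler_sumr -big_split; apply: eq_bigr => s _ /=.
rewrite scalerAl -mulrDl; congr (_ * _).
rewrite scaler_sumr -big_split; apply: eq_bigr => t _ /=.
by rewrite !mxE scalerDl scalerA.
Qed.

Lemma derivation_linform A B s :
  derivation A (linform B s) = linform (B *m A) s.
Proof.
rewrite derivation_sum.
rewrite (eq_bigr (fun t => \sum_u (B s t * A t u) *: 'X_u)) => [|t _].
  by rewrite exchange_big; apply: eq_bigr => u _; rewrite -scaler_suml mxE.
rewrite derivationZ /derivation (bigD1 t) //= big1 ?addr0 => [|u nu].
  rewrite mderivX mnm1E eqxx scale1r -[(_ - _)%MM]addm0 addmC.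
  rewrite (_ : (0 + _)%MM = 0%MM) ?mpolyX0 ?mulr1.
    by rewrite scaler_sumr; apply: eq_bigr => u _; rewrite scalerA.
  by apply/mnmP => v; rewrite !mnmE subnn.
by rewrite mderivX mnm1E eq_sym (negbTE nu) scale0r mulr0.
Qed.

(** The second-order parts of the two compositions agree by symmetry of second
    derivatives. *)
Lemma derivation_bracket A B p :
  derivation B (derivation A p) - derivation A (derivation B p) =
  derivation (A *m B - B *m A) p.
Proof.
have e A' B' : derivation B' (derivation A' p) = derivation (A' *m B') p +
    \sum_s \sum_t linform A' s * linform B' t * p^`M(s)^`M(t).
  rewrite derivation_sum -big_split; apply: eq_bigr => s _ /=.
  rewrite derivationM derivation_linform; congr (_ + _).
  by rewrite mulr_sumr; apply: eq_bigr => t _; rewrite mulrA.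
rewrite !e -[- (B *m A)]scaleN1r derivation_lin scaleN1r [X in _ - (_ + X)]exchange_big /=.
rewrite opprD addrACA -[RHS]addr0; congr (_ + _); apply/eqP; rewrite subr_eq0; apply/eqP.
apply: eq_bigr => s _; apply: eq_bigr => t _.
by rewrite mderiv_comm [linform A s * _]mulrC.
Qed.

(** On monomials a diagonal matrix acts by the weighted degree. *)
Lemma derivation_diag (a : 'I_M -> rat) (m : 'X_{1..M}) :
  derivation (diag_mx (\row_s a s)) 'X_[m] = (\sum_s (m s)%:R * a s) *: 'X_[m].
Proof.
rewrite /derivation scaler_suml; apply: eq_bigr => s _.
have -> : linform (diag_mx (\row_s a s)) s = a s *: 'X_s.
  rewrite /linform (bigD1 s) //= !mxE eqxx mulr1n big1 ?addr0 // => t.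
  by rewrite !mxE eq_sym => /negbTE->; rewrite mulr0n scale0r.
by rewrite -scalerAl -/(euler s 'X_[m]) eulerX scalerA mulrC.
Qed.

Lemma derivation_homog A n p : p \is n.-homog -> derivation A p \is n.-homog.
Proof.
move=> hp; rewrite /derivation rpred_sum // => s _; apply/dhomogP => m.
move/msuppM_le; case/allpairsP=> -[m1 m2] /= [h1 h2 ->].
have d1 : mdeg m1 = 1%N.
  move: h1 => /msupp_sum_le/flatten_mapP[t _ /msuppZ_le].
  by rewrite msuppX inE => /eqP->; rewrite mdeg1.
rewrite /= mdegD d1; move: h2; rewrite mcoeff_msupp mcoeff_deriv mulrn_eq0 /=.
rewrite -mcoeff_msupp => /(dhomogP _ _ _ hp) /=.
by rewrite mdegD mdeg1 addnC.
Qed.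


Variable n : nat.

Definition monset := [set b : 'X_{1..M < n.+1} | mdeg b == n].
Definition symdim := #|monset|.
Definition mon (k : 'I_symdim) : 'X_{1..M} := val (enum_val k).

Lemma mon_inj : injective mon.
Proof. by move=> k l /val_inj/enum_val_inj. Qed.

Lemma mdeg_mon k : mdeg (mon k) = n.
Proof. by have := enum_valP k; rewrite inE => /eqP. Qed.

Lemma monP m : mdeg m = n -> exists k, mon k = m.
Proof.
move=> hm; have lt : (mdeg m < n.+1)%N by rewrite hm.
have hb : BMultinom lt \in monset by rewrite inE /= hm.
by exists (enum_rank_in hb (BMultinom lt)); rewrite /mon enum_rankK_in.
Qed.

Definition symcoords p : 'rV[rat]_symdim := \row_k p@_(mon k).
Definition sympoly (v : 'rV[rat]_symdim) : {mpoly rat[M]} := \sum_k v 0 k *: 'X_[mon k].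

Lemma mcoeff_sympoly v k : (sympoly v)@_(mon k) = v 0 k.
Proof.
rewrite raddf_sum (bigD1 k) //= mcoeffZ mcoeffX eqxx mulr1 big1 ?addr0 // => l nl.
by rewrite mcoeffZ mcoeffX (inj_eq mon_inj) (negbTE nl) mulr0.
Qed.

Lemma sympolyK v : symcoords (sympoly v) = v.
Proof. by apply/rowP => k; rewrite mxE mcoeff_sympoly. Qed.

Lemma sympoly_inj : injective sympoly.
Proof. exact: can_inj sympolyK. Qed.

Lemma sympoly_homog v : sympoly v \is n.-homog.
Proof.
by rewrite rpred_sum // => k _; rewrite rpredZ // dhomogX /= mdeg_mon.
Qed.

Lemma symcoordsK p : p \is n.-homog -> sympoly (symcoords p) = p.
Proof.
move=> hp; apply/mpolyP => m; have [hm|hm] := eqVneq (mdeg m) n.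
  by have [k <-] := monP hm; rewrite mcoeff_sympoly mxE.
by rewrite (dhomog_nemf_coeff hp hm) (dhomog_nemf_coeff (sympoly_homog _) hm).
Qed.

Lemma sympoly_linear (r : nat) (F : 'M[rat]_(r, symdim)) (u : 'rV_r) :
  sympoly (u *m F) = \sum_k u 0 k *: sympoly (row k F).
Proof.
rewrite /sympoly (eq_bigr (fun a => \sum_k (u 0 k * F k a) *: 'X_[mon a])).
  rewrite exchange_big; apply: eq_bigr => k _; rewrite scaler_sumr.
  by apply: eq_bigr => a _; rewrite !mxE scalerA.
by move=> a _; rewrite mxE scaler_suml.
Qed.

(** The derivation induced by A, in the basis of monomials of degree n. *)
Definition sympow A : 'M[rat]_symdim :=
  \matrix_k symcoords (derivation A 'X_[mon k]).

Lemma sympoly_sympow A v : sympoly (v *m sympow A) = derivation A (sympoly v).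
Proof.
rewrite sympoly_linear derivation_sum; apply: eq_bigr => k _.
rewrite rowK symcoordsK ?derivationZ //; apply: derivation_homog.
by rewrite dhomogX /= mdeg_mon.
Qed.

Lemma sympow_ext (F G : 'M[rat]_symdim) :
  (forall v, sympoly (v *m F) = sympoly (v *m G)) -> F = G.
Proof. by move=> h; apply/row_matrixP => k; rewrite !rowE; apply/sympoly_inj/h. Qed.

Lemma sympolyB u v : sympoly (u - v) = sympoly u - sympoly v.
Proof. by rewrite -sumrB; apply: eq_bigr => k _; rewrite !mxE scalerBl. Qed.

Lemma sympolyZ c v : sympoly (c *: v) = c *: sympoly v.
Proof. by rewrite scaler_sumr; apply: eq_bigr => k _; rewrite mxE scalerA. Qed.

Lemma sympow_bracket A B :
  sympow A *m sympow B - sympow B *m sympow A = sympow (A *m B - B *m A).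
Proof.
apply: sympow_ext => v; rewrite mulmxBr !mulmxA sympolyB !sympoly_sympow.
exact: derivation_bracket.
Qed.

Lemma sympow_lin A B (a b : rat) :
  sympow (a *: A - b *: B) = a *: sympow A - b *: sympow B.
Proof.
apply: sympow_ext => v; rewrite mulmxBr -!scalemxAr sympolyB !sympolyZ !sympoly_sympow.
have z p : derivation 0 p = 0.
  rewrite /derivation big1 // => s _; rewrite /linform big1 ?mul0r // => t _.
  by rewrite mxE scale0r.
rewrite -(scaleNr b) derivation_lin scaleNr; congr (_ - _).
by rewrite -[a *: A]add0r derivation_lin z add0r.
Qed.

Lemma sympow_commute A B :
  A *m B = B *m A -> sympow A *m sympow B = sympow B *m sympow A.
Proof.
move=> AB; apply/eqP; rewrite -subr_eq0 sympow_bracket AB subrr.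
by have := sympow_lin 0 0 0 0; rewrite !scale0r !subrr => ->.
Qed.

Section SymGl.

Variables (N : nat) (V : glmod N M).

Definition symweight (m : 'X_{1..M}) : 'X_{1..N} :=
  [multinom (\sum_s m s * glw V s i)%N | i < N].

Fact sym_rel (i j k l : 'I_N) :
  sympow (glE V i j) *m sympow (glE V k l) - sympow (glE V k l) *m sympow (glE V i j) =
  (i == l)%:R *: sympow (glE V k j) - (k == j)%:R *: sympow (glE V i l).
Proof. by rewrite sympow_bracket glE_rel sympow_lin. Qed.

Fact sym_diag i : sympow (glE V i i) = diag_mx (\row_k (symweight (mon k) i)%:R).
Proof.
apply/matrixP => k l; rewrite !mxE glE_diag derivation_diag mcoeffZ mcoeffX.
rewrite (inj_eq mon_inj); case: eqP => _; rewrite ?mulr1 ?mulr0 ?mulr1n ?mulr0n //.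
by rewrite mnmE natr_sum; apply: eq_bigr => s _; rewrite natrM.
Qed.

Definition symmod : glmod N symdim := GlMod sym_rel sym_diag.

Lemma glw_symmod k : glw symmod k = symweight (mon k).
Proof. by []. Qed.

Lemma highest_weight_symmod v l : highest_weight symmod v l <->
  (forall i, derivation (glE V i i) (sympoly v) = (l i)%:R *: sympoly v) /\
  (forall i j : 'I_N, (i < j)%N -> derivation (glE V i j) (sympoly v) = 0).
Proof.
have sp0 : sympoly 0 = 0 by rewrite /sympoly big1 // => k _; rewrite mxE scale0r.
split=> [[hw hv]|[hw hv]]; split.
- by move=> i; rewrite -sympoly_sympow (has_weight_diag _ hw) sympolyZ.
- by move=> i j /hv h; rewrite -sympoly_sympow [v *m _]h sp0.
- move=> k nz; apply/mnmP => i.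
  have : v *m glE symmod i i = (l i)%:R *: v.
    by apply: sympoly_inj; rewrite sympoly_sympow hw sympolyZ.
  move/rowP/(_ k); rewrite mulmx_glE_diag mxE mulrC => /(mulIf nz) h.
  by apply/eqP; rewrite -(eqr_nat rat) h.
- by move=> i j lt_ij; apply: sympoly_inj; rewrite sympoly_sympow hv.
Qed.

End SymGl.

End SymmetricPower.

Arguments symmod {M} n {N} V.

(** Multiplication by a nonzero highest weight vector of weight l' and degree n'
    is injective and maps highest weight vectors to highest weight vectors. *)
Lemma rank_hwproj_mul M N (V : glmod N M) n n' l l' :
  (0 < \rank (hwproj (symmod n' V) l'))%N -> dominant l -> dominant l' ->
  (\rank (hwproj (symmod n V) l) <= \rank (hwproj (symmod (n + n') V) (l + l')))%N.
Proof.
move=> rk dl dl'.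
have dll : dominant (l + l')%MM by move=> i j h; rewrite !mnmDE leq_add ?dl ?dl'.
have [v hv nzv] : exists2 v, highest_weight (symmod n' V) v l' & v != 0.
  have : hwproj (symmod n' V) l' != 0 by rewrite -mxrank_eq0 -lt0n.
  case/rowV0Pn => v /sub_hwprojP h; exists v => //; exact: h.
set q := sympoly v; have nzq : q != 0.
  apply: contra_neq nzv => q0; apply: (@sympoly_inj M n').
  by rewrite -/q q0 /sympoly big1 // => k _; rewrite mxE scale0r.
pose F : 'M[rat]_(symdim M n, symdim M (n + n')) :=
  \matrix_k symcoords (n + n') ('X_[mon k] * q).
have hF u : sympoly (u *m F) = sympoly u * q.
  rewrite sympoly_linear mulr_suml; apply: eq_bigr => k _.
  rewrite rowK symcoordsK ?scalerAl // dhomogM ?sympoly_homog //.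
  by rewrite dhomogX /= mdeg_mon.
have freeF : row_free F.
  rewrite -kermx_eq0; apply/eqP/row_matrixP => k; rewrite row0.
  have : row k (kermx F) *m F = 0 by apply/sub_kermxP/row_sub.
  move/(congr1 (@sympoly M (n + n'))); rewrite hF.
  rewrite [RHS](_ : _ = 0); last by rewrite /sympoly big1 // => c _; rewrite mxE scale0r.
  move/eqP; rewrite mulf_eq0 (negbTE nzq) orbF => /eqP h.
  apply: sympoly_inj; rewrite h /sympoly big1 // => c _; by rewrite mxE scale0r.
rewrite -(mxrankMfree _ freeF); apply: mxrankS.
apply/row_subP => k; apply/sub_hwprojP => //.
rewrite row_mul; apply/highest_weight_symmod; rewrite hF.
have /highest_weight_symmod[hw0 hv0] := row_hwproj (symmod n V) dl k.
have /highest_weight_symmod[hw1 hv1] := hv.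
split=> [i|i j lt_ij]; rewrite derivationM.
  by rewrite hw0 hw1 -scalerAl -scalerAr -scalerDl -natrD mnmDE.
by rewrite hv0 // hv1 // mul0r mulr0 addr0.
Qed.

(** * Pieri's rule *)

Section Pieri.

Variable N : nat.
Local Notation delta := (delta N).
Implicit Types (l m g : 'X_{1..N}).

Definition below l : seq 'X_{1..N} :=
  [seq val b | b <- enum {: 'X_{1..N < (mdeg l).+1}} & (bmnm b <= l)%MM].

Lemma mdeg_le m l : (m <= l)%MM -> (mdeg m <= mdeg l)%N.
Proof. by move/submK <-; rewrite mdegD leq_addl. Qed.

Lemma mem_below l g : (g \in below l) = (g <= l)%MM.
Proof.
apply/mapP/idP => [[b]|le]; first by rewrite mem_filter => /andP[h _] ->.
have lt : (mdeg g < (mdeg l).+1)%N by rewrite ltnS mdeg_le.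
by exists (BMultinom lt); rewrite // mem_filter mem_enum /= le.
Qed.

Lemma below_uniq l : uniq (below l).
Proof.
rewrite map_inj_uniq => [|a b e]; first by apply: filter_uniq; rewrite -?enumT enum_uniq.
by apply/eqP; rewrite bmeqP; apply/eqP.
Qed.

Lemma mcoeffM_below (p q : {mpoly rat[N]}) l :
  (p * q)@_l = \sum_(g <- below l) p@_g * q@_(l - g).
Proof.
rewrite mcoeffM big_map big_filter big_enum_cond /=.
rewrite -(pair_big_dep xpredT (fun a b : 'X_{1..N < (mdeg l).+1} => l == (a + b)%MM)
           (fun a b => p@_a * q@_b)) /=.
rewrite [RHS]big_mkcond; apply: eq_bigr => a _ /=; case: ifP => [le|nle].
  have lt : (mdeg (l - a) < (mdeg l).+1)%N by rewrite ltnS mdegB.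
  rewrite (big_pred1 (BMultinom lt)) //= => b.
  rewrite -[RHS]/(b == BMultinom lt) bmeqP /=; apply/eqP/eqP => [e|->].
    by rewrite [X in (X - _)%MM]e addmC addmK.
  by rewrite addmC submK.
rewrite big1 // => b /eqP e; move: nle.
by rewrite [X in (_ <= X)%MM]e lem_addr.
Qed.

(** The diagram of m is obtained from that of l by removing a horizontal strip. *)
Definition interlace m l : bool :=
  (m <= l)%MM && [forall i : 'I_N, forall j : 'I_N, (j == i.+1 :> nat) ==> (l j <= m i)%N].

Lemma interlaceP m l :
  reflect ((forall i, (m i <= l i)%N) /\
           (forall i j : 'I_N, j = i.+1 :> nat -> (l j <= m i)%N)) (interlace m l).
Proof.
apply: (iffP andP) => [[/mnm_lepP h1 /forallP h2]|[h1 h2]]; split=> //.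
- by move=> i j e; have /forallP/(_ j) := h2 i; rewrite e eqxx.
- exact/mnm_lepP.
- by apply/forallP => i; apply/forallP => j; apply/implyP => /eqP /h2.
Qed.

Lemma interlace_dominant m l : interlace m l -> dominant l -> dominant m.
Proof.
case/interlaceP=> h1 h2 dl i j lt_ij.
have lt : (i.+1 < N)%N by apply: leq_ltn_trans (ltn_ord j).
apply: leq_trans (h1 j) _; apply: leq_trans (h2 i (Ordinal lt) _) => //.
have [e|ne] := eqVneq j (Ordinal lt); first by rewrite e.
by apply: dl; rewrite ltn_neqAle /= lt_ij andbT eq_sym; move: ne; rewrite -val_eqE.
Qed.

Definition hstrips l := [seq m <- below l | interlace m l].

Lemma mem_hstrips l m : (m \in hstrips l) = interlace m l.
Proof. by rewrite mem_filter mem_below /interlace; case: (m <= l)%MM; rewrite ?andbT. Qed.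

Definition homogeneous_sum (k : nat) : {mpoly rat[N]} :=
  \sum_(b : 'X_{1..N < k.+1} | mdeg b == k) 'X_[b].

Lemma mcoeff_homogeneous_sum k m : (homogeneous_sum k)@_m = (mdeg m == k)%:R.
Proof.
rewrite raddf_sum /=; case: eqP => [hm|hm].
  have lt : (mdeg m < k.+1)%N by rewrite hm.
  rewrite (bigD1 (BMultinom lt)) /= ?hm // mcoeffX eqxx big1 ?addr0 // => b.
  by rewrite bmeqP /= mcoeffX => /andP[_ /negbTE->].
by rewrite big1 // => b /eqP hb; rewrite mcoeffX; case: eqP => // e; case: hm; rewrite -e.
Qed.

Section Violation.

Variable L : 'X_{1..N}.
Hypothesis decL : forall i j : 'I_N, (i < j)%N -> (L j < L i)%N.

Definition violates g (b : 'I_N * 'I_N) := (b.2 == b.1.+1 :> nat) && (g b.1 <= L b.2)%N.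

Definition first_violation g (b : 'I_N * 'I_N) :=
  violates g b && [forall c : 'I_N * 'I_N, (c.1 < b.1)%N ==> ~~ violates g c].

Definition violating g := [exists b, violates g b].

(** The exponents at the first position where interlacing fails are exchanged.
    This position stays the first violation, so the map is an involution. *)
Definition swap_violation g :=
  if [pick b | first_violation g b] is Some b then g#(tperm b.1 b.2) else g.

Lemma first_violation_uniq g b c : first_violation g b -> first_violation g c -> b = c.
Proof.
move=> /andP[vb /forallP hb] /andP[vc /forallP hc].
have e1 : b.1 = c.1 :> nat.
  by case: (ltngtP b.1 c.1) => // lt;
     [have := hc b | have := hb c]; rewrite lt ?vb ?vc.
case: b c vb vc e1 {hb hc} => [i j] [i' j'] /andP[/= /eqP e _] /andP[/= /eqP e' _] ei.
by congr (_, _); apply: val_inj; rewrite //= e e' ei.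
Qed.

Lemma violatingP g : violating g -> exists b, first_violation g b.
Proof.
case/existsP => b0 vb0.
have [b vb hb] := arg_minnP (fun b : 'I_N * 'I_N => val b.1) vb0.
exists b; rewrite /first_violation vb; apply/forallP => c; apply/implyP => lt.
by apply/negP => /hb; rewrite leqNgt lt.
Qed.

Lemma swap_violationE g b : first_violation g b -> swap_violation g = g#(tperm b.1 b.2).
Proof.
move=> hb; rewrite /swap_violation; case: pickP => [c hc|/(_ b)]; last by rewrite hb.
by rewrite (first_violation_uniq hc hb).
Qed.

Lemma first_violation_swap g b : (g <= L)%MM -> first_violation g b ->
  first_violation (swap_violation g) b /\ (swap_violation g <= L)%MM.
Proof.
move=> /mnm_lepP gL hb; rewrite (swap_violationE hb).
case: b hb => i j /andP[/andP[/= /eqP e lej] /forallP hb]; split.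
  apply/andP; split.
    by rewrite /violates /= e eqxx mnmE tpermL gL.
  apply/forallP => -[i' j'] /=; apply/implyP => lt; have := hb (i', j').
  rewrite /= lt /violates /= mnmE tpermD //; rewrite -val_eqE /=; lia.
apply/mnm_lepP => c; rewrite mnmE; case: tpermP => [->|->|_ _] //.
by apply: leq_trans (gL j) _; rewrite ltnW ?decL // e.
Qed.

(** The involution changes the sign of the coefficients of an antisymmetric
    polynomial. *)
Lemma sum_violating (G : {mpoly rat[N]}) (d : nat) :
    (forall s : 'S_N, msym s G = (-1) ^+ s *: G) ->
  \sum_(g <- below L | violating g && (mdeg g == d)) G@_g = 0.
Proof.
move=> antiG; rewrite -big_filter; set r := [seq g <- _ | _].
have memr g : (g \in r) = [&& violating g, mdeg g == d & (g <= L)%MM].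
  by rewrite mem_filter mem_below -andbA.
have ur : uniq r by rewrite filter_uniq ?below_uniq.
have swapr g : g \in r -> [/\ swap_violation g \in r, G@_(swap_violation g) = - G@_g
    & swap_violation (swap_violation g) = g].
  rewrite memr => /and3P[vg /eqP dg gL]; have [b hb] := violatingP vg.
  have [hb' gL'] := first_violation_swap gL hb; split.
  - rewrite memr gL' (swap_violationE hb) mdeg_mperm dg eqxx !andbT.
    by apply/existsP; exists b; case/andP: hb'; rewrite (swap_violationE hb).
  - rewrite (swap_violationE hb) -mcoeff_sym antiG mcoeffZ odd_tperm.
    suff -> : b.1 != b.2 by rewrite expr1 mulN1r.
    by case/andP: hb => /andP[/eqP e _] _; rewrite -val_eqE /= e neq_ltn leqnn.
  rewrite (swap_violationE hb') (swap_violationE hb); apply/mnmP => c.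
  by rewrite !mnmE tpermK.
(* The swap preserves the index set of the sum, so that S = - S. *)
have pr : perm_eq r [seq swap_violation g | g <- r].
  apply: uniq_perm => // [|g].
    rewrite map_inj_in_uniq // => g g' /swapr[_ _ e] /swapr[_ _ e'] h.
    by rewrite -e -e' h.
  apply/idP/mapP => [gr|[g' /swapr[h _ _] ->//]].
  by have [h _ e] := swapr g gr; exists (swap_violation g); rewrite ?e.
set S := \sum_(g <- r) _; suff : S = - S by lra.
rewrite {1}/S (perm_big _ pr) big_map -sumrN; apply: eq_big_seq => g /swapr[_ + _]; exact.
Qed.

End Violation.

(** Multiplication by h_k sums the coefficients over all exponents below
    l + delta of the right degree; those that do not come from a horizontal strip
    cancel in pairs. *)
Lemma pieri (G : {mpoly rat[N]}) l (k : nat) : dominant l ->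
    (forall s : 'S_N, msym s G = (-1) ^+ s *: G) ->
  (G * homogeneous_sum k)@_(l + delta) =
  \sum_(m <- hstrips l | (mdeg m + k == mdeg l)%N) G@_(m + delta).
Proof.
move=> dl antiG; set L := (l + delta)%MM.
have decL (i j : 'I_N) : (i < j)%N -> (L j < L i)%N.
  by move=> lt; rewrite !mnmDE !mnmE; have := dl _ _ lt; have := ltn_ord j; lia.
have sum_k g : g \in below L -> (mdeg (L - g) == k) = (mdeg g + k == mdeg L)%N.
  by rewrite mem_below => le; rewrite -{2}(submK le) mdegD addnC eqn_add2r eq_sym.
rewrite mcoeffM_below.
transitivity (\sum_(g <- below L | (mdeg g + k == mdeg L)%N) G@_g).
  rewrite [RHS]big_mkcond; apply: eq_big_seq => g hg.
  by rewrite mcoeff_homogeneous_sum sum_k //; case: eqP; rewrite ?mulr1 ?mulr0.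
rewrite (bigID (violating L)) /= [X in X + _](_ : _ = 0) ?add0r; last first.
  case: (leqP k (mdeg L)) => le; last first.
    by rewrite big1 // => g /andP[/eqP e _]; lia.
  rewrite -[RHS](sum_violating decL (mdeg L - k)%N antiG).
  by apply: eq_bigl => g; rewrite andbC; congr (_ && _); lia.
rewrite -[LHS]big_filter -[RHS]big_filter -(big_map (fun m => m + delta)%MM xpredT (fun g => G@_g)).
apply: perm_big; apply: uniq_perm => [||g].
- by rewrite filter_uniq ?below_uniq.
- by rewrite map_inj_uniq ?filter_uniq ?below_uniq //; apply: addIm.
rewrite mem_filter mem_below; apply/idP/mapP.
  case/andP=> /andP[/eqP dg /existsPn good] /mnm_lepP gL.
  have good' (i j : 'I_N) : j = i.+1 :> nat -> (L j < g i)%N.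
    by move=> e; have := good (i, j); rewrite /violates /= e eqxx /= ltnNge.
  have dg' : (delta <= g)%MM.
    apply/mnm_lepP => i; rewrite mnmE.
    case: (ltnP i.+1 N) => [lt|]; last by lia.
    by have := good' i (Ordinal lt) erefl; rewrite mnmDE mnmE /=; lia.
  exists (g - delta)%MM; last by rewrite submK.
  rewrite mem_filter mem_hstrips; apply/andP; split.
    by move/eqP: dg; rewrite -{1}(submK dg') /L !mdegD; lia.
  apply/interlaceP; split=> [i|i j e].
    by rewrite mnmBE leq_subLR addnC; have := gL i; rewrite mnmDE.
  have := good' i j e; rewrite mnmBE mnmDE !mnmE.
  by have := ltn_ord j; lia.
case=> m; rewrite mem_filter mem_hstrips => /andP[/eqP dm /interlaceP[h1 h2]] ->.
apply/andP; split; last by apply/mnm_lepP => i; rewrite !mnmDE leq_add2r.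
apply/andP; split; first by rewrite /L !mdegD -dm addnAC.
apply/existsPn => -[i j]; rewrite /violates /=; apply/negP => /andP[/eqP e].
by have := h2 i j e; rewrite !mnmDE !mnmE; have := ltn_ord j; lia.
Qed.

(** The number of chains of partitions from 0 to l in which the i-th step is a
    horizontal strip with a i boxes; only partitions with at most N parts occur. *)
Fixpoint kostka (k : nat) (a : nat -> nat) (l : 'X_{1..N}) : nat :=
  if k is k'.+1 then
    (\sum_(m <- hstrips l | mdeg m + a k' == mdeg l) kostka k' a m)%N
  else (l == 0%MM).

Definition homogeneous_prod (k : nat) (a : nat -> nat) : {mpoly rat[N]} :=
  \prod_(i < k) homogeneous_sum (a i).

Lemma msym_homogeneous_sum k (s : 'S_N) : msym s (homogeneous_sum k) = homogeneous_sum k.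
Proof.
by apply/mpolyP => m; rewrite mcoeff_sym !mcoeff_homogeneous_sum mdeg_mperm.
Qed.

Lemma msym_homogeneous_prod k a (s : 'S_N) :
  msym s (homogeneous_prod k a) = homogeneous_prod k a.
Proof.
elim: k => [|k IH]; rewrite /homogeneous_prod; first by rewrite big_ord0 msym1.
by rewrite big_ord_recr msymM IH msym_homogeneous_sum.
Qed.

(** By degree only l = 0 can contribute, and the permutations of delta are
    distinct. *)
Lemma altcoeff1 l : altcoeff l 1 = (l == 0%MM)%:R.
Proof.
rewrite /altcoeff mcoeff_altM.
have perm0 (s : 'S_N) : delta#s = delta -> s = 1%g.
  move/mnmP => h; apply/permP => i; rewrite perm1; apply: val_inj.
  by have := h i; rewrite !mnmE /=; have := ltn_ord i; have := ltn_ord (s i); lia.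
have [->|nl] := eqVneq l 0%MM.
  rewrite (bigD1 1%g) //= big1 => [|s ns].
    rewrite odd_perm1 add0m (_ : delta#(1%g : 'S_N) = delta) ?lepm_refl; last first.
      by apply/mnmP => i; rewrite mnmE perm1.
    by rewrite addr0 mul1r mcoeff1 -{1}[delta]add0m addmK eqxx.
  rewrite add0m; case: ifP => le; last by rewrite mulr0.
  rewrite mcoeff1; case: eqP => [e|]; last by rewrite mulr0.
  by case/eqP: ns; apply: perm0; rewrite -{2}(submK le) e add0m.
rewrite big1 // => s _; case: ifP => le; last by rewrite mulr0.
rewrite mcoeff1; case: eqP => [e|]; last by rewrite mulr0.
case/eqP: nl; apply/eqP; rewrite -mdeg_eq0.
by have := congr1 (@mdeg N) (submK le); rewrite e add0m mdeg_mperm mdegD; lia.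
Qed.

(** Pieri's rule, applied to the last factor, is the recursion for the chains. *)
Lemma altcoeff_homogeneous_prod k a l : dominant l ->
  altcoeff l (homogeneous_prod k a) = (kostka k a l)%:R.
Proof.
elim: k l => [|k IH] l dl.
  by rewrite /homogeneous_prod big_ord0 altcoeff1.
rewrite /altcoeff /homogeneous_prod big_ord_recr /= mulrA pieri //.
  rewrite natr_sum big_seq_cond [RHS]big_seq_cond; apply: eq_bigr => m.
  by rewrite mem_hstrips => /andP[/interlace_dominant/(_ dl) /IH <-].
by move=> s; rewrite msymM msym_alt -/(homogeneous_prod k a) msym_homogeneous_prod scalerAl.
Qed.

End Pieri.

(** * Counting semistandard tableaux *)

Section PaddedTableaux.

Variable N : nat.
Implicit Types (l m : 'X_{1..N}) (t : seq (seq nat)).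
Local Open Scope nat_scope.

Definition entry t i c := nth 0 (nth [::] t i) c.

(** Semistandard tableaux with entries below k as arrays with exactly N rows,
    some of which may be empty; shapes are then exponents in N variables. *)
Definition padded_tableau (k : nat) l t := [/\ size t = N,
  forall i, size (nth [::] t i) = nth 0 l i,
  forall i c, c.+1 < nth 0 l i -> entry t i c <= entry t i c.+1,
  forall i c, c < nth 0 l i -> entry t i c < k &
  forall i c, c < nth 0 l i.+1 -> entry t i c < entry t i.+1 c].

Definition fill_rows (k : nat) l t : seq (seq nat) :=
  mkseq (fun i => nth [::] t i ++ nseq (nth 0 l i - size (nth [::] t i)) k) N.

Definition strip_rows (k : nat) t := [seq [seq x <- r | x < k] | r <- t].

(** A tableau with entries at most k is one with entries below k whose rows are
    filled up with k; the rows to fill form a horizontal strip. *)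
Fixpoint ptab (k : nat) l : seq (seq (seq nat)) :=
  if k is k'.+1 then [seq fill_rows k' l t | m <- hstrips l, t <- ptab k' m]
  else if l == 0%MM then [:: nseq N [::]] else [::].

(** In a sorted row bounded by k the entries equal to k are at the end. *)
Lemma sorted_split k r : sorted leq r -> all (leq^~ k) r ->
  r = [seq x <- r | x < k] ++ nseq (size r - size [seq x <- r | x < k]) k.
Proof.
elim: r => //= x r IHr px /andP[xk rk]; have sr := path_sorted px.
case: ltnP => [lt|ge] /=; first by rewrite subSS -IHr.
have e : x = k by apply/eqP; rewrite eqn_leq xk ge.
have allk : all (leq k) r.
  by rewrite -e; move: px; rewrite path_sortedE; [case/andP|exact: leq_trans].
have -> : [seq y <- r | y < k] = [::].
  rewrite -(filter_pred0 r); apply: eq_in_filter => y /(allP allk) /= h.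
  by rewrite ltnNge h.
rewrite subn0 /= e; congr (_ :: _); apply/all_pred1P/allP => y yr /=.
by rewrite eqn_leq (allP rk) // (allP allk).
Qed.

Lemma nth_mnm_big l i : N <= i -> nth 0 l i = 0.
Proof. by move=> h; rewrite nth_default ?size_tuple. Qed.

Lemma row_sorted r : (forall c, c.+1 < size r -> nth 0 r c <= nth 0 r c.+1) -> sorted leq r.
Proof. by move=> h; apply/(sortedP 0). Qed.

Lemma nth_fill_rows k l t i : size t = N ->
  nth [::] (fill_rows k l t) i =
  nth [::] t i ++ nseq (nth 0 l i - size (nth [::] t i)) k.
Proof.
move=> st; case: (ltnP i N) => h; first by rewrite nth_mkseq.
by rewrite !nth_default ?size_mkseq ?st // ?size_tuple // (nth_mnm_big _ h) sub0n.
Qed.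

Lemma strip_fill k l m t : padded_tableau k m t -> strip_rows k (fill_rows k l t) = t.
Proof.
case=> st sz _ lt _; apply: (@eq_from_nth _ [::]); rewrite size_map size_mkseq ?st // => i hi.
rewrite (nth_map [::]) ?size_mkseq // nth_fill_rows // filter_cat.
rewrite [X in _ ++ X](_ : _ = [::]) ?cats0.
  apply/all_filterP/(all_nthP 0) => c hc; apply: lt; by rewrite -sz.
by apply/eqP; rewrite -size_eq0 size_filter count_nseq ltnn.
Qed.

Lemma nth_interlace m l i : interlace m l -> nth 0 m i <= nth 0 l i /\ nth 0 l i.+1 <= nth 0 m i.
Proof.
case/interlaceP=> h1 h2; case: (ltnP i N) => hi; last first.
  by rewrite !nth_mnm_big // leqW.
split; first by have := h1 (Ordinal hi); rewrite !(mnm_nth 0).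
case: (ltnP i.+1 N) => hi'; last by rewrite nth_mnm_big.
by have := h2 (Ordinal hi) (Ordinal hi') erefl; rewrite !(mnm_nth 0).
Qed.

Lemma padded_tableau_fill k m l t : interlace m l -> padded_tableau k m t ->
  padded_tableau k.+1 l (fill_rows k l t).
Proof.
move=> il [st sz mono lt col].
have ent i c : c < nth 0 l i -> entry (fill_rows k l t) i c =
    if c < nth 0 m i then entry t i c else k.
  move=> hc; rewrite /entry nth_fill_rows // nth_cat sz.
  by case: ltnP => // h; rewrite nth_nseq ifT // ltn_sub2r // (leq_ltn_trans h).
have il1 i := (nth_interlace i il).1; have il2 i := (nth_interlace i il).2.
split.
- by rewrite size_mkseq.
- by move=> i; rewrite nth_fill_rows // size_cat size_nseq sz subnKC.
- move=> i c hc; rewrite !ent // ?(ltnW hc) //.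
  case: ifP => h1; case: ifP => h2 //.
  + exact: mono.
  + by rewrite ltnW ?lt.
  + by move: h1; rewrite (ltnW h2).
- by move=> i c hc; rewrite ent //; case: ifP => // h; rewrite ltnW ?ltnS ?lt.
- move=> i c hc.
  have hm : c < nth 0 m i := leq_trans hc (il2 i).
  rewrite (ent i c (leq_trans hm (il1 i))) (ent i.+1 c hc) hm.
  by case: ifP => h; [apply: col | apply: lt].
Qed.

Lemma ptabP k l t : dominant l -> t \in ptab k l <-> padded_tableau k l t.
Proof.
elim: k l t => [|k IH] l t dl /=.
  split=> [|[st sz _ lt _]].
    case: eqP => // ->; rewrite inE => /eqP->.
    have z i : nth 0 (0%MM : 'X_{1..N}) i = 0.
      by case: (ltnP i N) => h; [rewrite -(mnm_nth 0 _ (Ordinal h)) mnm0E | rewrite nth_mnm_big].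
    split=> [|i|i c|i c|i c]; rewrite ?size_nseq ?nth_nseq ?z //.
    by case: ifP.
  have l0 i : nth 0 l i = 0.
    by apply/eqP; rewrite -leqn0 leqNgt; apply/negP => /(lt i 0).
  have -> : l == 0%MM by apply/eqP/mnmP => i; rewrite mnm0E (mnm_nth 0) l0.
  rewrite inE; apply/eqP/(@eq_from_nth _ [::]); rewrite ?size_nseq // => i hi.
  by rewrite nth_nseq if_same; apply: size0nil; rewrite sz l0.
split=> [/allpairsPdep[m [t' [hm ht' ->]]]|[st sz mono lt col]].
  rewrite mem_hstrips in hm; apply: padded_tableau_fill (hm) _.
  by apply/IH => //; apply: interlace_dominant hm dl.
pose t' := strip_rows k t.
have nth_t' i : nth [::] t' i = [seq x <- nth [::] t i | x < k].
  case: (ltnP i (size t)) => h; first by rewrite (nth_map [::]).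
  by rewrite !nth_default ?size_map.
pose m : 'X_{1..N} := [multinom size (nth [::] t' i) | i < N].
have sz' i : size (nth [::] t' i) = nth 0 m i.
  case: (ltnP i N) => h; first by rewrite -(mnm_nth 0 m (Ordinal h)) mnmE.
  by rewrite nth_mnm_big // nth_default // size_map st.
have dec i : nth [::] t i = nth [::] t' i ++ nseq (nth 0 l i - nth 0 m i) k.
  rewrite -sz -sz' nth_t'; apply: sorted_split.
    by apply: row_sorted => c hc; apply: mono; rewrite -sz.
  by apply/(all_nthP 0) => c hc; rewrite -ltnS; apply: lt; rewrite -sz.
have ml i : nth 0 m i <= nth 0 l i.
  by rewrite -sz -sz' dec size_cat leq_addr.
have ent i c : c < nth 0 m i -> entry t i c = entry t' i c.
  by move=> h; rewrite /entry dec nth_cat sz' h.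
have lm i : nth 0 l i.+1 <= nth 0 m i.
  rewrite leqNgt; apply/negP => h; have := col i _ h.
  have := lt i.+1 _ h; rewrite {2}/entry dec nth_cat sz' ltnn subnn.
  have lt_ml : nth 0 m i < nth 0 l i.
    have hi : i.+1 < N by rewrite ltnNge; apply/negP => hi; move: h; rewrite (nth_mnm_big l hi).
    apply: leq_trans h _; rewrite -(mnm_nth 0 l (Ordinal hi)) -(mnm_nth 0 l (Ordinal (ltnW hi))).
    exact: dl.
  by rewrite nth_nseq subn_gt0 lt_ml; lia.
have il : interlace m l.
  apply/interlaceP; split=> [i|i j e]; first by rewrite !(mnm_nth 0).
  by rewrite !(mnm_nth 0) e.
apply/allpairsPdep; exists m, t'; split; first by rewrite mem_hstrips.
  apply/IH; first exact: interlace_dominant il dl.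
  split=> //.
  - by rewrite size_map.
  - move=> i c hc; rewrite -!ent //; last exact: ltnW.
    by apply: mono; apply: leq_trans hc _.
  - move=> i c hc; rewrite -sz' in hc.
    by have := mem_nth 0 hc; rewrite {2}nth_t' mem_filter => /andP[].
  - move=> i c hc; rewrite -!ent //; last first.
      exact: leq_trans hc (leq_trans (ml _) (lm _)).
    by apply: col; apply: leq_trans hc _.
apply: (@eq_from_nth _ [::]); rewrite ?size_mkseq // => i hi.
by rewrite nth_fill_rows ?size_map // sz' -dec.
Qed.

Lemma ptab_uniq k l : dominant l -> uniq (ptab k l).
Proof.
elim: k l => [|k IH] l dl /=; first by case: ifP.
apply: (@allpairs_uniq_dep _ (fun=> seq (seq nat)) _ (fun _ t => fill_rows k l t)).
- by rewrite filter_uniq ?below_uniq.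
- by move=> m; rewrite mem_hstrips => /interlace_dominant/(_ dl)/IH.
move=> u v /allpairsPdep[m [t [hm ht ->]]] /allpairsPdep[m' [t' [hm' ht' ->]]] /= e.
rewrite !mem_hstrips in hm hm'.
have P := (ptabP k t (interlace_dominant hm dl)).1 ht.
have P' := (ptabP k t' (interlace_dominant hm' dl)).1 ht'.
have et : t = t' by rewrite -(strip_fill l P) -(strip_fill l P') e.
have em : m = m'.
  by apply/mnmP => i; rewrite !(mnm_nth 0); case: P P' => _ <- _ _ _ [_ <- _ _ _]; rewrite et.
by rewrite et em.
Qed.

Definition has_content (k : nat) (a : nat -> nat) t :=
  all (fun i => count_mem i (flatten t) == a i) (iota 0 k).

Lemma mdegE_nth l : mdeg l = \sum_(i < N) nth 0 l i.
Proof. by rewrite mdegE; apply: eq_bigr => i _; rewrite (mnm_nth 0). Qed.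

Lemma count_flatten_rows (p : pred nat) t : size t = N ->
  count p (flatten t) = \sum_(i < N) count p (nth [::] t i).
Proof.
move=> st; rewrite count_flatten sumnE big_map (big_nth [::]) st big_mkord.
by [].
Qed.

Lemma has_content_fill k a m l t : interlace m l -> padded_tableau k m t ->
  has_content k.+1 a (fill_rows k l t) = (mdeg m + a k == mdeg l) && has_content k a t.
Proof.
move=> il P; have [st sz _ lt _] := P.
have cnt (p : pred nat) : count p (flatten (fill_rows k l t)) =
    count p (flatten t) + p k * (mdeg l - mdeg m).
  rewrite !count_flatten_rows ?size_mkseq // !mdegE_nth.
  rewrite -sumnB => [|i _]; last exact: (nth_interlace i il).1.
  rewrite big_distrr -big_split; apply: eq_bigr => i _ /=.
  by rewrite nth_fill_rows // count_cat count_nseq sz.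
have le : mdeg m <= mdeg l by rewrite mdeg_le //; case/andP: il.
rewrite /has_content -[k.+1]addn1 iotaD all_cat andbC /= andbT add0n; congr (_ && _).
  rewrite cnt /= eqxx mul1n (_ : count_mem k _ = 0); last first.
    apply/eqP; rewrite count_flatten_rows // sum_nat_eq0; apply/forallP => i; apply/implyP => _.
    rewrite -leqn0 leqNgt -has_count; apply/hasPn => x /(nthP 0)[c hc <-].
    by rewrite /= neq_ltn lt // -sz.
  by rewrite add0n; lia.
apply: eq_in_all => i; rewrite mem_iota => /andP[_ hi]; rewrite cnt /=.
by rewrite (gtn_eqF hi) mul0n addn0.
Qed.

Lemma count_ptab k a l : dominant l ->
  count (has_content k a) (ptab k l) = kostka k a l.
Proof.
elim: k l => [|k IH] l dl /=; first by case: eqP.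
rewrite count_flatten sumnE !big_map [RHS]big_mkcond.
apply: eq_big_seq => m; rewrite mem_hstrips => il /=.
have dm := interlace_dominant il dl.
rewrite count_map -IH //; case: ifP => h; last first.
  apply/eqP; rewrite -leqn0 leqNgt -has_count; apply/hasPn => t /(ptabP k t dm) P /=.
  by rewrite (has_content_fill a il P) h.
apply: eq_in_count => t /(ptabP k t dm) P /=.
by rewrite (has_content_fill a il P) h.
Qed.

End PaddedTableaux.

Section Tableaux.

Variables (N : nat) (la : part).
Hypothesis size_la : (size la <= N)%N.

Definition mnm_part (N : nat) (la : seq nat) : 'X_{1..N} := [multinom nth 0%N la i | i < N].

Lemma nth_mnm_part (nu : part) i : (size nu <= N)%N -> nth 0%N (mnm_part N nu) i = nth 0%N nu i.
Proof.
move=> sz; case: (ltnP i N) => h; first by rewrite -(mnm_nth 0%N _ (Ordinal h)) mnmE.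
by rewrite nth_mnm_big // nth_default // (leq_trans sz).
Qed.

Lemma dominant_mnm_part (nu : part) : dominant (mnm_part N nu).
Proof.
move=> i j lt; rewrite !mnmE; move: (nat_of_ord i) (nat_of_ord j) lt => {}i {}j.
elim: j => // j IH; rewrite ltnS leq_eqVlt => /orP[/eqP->|/IH]; first exact: part_nth_geq.
by apply: leq_trans; apply: part_nth_geq.
Qed.

Definition pad (t : seq (seq nat)) := t ++ nseq (N - size t) [::].

Definition tabs : seq (ssyt la) :=
  pmap insub [seq take (size la) t | t <- ptab N (mnm_part N la)].

Lemma padded_tableau_ssyt (t : ssyt la) :
  all (fun x => x < N)%N (flatten t) -> padded_tableau N (mnm_part N la) (pad t).
Proof.
move=> lt; have st : size t = size la.
  by case: t {lt} => t /= /and3P[/eqP <- _ _]; rewrite size_map.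
have nt i : nth [::] (pad t) i = nth [::] t i.
  rewrite nth_cat; case: ltnP => // h; rewrite nth_nseq nth_default //.
  by case: ifP.
split; rewrite /entry.
- by rewrite size_cat size_nseq st subnKC.
- by move=> i; rewrite nt ssyt_size nth_mnm_part.
- move=> i c; rewrite nt nth_mnm_part // -(ssyt_size t) => hc.
  have : sorted leq (nth [::] t i).
    case: (ltnP i (size t)) => hi; last by rewrite nth_default.
    by case: t hi {lt st nt hc} => t /= /and3P[_ /all_nthP h _] hi; apply: h.
  by move/(sortedP 0%N); apply.
- move=> i c; rewrite nt nth_mnm_part // -(ssyt_size t) => hc.
  apply: (allP lt); apply/flattenP; exists (nth [::] t i); last exact: mem_nth.
  apply: mem_nth; rewrite ltnNge; apply/negP => h; move: hc.
  by rewrite nth_default.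
- move=> i c; rewrite !nt nth_mnm_part // => hc.
  have hi : (i.+1 < size t)%N.
    rewrite ltnNge; apply/negP => h; move: hc.
    by rewrite -(ssyt_size t) nth_default.
  have : column_strict (nth [::] t i) (nth [::] t i.+1).
    by case: t hi {lt st nt} => t /= /and3P[_ _ /(sortedP [::]) h] hi; apply: h.
  have hc' : (c < nth 0 la i)%N := leq_trans hc (part_nth_geq la i).
  move/(all_nthP (0%N, 0%N)) => /(_ c).
  by rewrite size_zip !ssyt_size leq_min hc hc' nth_zip_cond size_zip
       !ssyt_size leq_min hc hc' => /(_ isT).
Qed.

Lemma ssyt_padded_tableau t : padded_tableau N (mnm_part N la) t ->
  is_ssyt la (take (size la) t) /\ pad (take (size la) t) = t.
Proof.
case=> st sz mono lt col.
have nt i : (i < size la)%N -> nth [::] (take (size la) t) i = nth [::] t i.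
  by move=> h; rewrite nth_take.
have stk : size (take (size la) t) = size la by rewrite size_takel ?st.
have ss : is_ssyt la (take (size la) t).
  apply/and3P; split.
  - apply/eqP/(@eq_from_nth _ 0%N); rewrite size_map stk // => i hi.
    by rewrite (nth_map [::]) ?stk // nt // sz nth_mnm_part.
  - apply/(all_nthP [::]) => i; rewrite stk => hi; rewrite nt //.
    by apply: row_sorted => c; rewrite sz; apply: mono.
  - apply/(sortedP [::]) => i; rewrite stk => hi.
    rewrite (nt _ hi) (nt _ (ltnW hi)).
    apply/(all_nthP (0%N, 0%N)) => c; rewrite nth_zip_cond => hc; rewrite hc /=.
    by move: hc; rewrite size_zip leq_min => /andP[_]; rewrite sz; apply: col.
split=> //.
rewrite /pad stk -[RHS](cat_take_drop (size la)); congr (_ ++ _).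
apply: (@eq_from_nth _ [::]); rewrite size_nseq ?size_drop ?st // => i hi.
rewrite nth_nseq hi nth_drop; apply/esym/size0nil.
by rewrite sz nth_mnm_part // nth_default // leq_addr.
Qed.

Lemma mem_tabs (t : ssyt la) : (t \in tabs) = all (fun x => x < N)%N (flatten t).
Proof.
have dl := dominant_mnm_part la.
rewrite mem_pmap_sub; apply/mapP/idP => [[u /(ptabP N u dl) P e]|lt].
  have [_ sz _ lt _] := P; rewrite [val t]e; apply/allP => x /flattenP[r hr].
  have /mem_take hr' := hr.
  case/(nthP [::]): hr' => i hi <- /(nthP 0%N)[c hc <-].
  by apply: lt; rewrite -sz.
have st : size t = size la.
  by case: t {lt} => t /= /and3P[/eqP <- _ _]; rewrite size_map.
exists (pad t); last by rewrite /pad -st take_size_cat.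
by apply/ptabP => //; apply: padded_tableau_ssyt.
Qed.

Lemma tabs_uniq : uniq tabs.
Proof.
have dl := dominant_mnm_part la.
apply: pmap_sub_uniq; rewrite map_inj_in_uniq ?ptab_uniq // => t u.
move=> /(ptabP N t dl) /ssyt_padded_tableau[_ e] /(ptabP N u dl) /ssyt_padded_tableau[_ e'] h.
by rewrite -e -e' h.
Qed.

Lemma flatten_pad t : flatten (pad t) = flatten t.
Proof.
rewrite flatten_cat (_ : flatten (nseq _ _) = [::]) ?cats0 //.
by elim: (_ - _)%N.
Qed.

Lemma count_tabs (b : nat -> nat) :
  count (fun t => [forall i : 'I_N, tabmonom t i == b i]) tabs = kostka N b (mnm_part N la).
Proof.
have dl := dominant_mnm_part la.
rewrite -count_ptab //.
have e1 : [seq val t | t <- tabs] = [seq take (size la) t | t <- ptab N (mnm_part N la)].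
  rewrite /tabs pmap_filter; last exact: insubK.
  apply/all_filterP/allP => u /mapP[t /(ptabP N t dl) /ssyt_padded_tableau[h _] ->].
  by rewrite isSome_insub.
rewrite (eq_count (a2 := preim val (has_content N b))); last first.
  move=> t; apply/forallP/idP => [h|/allP h i].
    apply/allP => i; rewrite mem_iota => /andP[_ hi].
    by have := h (Ordinal hi); rewrite tabmonomE.
  by rewrite tabmonomE; apply: h; rewrite mem_iota /= add0n.
rewrite -count_map e1 count_map; apply: eq_in_count => t.
move/(ptabP N t dl) /ssyt_padded_tableau => [_ e] /=.
by rewrite /has_content -[in RHS]e flatten_pad.
Qed.

Definition content (t : ssyt la) : 'X_{1..N} := [multinom tabmonom t i | i < N].

Lemma count_content (a : 'X_{1..N}) :
  count (fun t => content t == a) tabs = kostka N (nth 0%N a) (mnm_part N la).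
Proof.
rewrite -count_tabs //; apply: eq_count => t; apply/eqP/forallP => [<- i|h].
  by rewrite -(mnm_nth 0%N) mnmE.
by apply/mnmP => i; rewrite mnmE (eqP (h i)) (mnm_nth 0%N).
Qed.

End Tableaux.

(** * Orthogonality of Schur polynomials *)

Definition cmon (N : nat) (m : 'X_{1..N}) : monalg.cmonom nat :=
  \big[mmul/mone]_(i < N) expcmn (ucm (i : nat)) (m i).

Lemma cmonE N (m : 'X_{1..N}) i : cmon m i = nth 0%N m i.
Proof.
rewrite /cmon cm_prodE; case: (ltnP i N) => h.
  rewrite (bigD1 (Ordinal h)) //= expcmE cmU eqxx mul1n -(mnm_nth 0%N m (Ordinal h)).
  rewrite big1 ?addn0 // => j; rewrite -val_eqE /= expcmE cmU => /negbTE->.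
  by rewrite mul0n.
rewrite nth_mnm_big // big1 // => j _; rewrite expcmE cmU.
by rewrite ltn_eqF ?mul0n // (leq_trans (ltn_ord j)).
Qed.

Lemma cmon_mnm_part N (la : part) : (size la <= N)%N -> cmon (mnm_part N la) = partmonom la.
Proof. by move=> h; apply/eqP/cmP => i; rewrite cmonE nth_mnm_part // partmonomE. Qed.

Lemma fsbig_card (T : choiceType) (r : seq T) (P : set T) :
  uniq r -> (forall x, x \in r <-> P x) ->
  \sum_(x \in P) (1 : int) = (size r)%:R.
Proof.
move=> ur hr; have -> : P = [set` r]%classic.
  by apply/seteqP; split=> x /=; apply hr.
by rewrite -fsbig_seq // big_const_seq count_predT iter_addr_0.
Qed.

Lemma schur_cmon N (la : part) (m : 'X_{1..N}) : (size la <= N)%N ->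
  schur la (cmon m) = (kostka N (nth 0%N m) (mnm_part N la))%:R.
Proof.
move=> sz; rewrite -count_tabs // -size_filter; apply: fsbig_card.
  by rewrite filter_uniq // tabs_uniq.
move=> t; rewrite mem_filter mem_tabs //=; split.
  case/andP=> /forallP h /allP lt; apply/eqP/cmP => i; rewrite cmonE.
  case: (ltnP i N) => hi; first exact/eqP/(h (Ordinal hi)).
  rewrite nth_mnm_big // tabmonomE; apply/count_memPn/negP => /lt.
  by rewrite ltnNge hi.
move=> e; apply/andP; split; first by apply/forallP => i; rewrite e cmonE.
apply/allP => x xt; rewrite ltnNge; apply/negP => h.
have := tabmonomE t x; rewrite e cmonE nth_mnm_big // => /esym/eqP.
by rewrite -leqn0 leqNgt -has_count has_pred1 xt.
Qed.


(** The part of degree r in the first N variables. *)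
Definition serpoly (N r : nat) (F : pseries) : {mpoly rat[N]} :=
  \sum_(b : 'X_{1..N < r.+1} | mdeg b == r) (F (cmon b))%:~R *: 'X_[b].

Lemma mcoeff_serpoly N r F (m : 'X_{1..N}) :
  (serpoly N r F)@_m = if mdeg m == r then (F (cmon m))%:~R else 0.
Proof.
rewrite raddf_sum /=; case: eqP => [hm|hm].
  have lt : (mdeg m < r.+1)%N by rewrite hm.
  rewrite (bigD1 (BMultinom lt)) /= ?hm // mcoeffZ mcoeffX eqxx mulr1 big1 ?addr0 // => b.
  by rewrite bmeqP /= mcoeffZ mcoeffX => /andP[_ /negbTE->]; rewrite mulr0.
rewrite big1 // => b /eqP hb; rewrite mcoeffZ mcoeffX.
by case: eqP => [e|]; [case: hm; rewrite -e | rewrite mulr0].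
Qed.

Section Contingency.

Variables (N B : nat).

(** The rows of a matrix of natural numbers are encoded as exponents; its row
    sums are a and its column sums are b.  The bound B makes the type finite. *)
Definition margins (a b : 'X_{1..N}) (f : {ffun 'I_N -> 'X_{1..N < B}}) : bool :=
  [forall i, (mdeg (f i) == a i) && (\sum_j bmnm (f j) i == b i)%N].

(** To expand the product is to choose a monomial of degree a_i, the i-th row,
    from each factor. *)
Lemma mcoeff_homogeneous_prod (a b : 'X_{1..N}) : (mdeg a < B)%N ->
  (homogeneous_prod N N (nth 0%N a))@_b = #|[pred f | margins a b f]|%:R.
Proof.
move=> ha.
have hB i : (a i < B)%N by apply: leq_ltn_trans ha; rewrite mdegE (bigD1 i) ?leq_addr.
have e k : (k < B)%N ->
    homogeneous_sum N k = \sum_(c : 'X_{1..N < B} | mdeg c == k) 'X_[c] :> {mpoly rat[N]}.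
  move=> hk; apply/mpolyP => m; rewrite mcoeff_homogeneous_sum raddf_sum /=.
  case: eqP => [hm|hm].
    have lt : (mdeg m < B)%N by rewrite hm.
    rewrite (bigD1 (BMultinom lt)) /= ?hm // mcoeffX eqxx big1 ?addr0 // => c.
    by rewrite bmeqP /= mcoeffX => /andP[_ /negbTE->].
  by rewrite big1 // => c /eqP hc; rewrite mcoeffX; case: eqP => // e; case: hm; rewrite -e.
rewrite /homogeneous_prod.
rewrite (eq_bigr (fun i : 'I_N => \sum_(c : 'X_{1..N < B} | mdeg c == a i) 'X_[c])); last first.
  by move=> i _; rewrite -(mnm_nth 0%N) e.
rewrite bigA_distr_big_dep raddf_sum /= -sum1_card natr_sum big_mkcond [RHS]big_mkcond /=.
apply: eq_bigr => f _; rewrite mprodXE mcoeffX.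
transitivity (if margins a b f then 1 else 0 : rat); last by [].
case: (boolP (margins a b f)) => [/forallP mf|nmf].
  rewrite ifT; last by apply/familyP => i; case/andP: (mf i).
  suff -> : (\sum_j f j)%MM = b by rewrite eqxx.
  by apply/mnmP => i; rewrite mnm_sumE; case/andP: (mf i) => _ /eqP.
case: ifP => // /familyP fam; case: eqP => // eb; case/negP: nmf.
apply/forallP => i; have h : mdeg (f i) == a i := fam i; rewrite h.
by rewrite -eb mnm_sumE eqxx.
Qed.

Definition transpose_mnm (f : {ffun 'I_N -> 'X_{1..N < B}}) : {ffun 'I_N -> 'X_{1..N < B}} :=
  [ffun i => insubd (f i) [multinom bmnm (f j) i | j < N]].

Lemma transpose_mnmE a b f i j : (mdeg b < B)%N -> margins a b f ->
  bmnm (transpose_mnm f i) j = bmnm (f j) i.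
Proof.
move=> hb /forallP mf; rewrite ffunE val_insubd mdegE.
rewrite (eq_bigr (fun j => bmnm (f j) i)) => [|c _]; last by rewrite mnmE.
have /andP[_ /eqP->] := mf i.
by rewrite (leq_ltn_trans _ hb) ?mnmE // mdegE (bigD1 i) ?leq_addr.
Qed.

Lemma margins_transpose a b f : (mdeg b < B)%N -> margins a b f -> margins b a (transpose_mnm f).
Proof.
move=> hb mf; have tE i j := transpose_mnmE i j hb mf.
move/forallP: mf => mf; apply/forallP => i; apply/andP; split.
  rewrite mdegE (eq_bigr (fun j => bmnm (f j) i)) => [|c _]; last by rewrite tE.
  by case/andP: (mf i).
rewrite (eq_bigr (fun j => bmnm (f i) j)) => [|c _]; last by rewrite tE.
by rewrite -mdegE; case/andP: (mf i).
Qed.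

Lemma card_margins_le a b : (mdeg b < B)%N ->
  (#|[pred f | margins a b f]| <= #|[pred f | margins b a f]|)%N.
Proof.
move=> hb; rewrite -(@card_in_image _ _ transpose_mnm).
  by apply/subset_leq_card/fintype.subsetP => g /fintype.imageP[f mf ->]; apply: margins_transpose.
move=> f g mf mg e; apply/ffunP => j; apply/eqP; rewrite bmeqP; apply/eqP/mnmP => i.
by rewrite -(transpose_mnmE i j hb mf) -(transpose_mnmE i j hb mg) e.
Qed.

End Contingency.

(** Transposition of matrices exchanges row sums and column sums. *)
Lemma homogeneous_prod_sym N (a b : 'X_{1..N}) :
  (homogeneous_prod N N (nth 0%N a))@_b = (homogeneous_prod N N (nth 0%N b))@_a.
Proof.
have ha : (mdeg a < (maxn (mdeg a) (mdeg b)).+1)%N by rewrite ltnS leq_maxl.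
have hb : (mdeg b < (maxn (mdeg a) (mdeg b)).+1)%N by rewrite ltnS leq_maxr.
rewrite (mcoeff_homogeneous_prod b ha) (mcoeff_homogeneous_prod a hb).
by congr _%:R; apply/eqP; rewrite eqn_leq !card_margins_le.
Qed.

Section Orthogonality.

Variable N : nat.
Local Notation delta := (delta N).
Implicit Types (l m : 'X_{1..N}) (la nu : part).


Lemma height_cmwt m : height m = cmwt N (cmon m).
Proof.
by apply: eq_bigr => i _; rewrite cmonE (mnm_nth 0%N).
Qed.

Lemma above_height l m : above l m -> (height l < height m)%N.
Proof.
case=> n [n_pos [a [b nab]] hn].
have : (\sum_i (m i + \sum_j n j i) * (N - i) = \sum_i (l i + \sum_j n i j) * (N - i))%N.
  by apply: eq_bigr => i _; rewrite hn.
rewrite (eq_bigr (fun i : 'I_N => m i * (N - i) + \sum_j n j i * (N - i))%N); last first.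
  by move=> i _; rewrite mulnDl big_distrl.
rewrite [RHS](eq_bigr (fun i : 'I_N => l i * (N - i) + \sum_j n i j * (N - i))%N); last first.
  by move=> i _; rewrite mulnDl big_distrl.
rewrite !big_split /= exchange_big /= => e.
suff : (\sum_(i < N) \sum_j n i j * (N - j) < \sum_(i < N) \sum_j n i j * (N - i))%N.
  move=> h; rewrite -(ltn_add2r (\sum_(j < N) \sum_(i < N) n j i * (N - i))%N).
  by rewrite [X in (_ < X)%N]e ltn_add2l.
have le (i j : 'I_N) : (n i j * (N - j) <= n i j * (N - i))%N.
  have [->|/n_pos lt] := eqVneq (n i j) 0%N; first by [].
  by rewrite leq_mul2l leq_sub2l ?orbT // ltnW.
rewrite (bigD1 a) //= [X in (_ < X)%N](bigD1 a) //= -addSn leq_add //; last first.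
  by apply: leq_sum => i _; apply: leq_sum => j _; apply: le.
rewrite (bigD1 b) //= [X in (_ < X)%N](bigD1 b) //= -addSn leq_add //; last first.
  by apply: leq_sum => j _; apply: le.
by rewrite ltn_pmul2l ?lt0n // ltn_sub2l ?n_pos.
Qed.

(** The entries in row i of a tableau are at least i, so that a content has the
    largest height if all of them are equal to i. *)
Lemma schur_height nu m : schur nu (cmon m) != 0 -> (size nu <= N)%N ->
  (height m <= height (mnm_part N nu))%N.
Proof.
move=> nz sz; rewrite !height_cmwt cmon_mnm_part //.
have [t <-] : exists t : ssyt nu, tabmonom t = cmon m.
  apply: contrapT => h; case/eqP: nz; rewrite /schur.
  rewrite (_ : [set t | _]%classic = set0) ?fsbig_set0 //.
  by rewrite -subset0 => t /= e; apply: h; exists t.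
by case: (cmwt_tab t sz).
Qed.

(** The coefficient of x^(l + delta) y^(m + delta) in the product of the two
    alternants and of all 1 / (1 - x_i y_j). *)
Definition double_alt l m : rat :=
  \sum_(s : 'S_N) \sum_(t : 'S_N) (-1) ^+ s * (-1) ^+ t *
    (if (delta#s <= l + delta)%MM && (delta#t <= m + delta)%MM then
      (homogeneous_prod N N (nth 0%N (l + delta - delta#s)%MM))@_(m + delta - delta#t) else 0).

Lemma double_alt_sym l m : double_alt l m = double_alt m l.
Proof.
rewrite /double_alt exchange_big; apply: eq_bigr => s _; apply: eq_bigr => t _.
rewrite [X in X * _]mulrC andbC; case: ifP => // _; congr (_ * _).
exact: homogeneous_prod_sym.
Qed.

Lemma mdeg_sub_perm l (s : 'S_N) : (delta#s <= l + delta)%MM ->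
  mdeg (l + delta - delta#s) = mdeg l.
Proof.
move=> le; have := congr1 (@mdeg N) (submK le).
by rewrite mdegD mdegD mdeg_mperm => /addIn.
Qed.

Lemma altcoeff_schur_sum l nu r : (size nu <= N)%N -> mdeg l = r ->
  altcoeff l (serpoly N r (schur nu)) =
  \sum_(s : 'S_N) (-1) ^+ s * (if (delta#s <= l + delta)%MM then
     (schur nu (cmon (l + delta - delta#s)%MM))%:~R else 0).
Proof.
move=> sz hl; rewrite /altcoeff mcoeff_altM; apply: eq_bigr => s _; congr (_ * _).
by case: ifP => // le; rewrite mcoeff_serpoly mdeg_sub_perm // hl eqxx.
Qed.

Lemma altcoeff_schur_double l nu r : (size nu <= N)%N -> mdeg l = r ->
  altcoeff l (serpoly N r (schur nu)) = double_alt l (mnm_part N nu).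
Proof.
move=> sz hl; rewrite altcoeff_schur_sum //; apply: eq_bigr => s _.
rewrite (eq_bigr (fun t : 'S_N => (-1) ^+ s * ((-1) ^+ t * (if (delta#s <= l + delta)%MM &&
   (delta#t <= mnm_part N nu + delta)%MM then (homogeneous_prod N N
    (nth 0%N (l + delta - delta#s)%MM))@_(mnm_part N nu + delta - delta#t) else 0)))); last first.
  by move=> t _; rewrite mulrA.
rewrite -mulr_sumr; congr (_ * _); case: ifP => le /=; last first.
  by rewrite big1 // => t _; rewrite mulr0.
rewrite schur_cmon // -mcoeff_altM -/(altcoeff _ _).
rewrite altcoeff_homogeneous_prod ?natz //; exact: dominant_mnm_part.
Qed.

(** [double_alt] is symmetric in l and nu.  If it is nonzero, then
    [schur_height] bounds the height of l by that of nu, and by symmetry the two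
    heights agree.  Then only the identity permutation contributes, and the
    extremal property of Schur functions gives the value. *)
Lemma altcoeff_schur la nu r : (size la <= N)%N -> (size nu <= N)%N ->
  mdeg (mnm_part N la) = r -> mdeg (mnm_part N nu) = r ->
  altcoeff (mnm_part N la) (serpoly N r (schur nu)) = (nu == la)%:R.
Proof.
move=> sl sn hl hn.
have le_height la' nu' : (size nu' <= N)%N -> mdeg (mnm_part N la') = r ->
    altcoeff (mnm_part N la') (serpoly N r (schur nu')) != 0 ->
    (height (mnm_part N la') <= height (mnm_part N nu'))%N.
  move=> sn' hl'; rewrite altcoeff_schur_sum // => nz.
  have [s] : exists s : 'S_N, (-1) ^+ s * (if (delta#s <= mnm_part N la' + delta)%MM then
     (schur nu' (cmon (mnm_part N la' + delta - delta#s)%MM))%:~R else 0) != 0 :> rat.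
    apply/existsP; apply: contraNT nz => /existsPn h; rewrite big1 // => s _.
    by apply/eqP; have := h s; rewrite negbK.
  rewrite mulf_eq0 negb_or => /andP[_]; case: ifP => [le|]; last by rewrite eqxx.
  rewrite intr_eq0 => /schur_height/(_ sn'); apply: leq_trans.
  have [e|ns] := eqVneq s 1%g; last by apply/ltnW/above_height/delta_perm_above.
  by rewrite e (_ : delta#(1%g : 'S_N) = delta) ?addmK //; apply/mnmP => i; rewrite mnmE perm1.
have [eh|nh] := eqVneq (height (mnm_part N la)) (height (mnm_part N nu)).
  rewrite altcoeff_schur_sum // (bigD1 1%g) //= big1 ?addr0 => [|s ns].
    rewrite odd_perm1 mul1r (_ : delta#(1%g : 'S_N) = delta); last first.
      by apply/mnmP => i; rewrite mnmE perm1.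
    rewrite lem_addl addmK cmon_mnm_part // (schur_extremal sn) ?pmulrn //.
      by case: eqP.
    by move: eh; rewrite !height_cmwt !cmon_mnm_part // => ->.
  case: ifP => [le|]; last by rewrite mulr0.
  have [->|nz] := eqVneq (schur nu (cmon (mnm_part N la + delta - delta#s)%MM)) 0.
    by rewrite mulr0.
  have := schur_height nz sn; rewrite -eh leqNgt.
  by move/negP; case; apply/above_height/delta_perm_above.
have -> : nu == la = false by apply: contraNF nh => /eqP->.
apply/eqP; apply: contraNT nh => nz.
rewrite eqn_leq le_height //=; apply: le_height => //.
by rewrite altcoeff_schur_double // double_alt_sym -(altcoeff_schur_double (r := r)).
Qed.

(** The number of tableaux of a given content is a coefficient of a product of
    complete homogeneous polynomials, where the order of the factors is
    immaterial. *)
Lemma schur_symmetric r nu (s : 'S_N) : (size nu <= N)%N ->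
  msym s (serpoly N r (schur nu)) = serpoly N r (schur nu).
Proof.
move=> sz; apply/mpolyP => m; rewrite mcoeff_sym !mcoeff_serpoly mdeg_mperm.
case: ifP => // _; rewrite !schur_cmon // !mulrz_nat.
rewrite -!altcoeff_homogeneous_prod; try exact: dominant_mnm_part.
congr (altcoeff _ _); rewrite /homogeneous_prod [RHS](reindex_perm s).
by apply: eq_bigr => i _; rewrite -!(mnm_nth 0%N) mnmE.
Qed.

End Orthogonality.

(** * Coordinates in the Schur basis *)

Lemma alt_neq0 N : alt N != 0.
Proof.
apply/eqP => h; have := altcoeff1 (0%MM : 'X_{1..N}).
by rewrite /altcoeff h mul0r mcoeff0 eqxx => /esym/eqP; rewrite oner_eq0.
Qed.

(** An exponent of maximal height in the support is strictly decreasing: any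
    other one is raised by a transposition or fixed by one, and in the latter
    case the coefficient is its own opposite. *)
Lemma antisymmetric_eq0 N (H : {mpoly rat[N]}) :
    (forall s : 'S_N, msym s H = (-1) ^+ s *: H) ->
    (forall m, dominant m -> H@_(m + delta N) = 0) ->
  H = 0.
Proof.
move=> antiH H0; apply/eqP; apply/negPn/negP => nzH.
have anti (i j : 'I_N) (k : 'X_{1..N}) : i != j -> H@_(k#(tperm i j)) = - H@_k.
  by move=> ne; rewrite -mcoeff_sym antiH mcoeffZ odd_tperm ne expr1 mulN1r.
(* k has maximal height in the support. *)
have [k kH kmax] : exists2 k, k \in msupp H &
    forall k', k' \in msupp H -> (height k' <= height k)%N.
  have lt0 : (0 < size (msupp H))%N by rewrite lt0n size_eq0 msupp_eq0.
  pose t (i : 'I_(size (msupp H))) := nth 0%MM (msupp H) i.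
  have [i _ hi] := @arg_maxnP _ (Ordinal lt0) xpredT (fun i => height (t i)) isT.
  exists (t i) => [|k' hk']; first exact: mem_nth.
  have lt : (index k' (msupp H) < size (msupp H))%N by rewrite index_mem.
  by have := hi (Ordinal lt) isT; rewrite /t /= nth_index.
have dec (i j : 'I_N) : (i < j)%N -> (k j < k i)%N.
  move=> lt_ij; have ne : i != j by rewrite -val_eqE neq_ltn lt_ij.
  rewrite ltnNge leq_eqVlt; apply/negP => /orP[/eqP e|lt].
    have := anti i j k ne; rewrite (_ : k#(tperm i j) = k) => [e'|].
      by move: kH; rewrite mcoeff_msupp (_ : H@_k = 0) ?eqxx //; lra.
    by apply/mnmP => c; rewrite mnmE; case: tpermP => // ->.
  have : k#(tperm i j) \in msupp H by rewrite mcoeff_msupp anti // oppr_eq0 -mcoeff_msupp.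
  move/kmax; rewrite leqNgt => /negP; apply; apply: above_height.
  apply: (above_root (c := k j - k i) lt_ij); first by rewrite subn_gt0.
  move=> p; rewrite mnmE; case: tpermP => [->|->|/eqP/negbTE-> /eqP/negbTE-> //].
    by rewrite eqxx (negbTE ne); lia.
  by rewrite eqxx eq_sym (negbTE ne); lia.
have gap (d : nat) (i j : 'I_N) : j = (i + d)%N :> nat -> (k j + d <= k i)%N.
  elim: d i => [|d IH] i e.
    by move: e; rewrite !addn0 => /ord_inj->.
  have lt : (i.+1 < N)%N by have := ltn_ord j; lia.
  have := dec i (Ordinal lt) (leqnn _); have := IH (Ordinal lt); rewrite /= e addSnnS => /(_ erefl).
  lia.
have dk : (delta N <= k)%MM.
  apply/mnm_lepP => i; rewrite mnmE.
  have lt : (N.-1 < N)%N by have := ltn_ord i; lia.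
  have := gap (N - i.+1)%N i (Ordinal lt); have := ltn_ord i => /= lt_i.
  by move=> h; apply: leq_trans (h _); lia.
move: kH; rewrite mcoeff_msupp -(submK dk) H0 ?eqxx // => i j lt_ij.
have := gap (j - i)%N i j; rewrite !mnmBE !mnmE; have := ltn_ord j; lia.
Qed.

Section Partitions.

Implicit Types (la nu : part).

Lemma psize_mnm_part N la : (size la <= N)%N -> mdeg (mnm_part N la) = psize la.
Proof.
move=> sz; rewrite /psize sumnE (big_nth 0%N) big_mkord mdegE.
rewrite (big_ord_widen N (fun i => nth 0%N la i) sz) [RHS]big_mkcond /=.
by apply: eq_bigr => i _; rewrite mnmE; case: ltnP => // h; rewrite nth_default.
Qed.

Lemma size_le_psize la : (size la <= psize la)%N.
Proof.
rewrite /psize; case: la => s /= /andP[_]; elim: s => //= x s IH.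
rewrite inE negb_or => /andP[nx /IH]; move: nx; rewrite eq_sym -lt0n; lia.
Qed.

Lemma nth_filter_pos s i : sorted geq s -> nth 0%N [seq x <- s | 0 < x]%N i = nth 0%N s i.
Proof.
elim: s i => //= x s IH i px; have ss := path_sorted px.
case: (posnP x) => [x0|xp] /=; last by case: i => //= i; apply: IH.
have z y : y \in s -> y = 0%N.
  move=> ys; move: px; rewrite path_sortedE => [/andP[/allP/(_ y ys)]|].
    by rewrite x0 /= leqn0 => /eqP.
  by move=> a b c /= h1 h2; apply: leq_trans h2 h1.
rewrite (_ : [seq y <- s | _] = [::]); last first.
  by apply/eqP; rewrite -size_eq0 size_filter -leqn0 leqNgt -has_count;
     apply/hasPn => y /z ->.
rewrite nth_nil; case: i => //= i; case: (ltnP i (size s)) => h; last by rewrite nth_default.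
by rewrite (z _ (mem_nth _ h)).
Qed.

Lemma sorted_dominant N (m : 'X_{1..N}) : dominant m -> sorted geq m.
Proof.
move=> dm; apply/(sortedP 0%N) => i; rewrite size_tuple => hi.
by have := dm (Ordinal (ltnW hi)) (Ordinal hi) (leqnn _); rewrite !(mnm_nth 0%N).
Qed.

Lemma dominant_part N (m : 'X_{1..N}) : dominant m ->
  exists2 la : part, (size la <= N)%N & mnm_part N la = m.
Proof.
move=> dm; have sm := sorted_dominant dm.
have ip : is_part [seq x <- m | 0 < x]%N.
  rewrite /is_part sorted_filter //=; last by move=> a b c /= h1 h2; apply: leq_trans h2 h1.
  by rewrite mem_filter.
exists (Part ip); first by rewrite size_filter (leq_trans (count_size _ _)) // size_tuple.
by apply/mnmP => i; rewrite mnmE /= nth_filter_pos // -(mnm_nth 0%N).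
Qed.

(** Partitions are read off from exponents in r variables by omitting zeros. *)
Definition parts_of (r : nat) : seq part :=
  undup [seq la <- pmap insub
    [seq [seq x <- bmnm b | 0 < x]%N | b <- enum {: 'X_{1..r < r.+1}}] | psize la == r].

Lemma mem_parts_of r la : (la \in parts_of r) = (psize la == r).
Proof.
rewrite mem_undup mem_filter; case: eqP => //= hr; rewrite mem_pmap_sub.
have sz : (size la <= r)%N by rewrite -hr size_le_psize.
have lt : (mdeg (mnm_part r la) < r.+1)%N by rewrite psize_mnm_part // hr.
apply/mapP; exists (BMultinom lt); first by rewrite mem_enum.
have sm := sorted_dominant (@dominant_mnm_part r la).
rewrite /=; set s := [seq x <- _ | _].
have ip : is_part s.
  rewrite /is_part /s sorted_filter //=; last by move=> a b c /= h1 h2; apply: leq_trans h2 h1.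
  by rewrite mem_filter.
have -> : la = Part ip; last by [].
apply: partmonom_inj; apply/eqP/cmP => i; rewrite !partmonomE /= nth_filter_pos //.
by rewrite nth_mnm_part.
Qed.

Lemma parts_of_uniq r : uniq (parts_of r).
Proof. exact: undup_uniq. Qed.

End Partitions.

Lemma altcoeffB N (l : 'X_{1..N}) p q : altcoeff l (p - q) = altcoeff l p - altcoeff l q.
Proof. by rewrite /altcoeff mulrBr mcoeffB. Qed.

Lemma altcoeffZ N (l : 'X_{1..N}) c p : altcoeff l (c *: p) = c * altcoeff l p.
Proof. by rewrite /altcoeff -scalerAr mcoeffZ. Qed.

Lemma altcoeff_sum N (l : 'X_{1..N}) (I : Type) (r : seq I) (F : I -> {mpoly rat[N]}) :
  altcoeff l (\sum_(i <- r) F i) = \sum_(i <- r) altcoeff l (F i).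
Proof. by rewrite /altcoeff mulr_sumr raddf_sum. Qed.

Lemma altcoeff_serpoly_deg N r F (l : 'X_{1..N}) : mdeg l != r ->
  altcoeff l (serpoly N r F) = 0.
Proof.
move=> nl; rewrite /altcoeff mcoeff_altM big1 // => s _.
case: ifP => le; last by rewrite mulr0.
by rewrite mcoeff_serpoly mdeg_sub_perm // (negbTE nl) mulr0.
Qed.

(** The difference of the two sides, multiplied by the alternant, is
    antisymmetric; by orthogonality its coefficients at l + delta vanish for all
    dominant l. *)
Lemma symmetric_expansion N r (F : pseries) : (r <= N)%N ->
    (forall s : 'S_N, msym s (serpoly N r F) = serpoly N r F) ->
  serpoly N r F = \sum_(la <- parts_of r)
    altcoeff (mnm_part N la) (serpoly N r F) *: serpoly N r (schur la).
Proof.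
move=> le_rN symF; apply/eqP; rewrite -subr_eq0; set D := _ - _.
suff : alt N * D = 0 by move/eqP; rewrite mulf_eq0 (negbTE (alt_neq0 N)).
have sz la : la \in parts_of r -> (size la <= N)%N.
  rewrite mem_parts_of => /eqP e; apply: leq_trans (size_le_psize _) _.
  by rewrite e.
apply: antisymmetric_eq0 => [s|m dm].
  rewrite msymM msym_alt -scalerAl; congr (_ *: (_ * _)).
  rewrite /D msymB symF; congr (_ - _); rewrite raddf_sum /=; apply: eq_big_seq => la hla.
  by rewrite msymZ schur_symmetric // sz.
rewrite -[LHS]/(altcoeff m D) altcoeffB altcoeff_sum.
have [hm|hm] := eqVneq (mdeg m) r; last first.
  rewrite altcoeff_serpoly_deg // big1 ?subr0 // => la _.
  by rewrite altcoeffZ [X in _ * X]altcoeff_serpoly_deg ?mulr0.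
have [la sla em] := dominant_part dm; rewrite -em in hm *.
have hla : la \in parts_of r by rewrite mem_parts_of -(psize_mnm_part sla) hm.
rewrite (bigD1_seq la) ?parts_of_uniq //= altcoeffZ altcoeff_schur // eqxx mulr1.
rewrite big_seq_cond big1 ?addr0 ?subrr // => nu /andP[hnu ne].
rewrite altcoeffZ altcoeff_schur ?(negbTE ne) ?mulr0 ?sz // psize_mnm_part ?sz //.
by apply/eqP; rewrite -mem_parts_of.
Qed.

Lemma altcoeff_int N r F (l : 'X_{1..N}) : altcoeff l (serpoly N r F) \is a Num.int.
Proof.
rewrite /altcoeff mcoeff_altM rpred_sum // => s _; rewrite rpredM ?rpredX ?rpredN1 //.
by case: ifP => _; rewrite ?rpred0 // mcoeff_serpoly; case: ifP => _; rewrite ?rpred0 ?intr_int.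
Qed.

Lemma cmon_exists (b : monalg.cmonom nat) N0 :
  exists2 N, (N0 <= N)%N & exists m : 'X_{1..N}, cmon m = b.
Proof.
pose N := maxn N0 (\max_(i <- finsupp b) i.+1); exists N; first exact: leq_maxl.
exists [multinom b i | i < N]; apply/eqP/cmP => i; rewrite cmonE.
case: (ltnP i N) => h; first by rewrite -(mnm_nth 0%N _ (Ordinal h)) mnmE.
rewrite nth_mnm_big //; apply/esym/eqP; rewrite cmE_eq0; apply/negP => hi.
move: h; rewrite leqNgt => /negP; apply; rewrite /N leq_max; apply/orP; right.
by rewrite (big_fsetD1 i) //= leq_maxl.
Qed.

Lemma schur_homogeneous N (m : 'X_{1..N}) (la : part) : schur la (cmon m) != 0 -> mdeg m = psize la.
Proof.
move=> nz; have [t e] : exists t : ssyt la, tabmonom t = cmon m.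
  apply: contrapT => h; case/eqP: nz; rewrite /schur.
  rewrite (_ : [set t | _]%classic = set0) ?fsbig_set0 //.
  by rewrite -subset0 => t /= e; apply: h; exists t.
have hx x : x \in flatten t -> (x < N)%N.
  move=> xt; rewrite ltnNge; apply/negP => h.
  have := tabmonomE t x; rewrite e cmonE nth_mnm_big // => /esym/eqP.
  by rewrite -leqn0 leqNgt -has_count has_pred1 xt.
have -> : mdeg m = size (flatten t).
  rewrite mdegE -sum1_size.
  transitivity (\sum_(x <- flatten t) \sum_(i < N) (x == i))%N; last first.
    apply: eq_big_seq => x /hx lt; rewrite (bigD1 (Ordinal lt)) //= eqxx big1 // => i.
    by rewrite -val_eqE /= eq_sym => /negbTE->.
  rewrite exchange_big; apply: eq_bigr => i _ /=.
  rewrite (mnm_nth 0%N) -cmonE -e tabmonomE -sum1_count big_mkcond.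
  by apply: eq_bigr => x _ /=; case: (x == i).
rewrite size_flatten /psize; case: t {e hx} => t /= /and3P[/eqP e _ _].
by congr sumn; rewrite -[RHS]e.
Qed.

Section Hall.

Variables (r N1 : nat) (F : pseries).
Hypothesis le_rN1 : (r <= N1)%N.
Hypothesis homF : forall N (m : 'X_{1..N}), (N1 <= N)%N -> F (cmon m) != 0 -> mdeg m = r.
Hypothesis symF : forall N (s : 'S_N), (N1 <= N)%N -> msym s (serpoly N r F) = serpoly N r F.

(** The expansion in N variables restricts to fewer variables, where the
    coefficients are again determined by orthogonality. *)
Lemma altcoeff_stable N0 N (la : part) : (N1 <= N0)%N -> (N0 <= N)%N -> psize la = r ->
  altcoeff (mnm_part N0 la) (serpoly N0 r F) = altcoeff (mnm_part N la) (serpoly N r F).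
Proof.
move=> h0 h hla; have hN1 := leq_trans h0 h; have hN := leq_trans le_rN1 hN1.
have -> : serpoly N0 r F = \sum_(nu <- parts_of r)
    altcoeff (mnm_part N nu) (serpoly N r F) *: serpoly N0 r (schur nu).
  apply/mpolyP => m; rewrite mcoeff_serpoly.
  pose M : 'X_{1..N} := [multinom nth 0%N m i | i < N].
  have eM : cmon M = cmon m.
    apply/eqP/cmP => i; rewrite !cmonE; case: (ltnP i N) => hi.
      by rewrite -(mnm_nth 0%N _ (Ordinal hi)) mnmE.
    by rewrite !nth_mnm_big // (leq_trans h).
  have dM : mdeg M = mdeg m.
    transitivity (\sum_(i < N) nth 0 m i)%N.
      by rewrite mdegE; apply: eq_bigr => i _; rewrite mnmE.
    transitivity (\sum_(i < N0) nth 0 m i)%N; last first.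
      by rewrite mdegE; apply: eq_bigr => i _; rewrite (mnm_nth 0%N).
    rewrite (big_ord_widen N (fun i => nth 0%N m i) h) [RHS]big_mkcond.
    by apply: eq_bigr => i _; case: ltnP => // hi; rewrite nth_mnm_big.
  rewrite raddf_sum /=.
  have := congr1 (mcoeff M) (symmetric_expansion hN (fun s => symF s hN1)).
  rewrite mcoeff_serpoly dM eM raddf_sum /= => ->.
  by apply: eq_bigr => nu _; rewrite !mcoeffZ !mcoeff_serpoly dM eM.
have sz nu : nu \in parts_of r -> (size nu <= N0)%N.
  by rewrite mem_parts_of => /eqP e; rewrite (leq_trans (size_le_psize _)) // e (leq_trans le_rN1).
have hla' : la \in parts_of r by rewrite mem_parts_of hla.
rewrite altcoeff_sum (bigD1_seq la) ?parts_of_uniq //=.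
rewrite altcoeffZ altcoeff_schur ?psize_mnm_part ?sz // eqxx mulr1.
rewrite big_seq_cond big1 ?addr0 // => nu /andP[hnu ne].
rewrite altcoeffZ altcoeff_schur ?(negbTE ne) ?mulr0 ?psize_mnm_part ?sz //.
by apply/eqP; rewrite -mem_parts_of.
Qed.

(** An integer, since the alternant and the series have integer coefficients. *)
Definition hall_coord (la : part) : int :=
  Num.floor (altcoeff (mnm_part N1 la) (serpoly N1 r F)).

Lemma hall_coordE N (la : part) : (N1 <= N)%N -> psize la = r ->
  (hall_coord la)%:~R = altcoeff (mnm_part N la) (serpoly N r F).
Proof.
move=> h hla; rewrite -(altcoeff_stable (leqnn N1) h hla) /hall_coord.
by rewrite floorK // altcoeff_int.
Qed.

Definition hall_coords : malg part int :=
  \sum_(la <- parts_of r) mkmalgU la (hall_coord la).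

Lemma mcoeff_hall_coords la :
  monalg.mcoeff la hall_coords = if psize la == r then hall_coord la else 0.
Proof.
rewrite raddf_sum /=; case: ifP => h.
  rewrite (bigD1_seq la) ?parts_of_uniq ?mem_parts_of //= monalg.mcoeffUU big1 ?addr0 // => nu.
  by rewrite monalg.mcoeffU => /negbTE->.
rewrite big_seq big1 // => nu; rewrite mem_parts_of monalg.mcoeffU => hnu.
by case: eqP => // e; move: h; rewrite -e hnu.
Qed.

Lemma sum_hall_coords (G : part -> int) :
  \sum_(la <- monalg.msupp hall_coords) monalg.mcoeff la hall_coords * G la =
  \sum_(la <- parts_of r) hall_coord la * G la.
Proof.
rewrite [RHS](bigID (mem (monalg.msupp hall_coords))) /= [X in _ + X]big_seq_cond.
rewrite [X in _ + X]big1 ?addr0 => [|la]; last first.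
  rewrite mem_parts_of => /andP[h]; rewrite -monalg.mcoeff_eq0 mcoeff_hall_coords h => /eqP->.
  by rewrite mul0r.
have mem_supp la : la \in monalg.msupp hall_coords -> psize la == r.
  by rewrite -monalg.mcoeff_neq0 mcoeff_hall_coords; case: ifP => //; rewrite eqxx.
rewrite -[RHS]big_filter (perm_big [seq la <- parts_of r | la \in monalg.msupp hall_coords]) /=.
  apply: eq_big_seq => la; rewrite mem_filter mem_parts_of => /andP[_ h].
  by rewrite mcoeff_hall_coords h.
apply: uniq_perm; rewrite ?fset_uniq ?filter_uniq ?parts_of_uniq // => la.
by rewrite mem_filter mem_parts_of; case: (boolP (_ \in _)) => // /mem_supp ->.
Qed.

Lemma schur_coords_hall : schur_coords F = hall_coords.
Proof.
apply: schur_coordsP => b; have [N hN1 [m <-]] := cmon_exists b N1.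
have hN := leq_trans le_rN1 hN1.
rewrite (sum_hall_coords (fun la => schur la (cmon m))).
have [hm|hm] := eqVneq (mdeg m) r; last first.
  rewrite big_seq big1 => [|la].
    by apply/eqP; apply: contraNT hm => /(homF hN1) ->.
  rewrite mem_parts_of => /eqP hla.
  have [->|nz] := eqVneq (schur la (cmon m)) 0; first by rewrite mulr0.
  by move: hm; rewrite (schur_homogeneous nz) hla eqxx.
apply: (@intr_inj rat).
have := congr1 (mcoeff m) (symmetric_expansion hN (fun s => symF s hN1)).
rewrite mcoeff_serpoly hm eqxx raddf_sum /= => ->.
rewrite [RHS]raddf_sum /=; apply: eq_big_seq => la; rewrite mem_parts_of => /eqP hla.
by rewrite mcoeffZ mcoeff_serpoly hm eqxx rmorphM /= (hall_coordE hN1 hla).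
Qed.

Lemma hall_altcoeff N (la : part) : (N1 <= N)%N -> psize la = r ->
  (hall F (schur la))%:~R = altcoeff (mnm_part N la) (serpoly N r F).
Proof.
move=> h hla; rewrite -(hall_coordE h hla) /hall schur_coords_hall.
have -> : schur_coords (schur la) = mkmalgU la 1%R.
  apply: schur_coordsP => b.
  by rewrite msuppU oner_eq0 big_seq_fset1 monalg.mcoeffU eqxx mul1r.
rewrite (sum_hall_coords (fun nu => monalg.mcoeff nu (mkmalgU la 1))).
rewrite (bigD1_seq la) ?parts_of_uniq ?mem_parts_of ?hla //= monalg.mcoeffUU mulr1.
rewrite big1 ?addr0 // => nu; rewrite monalg.mcoeffU eq_sym => /negbTE->.
by rewrite mulr0.
Qed.

End Hall.

(** * The image of an equivariant idempotent *)

Lemma card_sig1 n (p : 'I_n -> nat) (i : 'I_n) :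
  #|[pred k : 'I_(\sum_i p i) | tagnat.sig1 k == i]| = p i.
Proof.
transitivity (\sum_(j < n) \sum_(c < p j) (j == i))%N; last first.
  rewrite (bigD1 i) //= [X in (_ + X)%N]big1 ?addn0 => [|j /negbTE nj].
    by rewrite sum_nat_const card_ord eqxx muln1.
  by rewrite big1 // => c _; rewrite nj.
rewrite sig_big_dep /= (reindex _ tagnat.sig_bij_on) /=.
rewrite -sum1_card big_mkcond /=; apply: eq_bigr => k _.
by rewrite inE /tagnat.sig1; case: eqP.
Qed.

Section ImageModule.

Variables (N D : nat) (V : glmod N D) (Pi : 'M[rat]_D).
Hypothesis idemPi : Pi *m Pi = Pi.
Hypothesis commPi : forall i j, Pi *m glE V i j = glE V i j *m Pi.

Local Notation wlist := (undup [seq glw V k | k : 'I_D]).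
Local Notation wt i := (nth 0%MM wlist i).

Definition wpiece (a : 'X_{1..N}) : 'M[rat]_D := wproj V a *m Pi.

(** Bases of the weight spaces of the image of Pi, stacked. *)
Definition image_basis := \mxcol_(i < size wlist) row_base (wpiece (wt i)).

Lemma Pi_wproj a : Pi *m wproj V a = wproj V a *m Pi.
Proof. by apply: wproj_comm => i; apply: commPi. Qed.

Lemma wpiece_idem a : wpiece a *m wpiece a = wpiece a.
Proof.
rewrite /wpiece -mulmxA (mulmxA Pi) Pi_wproj -(mulmxA _ Pi Pi) idemPi.
by rewrite mulmxA wproj_mul eqxx.
Qed.

Lemma sum_wpiece : Pi = \sum_(i < size wlist) wpiece (wt i).
Proof.
rewrite -mulmx_suml -[LHS]mul1mx; congr (_ *m _); apply/matrixP => k l.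
rewrite summxE.
have hk : glw V k \in wlist by rewrite mem_undup; apply: fintype.image_f.
have lt : (index (glw V k) wlist < size wlist)%N by rewrite index_mem.
rewrite (bigD1 (Ordinal lt)) //= !mxE nth_index // eqxx big1 ?addr0 // => i.
rewrite -val_eqE /= => ni; rewrite !mxE.
case: (k == l); last by rewrite mulr0n.
case: eqP => // e; case/eqP: ni; rewrite e index_uniq ?undup_uniq //.
Qed.

Lemma row_base_wproj a b : row_base (wpiece a) *m wproj V b =
  if a == b then row_base (wpiece a) else 0.
Proof.
have /submxP[X ->] : (row_base (wpiece a) <= wpiece a)%MS by rewrite eq_row_base.
rewrite -mulmxA /wpiece -mulmxA Pi_wproj (mulmxA (wproj V a)) wproj_mul.
by case: eqP => _; rewrite ?mul0mx ?mulmx0.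
Qed.

Lemma image_basis_free : row_free image_basis.
Proof.
rewrite -kermx_eq0; apply/rowV0P => u /sub_kermxP u0.
rewrite -[u]submxrowK in u0 *; rewrite mul_mxrow_mxcol in u0.
suff z i : submxrow u i = 0.
  by apply/matrixP => a b; rewrite mxE [submxrow u _]z !mxE.
have := congr1 (mulmx^~ (wproj V (wt i))) u0.
rewrite /= mul0mx mulmx_suml (bigD1 i) //= big1 ?addr0 => [|j nj]; last first.
  rewrite -mulmxA row_base_wproj nth_uniq ?undup_uniq // -val_eqE /= in nj *.
  by rewrite (negbTE nj) mulmx0.
rewrite -mulmxA row_base_wproj eqxx => h.
by apply: (row_free_inj (row_base_free (wpiece (wt i)))); rewrite h mul0mx.
Qed.

Lemma image_basis_sub : (image_basis <= Pi)%MS.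
Proof.
apply/row_subP => s; rewrite row_mxcol; apply: submx_trans (row_sub _ _) _.
by rewrite eq_row_base submxMl.
Qed.

Lemma sub_image_basis : (Pi <= image_basis)%MS.
Proof.
rewrite {1}sum_wpiece summx_sub // => i _.
rewrite -(eq_row_base (wpiece (wt i))).
have -> : row_base (wpiece (wt i)) = submxcol image_basis i by rewrite /image_basis mxcolK.
exact: rowsub_sub.
Qed.

Lemma image_basis_stable i j : (image_basis *m glE V i j <= image_basis)%MS.
Proof.
have /submxP[X e] := image_basis_sub.
rewrite {1}e -mulmxA commPi mulmxA.
exact: submx_trans (submxMl _ _) sub_image_basis.
Qed.

Definition imageE i j := image_basis *m glE V i j *m pinvmx image_basis.
Definition imagew (k : 'I_(\sum_(i < size wlist) \rank (wpiece (wt i)))) : 'X_{1..N} :=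
  wt (tagnat.sig1 k).

Lemma imageE_mul i j k l : imageE i j *m imageE k l =
  image_basis *m (glE V i j *m glE V k l) *m pinvmx image_basis.
Proof. have h := mulmxKpV (image_basis_stable i j).
by rewrite /imageE; move: (pinvmx _) h => p h; rewrite !mulmxA h. Qed.

Fact image_rel (i j k l : 'I_N) : imageE i j *m imageE k l - imageE k l *m imageE i j =
  (i == l)%:R *: imageE k j - (k == j)%:R *: imageE i l.
Proof.
rewrite !imageE_mul -mulmxBl -mulmxBr glE_rel mulmxBr mulmxBl.
by rewrite -!scalemxAr -!scalemxAl.
Qed.

Fact image_diag i : imageE i i = diag_mx (\row_k (imagew k i)%:R).
Proof.
rewrite /imageE (_ : image_basis *m _ = diag_mx (\row_k (imagew k i)%:R) *m image_basis).
  by rewrite -mulmxA mulmxVp ?mulmx1 ?image_basis_free.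
apply/row_matrixP => k.
have -> : row k (diag_mx (\row_k (imagew k i)%:R) *m image_basis) =
    (imagew k i)%:R *: row k image_basis.
  by rewrite mul_diag_mx; apply/rowP => a; rewrite !mxE.
rewrite row_mul row_mxcol.
set r := row _ _.
have er : r *m wproj V (wt (tagnat.sig1 k)) = r.
  by rewrite /r -row_mul row_base_wproj eqxx.
rewrite -er -mulmxA scalemxAr; congr (_ *m _).
apply/matrixP => a b; rewrite mulmx_glE_diag !mxE.
case: (a =P b) => [->|]; last by rewrite mulr0n mul0r mulr0.
rewrite mulr1n mulrC; case: (eqVneq (glw V b) _) => [->|]; by rewrite ?mulr0.
Qed.

Definition imagemod : glmod N _ := GlMod image_rel image_diag.

Lemma card_imagew a : #|[pred k | glw imagemod k == a]| = \rank (wpiece a).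
Proof.
have [ha|ha] := boolP (a \in wlist); last first.
  rewrite (_ : wpiece a = 0) ?mxrank0.
    apply: eq_card0 => k; rewrite inE /=; apply: contraNF ha => /eqP <-.
    by apply: mem_nth; apply: ltn_ord.
  rewrite /wpiece (_ : wproj V a = 0) ?mul0mx //; apply/matrixP => k l.
  rewrite !mxE; case: (k == l); last by rewrite mulr0n.
  case: eqP => // e; case/negP: ha; rewrite -e mem_undup; exact: fintype.image_f.
have lt : (index a wlist < size wlist)%N by rewrite index_mem.
rewrite -[in RHS](nth_index 0%MM ha).
rewrite -[RHS](card_sig1 (fun i : 'I_(size wlist) => \rank (wpiece (wt i))) (Ordinal lt)).
apply: eq_card => k; rewrite !inE /= /imagew.
by rewrite -{1}(nth_index 0%MM ha) nth_uniq ?undup_uniq // ltn_ord.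
Qed.

End ImageModule.

(** * A representation with character s_mu *)

Section Bimodule.

Variable N : nat.

Local Notation cell := ('I_N * 'I_N)%type.
Local Notation ncell := #|{: 'I_N * 'I_N}|.
Implicit Types A B : 'M[rat]_N.

(** The index s stands for a cell of the matrix of variables; A acts on the
    column index of the cell. *)
Definition act_right A : 'M[rat]_ncell := \matrix_(s, t)
  (((enum_val s : cell).1 == (enum_val t : cell).1)%:R *
    A (enum_val s : cell).2 (enum_val t : cell).2).

(** A acts on the row index of the cell. *)
Definition act_left A : 'M[rat]_ncell := \matrix_(s, t)
  (((enum_val s : cell).2 == (enum_val t : cell).2)%:R *
    A (enum_val s : cell).1 (enum_val t : cell).1).

Lemma big_cell (R : Type) (idx : R) (op : Monoid.com_law idx) (F : cell -> R) :
  \big[op/idx]_(u < ncell) F (enum_val u) = \big[op/idx]_i \big[op/idx]_j F (i, j).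
Proof.
rewrite pair_big /= -(@big_enum_val _ _ _ _ {: cell} F).
by apply: eq_bigr => -[i j].
Qed.

Lemma act_rightM A B : act_right A *m act_right B = act_right (A *m B).
Proof.
apply/matrixP => s t; rewrite !mxE.
pose G (p : cell) := ((enum_val s : cell).1 == p.1)%:R * A (enum_val s : cell).2 p.2 *
   ((p.1 == (enum_val t : cell).1)%:R * B p.2 (enum_val t : cell).2).
rewrite (eq_bigr (fun u => G (enum_val u))).
  rewrite big_cell /G (bigD1 (enum_val s : cell).1) //= [X in _ + X]big1 ?addr0.
    by rewrite mulr_sumr; apply: eq_bigr => j _; rewrite eqxx mul1r mulrCA.
  by move=> i; rewrite eq_sym => /negbTE ni; rewrite big1 // => j _; rewrite ni !mul0r.
by move=> u _; rewrite !mxE.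
Qed.

Lemma act_leftM A B : act_left A *m act_left B = act_left (A *m B).
Proof.
apply/matrixP => s t; rewrite !mxE.
pose G (p : cell) := ((enum_val s : cell).2 == p.2)%:R * A (enum_val s : cell).1 p.1 *
   ((p.2 == (enum_val t : cell).2)%:R * B p.1 (enum_val t : cell).1).
rewrite (eq_bigr (fun u => G (enum_val u))).
  rewrite big_cell /G exchange_big (bigD1 (enum_val s : cell).2) //= [X in _ + X]big1 ?addr0.
    by rewrite mulr_sumr; apply: eq_bigr => j _; rewrite eqxx mul1r mulrCA.
  by move=> i; rewrite eq_sym => /negbTE ni; rewrite big1 // => j _; rewrite ni !mul0r.
by move=> u _; rewrite !mxE.
Qed.

Lemma act_left_right A B : act_left A *m act_right B = act_right B *m act_left A.
Proof.
apply/matrixP => s t; rewrite !mxE.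
pose G (p : cell) := ((enum_val s : cell).2 == p.2)%:R * A (enum_val s : cell).1 p.1 *
   ((p.1 == (enum_val t : cell).1)%:R * B p.2 (enum_val t : cell).2).
rewrite (eq_bigr (fun u => G (enum_val u))); last first.
  by move=> u _; rewrite !mxE.
pose H (p : cell) := ((enum_val s : cell).1 == p.1)%:R * B (enum_val s : cell).2 p.2 *
   ((p.2 == (enum_val t : cell).2)%:R * A p.1 (enum_val t : cell).1).
rewrite [RHS](eq_bigr (fun u => H (enum_val u))); last first.
  by move=> u _; rewrite !mxE.
rewrite !big_cell /G /H; move: (enum_val s : cell) (enum_val t : cell) => [a b] [c d] /=.
rewrite (bigD1 c) //= [X in _ + X]big1 ?addr0 => [|i /negbTE ni]; last first.
  by rewrite big1 // => j _; rewrite ni mul0r mulr0.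
rewrite (bigD1 b) //= [X in _ + X]big1 ?addr0 => [|j]; last first.
  by rewrite eq_sym => /negbTE nj; rewrite nj !mul0r.
rewrite [RHS](bigD1 a) //= [X in _ = _ + X]big1 ?addr0 => [|i]; last first.
  by rewrite eq_sym => /negbTE ni; rewrite big1 // => j _; rewrite ni !mul0r.
rewrite [RHS](bigD1 d) //= [X in _ = _ + X]big1 ?addr0 => [|j /negbTE nj]; last first.
  by rewrite nj mul0r mulr0.
by rewrite !eqxx !mul1r mulrC.
Qed.

Lemma act_right_lin A B (a b : rat) :
  act_right (a *: A - b *: B) = a *: act_right A - b *: act_right B.
Proof. by apply/matrixP => s t; rewrite !mxE; ring. Qed.

Lemma act_left_lin A B (a b : rat) :
  act_left (a *: A - b *: B) = a *: act_left A - b *: act_left B.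
Proof. by apply/matrixP => s t; rewrite !mxE; ring. Qed.

Lemma delta_mx_rel (i j k l : 'I_N) :
  delta_mx j i *m delta_mx l k - delta_mx l k *m delta_mx j i =
  (i == l)%:R *: delta_mx j k - (k == j)%:R *: delta_mx l i :> 'M[rat]_N.
Proof. by rewrite !mul_delta_mx_cond -!scaler_nat. Qed.

Fact right_rel (i j k l : 'I_N) :
  act_right (delta_mx j i) *m act_right (delta_mx l k) -
  act_right (delta_mx l k) *m act_right (delta_mx j i) =
  (i == l)%:R *: act_right (delta_mx j k) - (k == j)%:R *: act_right (delta_mx l i).
Proof.
rewrite -act_right_lin -delta_mx_rel !act_rightM.
by have := act_right_lin (delta_mx j i *m delta_mx l k) (delta_mx l k *m delta_mx j i) 1 1;
   rewrite !scale1r.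
Qed.

Fact left_rel (i j k l : 'I_N) :
  act_left (delta_mx j i) *m act_left (delta_mx l k) -
  act_left (delta_mx l k) *m act_left (delta_mx j i) =
  (i == l)%:R *: act_left (delta_mx j k) - (k == j)%:R *: act_left (delta_mx l i).
Proof.
rewrite -act_left_lin -delta_mx_rel !act_leftM.
by have := act_left_lin (delta_mx j i *m delta_mx l k) (delta_mx l k *m delta_mx j i) 1 1;
   rewrite !scale1r.
Qed.

Fact right_diag (i : 'I_N) : act_right (delta_mx i i) =
  diag_mx (\row_s (U_((enum_val s : cell).2)%MM i)%:R).
Proof.
apply/matrixP => s t; rewrite !mxE mnm1E.
have [->|nst] := eqVneq s t; first by rewrite eqxx mul1r mulr1n andbb eq_sym.
rewrite mulr0n; have : (enum_val s : cell) != enum_val t by rewrite (inj_eq enum_val_inj).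
move: (enum_val s : cell) (enum_val t : cell) => [a b] [c d]; rewrite xpair_eqE /=.
by case: (a == c) => //= nbd; rewrite ?mul0r // mul1r;
   case: eqP => // e; case: eqP => // e'; move: nbd; rewrite e e' eqxx.
Qed.

Fact left_diag (i : 'I_N) : act_left (delta_mx i i) =
  diag_mx (\row_s (U_((enum_val s : cell).1)%MM i)%:R).
Proof.
apply/matrixP => s t; rewrite !mxE mnm1E.
have [->|nst] := eqVneq s t; first by rewrite eqxx mul1r mulr1n andbb eq_sym.
rewrite mulr0n; have : (enum_val s : cell) != enum_val t by rewrite (inj_eq enum_val_inj).
move: (enum_val s : cell) (enum_val t : cell) => [a b] [c d]; rewrite xpair_eqE /= andbC.
by case: (b == d) => //= nac; rewrite ?mul0r // mul1r;
   case: eqP => // e; case: eqP => // e'; move: nac; rewrite e e' eqxx.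
Qed.

Definition rightmod : glmod N ncell := GlMod right_rel right_diag.
Definition leftmod : glmod N ncell := GlMod left_rel left_diag.

Variable m : nat.
Local Notation D := (symdim ncell m).
Local Notation WR := (symmod m rightmod).
Local Notation WL := (symmod m leftmod).

Lemma left_right_comm i j k l :
  glE WL i j *m glE WR k l = glE WR k l *m glE WL i j.
Proof. by apply/sympow_commute/act_left_right. Qed.

(** A matrix of exponents, given by its rows, as a monomial in the N x N variables. *)
Definition matmnm (f : {ffun 'I_N -> 'X_{1..N < m.+1}}) : 'X_{1..ncell} :=
  [multinom bmnm (f (enum_val s : cell).1) (enum_val s : cell).2 | s < ncell].

Lemma left_weight (z : 'X_{1..ncell}) (i : 'I_N) :
  symweight leftmod z i = (\sum_j z (enum_rank (i, j)))%N.
Proof.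
rewrite mnmE.
pose G (p : cell) := (z (enum_rank p) * (p.1 == i))%N.
rewrite (eq_bigr (fun s => G (enum_val s))).
  rewrite big_cell /G (bigD1 i) //= [X in (_ + X)%N]big1 ?addn0 => [|c /negbTE nc].
    by apply: eq_bigr => j _; rewrite eqxx muln1.
  by rewrite big1 // => j _; rewrite nc muln0.
by move=> s _; rewrite /G enum_valK mnm1E.
Qed.

Lemma right_weight (z : 'X_{1..ncell}) (j : 'I_N) :
  symweight rightmod z j = (\sum_i z (enum_rank (i, j)))%N.
Proof.
rewrite mnmE.
pose G (p : cell) := (z (enum_rank p) * (p.2 == j))%N.
rewrite (eq_bigr (fun s => G (enum_val s))).
  rewrite big_cell /G exchange_big (bigD1 j) //= [X in (_ + X)%N]big1 ?addn0 => [|c /negbTE nc].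
    by apply: eq_bigr => i _; rewrite eqxx muln1.
  by rewrite big1 // => i _; rewrite nc muln0.
by move=> s _; rewrite /G enum_valK mnm1E.
Qed.

Lemma mdeg_left_weight z : mdeg (symweight leftmod z) = mdeg z.
Proof.
rewrite !mdegE (eq_bigr _ (fun i _ => left_weight z i)).
rewrite -(big_cell _ (fun p => z (enum_rank p))).
by apply: eq_bigr => s _; rewrite enum_valK.
Qed.

(** The left weight of a monomial in the matrix of variables is the vector of row
    sums of its exponents, the right weight that of column sums. *)
Lemma count_margins (a b : 'X_{1..N}) : mdeg a = m ->
  #|[pred k : 'I_D | (glw WL k == a) && (glw WR k == b)]| =
  #|[pred f : {ffun 'I_N -> 'X_{1..N < m.+1}} | margins a b f]|.
Proof.
move=> ha.
have matE f i j : matmnm f (enum_rank (i, j)) = bmnm (f i) j by rewrite mnmE enum_rankK.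
have hf f : margins a b f -> exists k : 'I_D, mon k = matmnm f.
  move/forallP => mf; apply: monP; rewrite -mdeg_left_weight -ha !mdegE.
  apply: eq_bigr => i _; rewrite left_weight.
  rewrite (eq_bigr (fun j => bmnm (f i) j)) => [|j _]; last by rewrite matE.
  by rewrite -mdegE; case/andP: (mf i) => /eqP.
have weights f k : mon k = matmnm f ->
    ((glw WL k == a) && (glw WR k == b)) = margins a b f.
  move=> hk; rewrite !glw_symmod hk; apply/andP/forallP => [[/eqP ea /eqP eb] i|mf].
    rewrite -ea -eb left_weight right_weight mdegE; apply/andP; split; apply/eqP.
      by apply: eq_bigr => j _; rewrite matE.
    by apply: eq_bigr => j _; rewrite matE.
  split; apply/eqP/mnmP => i; rewrite ?left_weight ?right_weight.
    rewrite (eq_bigr (fun j => bmnm (f i) j)) => [|j _]; last by rewrite matE.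
    by rewrite -mdegE; case/andP: (mf i) => /eqP.
  rewrite (eq_bigr (fun j => bmnm (f j) i)) => [|j _]; last by rewrite matE.
  by case/andP: (mf i) => _ /eqP.
have mat_inj : injective matmnm.
  move=> f g e; apply/ffunP => i; apply/eqP; rewrite bmeqP; apply/eqP/mnmP => j.
  by rewrite -!matE e.
have mat_surj (k : 'I_D) : exists f, mon k == matmnm f.
  exists [ffun i => insubd bm0 [multinom mon k (enum_rank (i, j)) | j < N]].
  apply/eqP/mnmP => s; rewrite mnmE ffunE val_insubd.
  rewrite ifT; last first.
    rewrite ltnS -[X in (_ <= X)%N](mdeg_mon k) -mdeg_left_weight [X in (_ <= X)%N]mdegE.
    rewrite (bigD1 (enum_val s : cell).1) //= left_weight mdegE.
    by rewrite (eq_bigr _ (fun j _ => mnmE _ j)) leq_addr.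
  by rewrite mnmE -surjective_pairing enum_valK.
pose phi (k : 'I_D) := xchoose (mat_surj k).
have phiP k : mon k = matmnm (phi k) by apply/eqP/(xchooseP (mat_surj k)).
have phi_inj : injective phi by move=> k l e; apply: mon_inj; rewrite !phiP e.
rewrite -(fintype.card_image phi_inj); apply: eq_card => f; rewrite [RHS]inE.
apply/fintype.imageP/idP => [[k hk ->]|mf].
  by rewrite -(weights _ _ (phiP k)).
have [k hk] := hf f mf; exists k; first by rewrite inE (weights _ _ hk).
by apply: mat_inj; rewrite -phiP hk.
Qed.

(** The right character of the weight space of a for the left action: choosing
    a monomial with row sums a amounts to choosing a monomial of degree a_i in
    each row. *)
Lemma wgen_wproj_left (a : 'X_{1..N}) : mdeg a = m ->
  wgen WR (wproj WL a) = homogeneous_prod N N (nth 0%N a).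
Proof.
move=> ha; apply/mpolyP => b.
have lt : (mdeg a < m.+1)%N by rewrite ha.
rewrite (mcoeff_homogeneous_prod b lt) -count_margins // mcoeff_wgen.
have cardE (P : pred 'I_D) : #|[pred k | P k]|%:R = \sum_(k | P k) 1 :> rat.
  by rewrite -sum1_card natr_sum.
rewrite cardE big_mkcond [RHS]big_mkcond /=.
apply: eq_bigr => k _; rewrite !mxE eqxx mulr1n.
by case: (_ == b); case: (_ == a).
Qed.


Variable mu : part.
Hypothesis size_mu : (size mu <= N)%N.
Local Notation lmu := (mnm_part N mu).
Local Notation Pi := (hwproj WR lmu).

Let dmu : dominant lmu := @dominant_mnm_part N mu.

Lemma central_left i j : centralises WR (glE WL i j).
Proof. by move=> k l; rewrite left_right_comm. Qed.

Lemma central_wproj (a : 'X_{1..N}) : centralises WR (wproj WL a).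
Proof. by move=> k l; rewrite wproj_comm // => i; rewrite left_right_comm. Qed.

Lemma central_hwproj i j : Pi *m glE WL i j = glE WL i j *m Pi.
Proof. by rewrite hwproj_comm //; apply: central_left. Qed.

(** The trace formula for the right action is applied with the projection onto
    a left weight space, which commutes with the right action, in the role of Q. *)
Lemma rank_wpiece_left (a : 'X_{1..N}) : mdeg a = m ->
  \rank (wpiece WL Pi a) = kostka N (nth 0%N a) lmu.
Proof.
move=> ha; apply/eqP; rewrite -(eqr_nat rat) -altcoeff_homogeneous_prod //.
rewrite -mxtrace_idempotent; last first.
  by apply: wpiece_idem; [apply: hwproj_idem | apply: central_hwproj].
by rewrite trace_hwproj ?wgen_wproj_left //; apply: central_wproj.
Qed.

(** The highest weight vectors of weight mu for the right action, as a
    representation for the left action.  The degree m is meant to be the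
    number of boxes of mu. *)
Definition schurmod := imagemod central_hwproj.

Lemma card_schurmod (a : 'X_{1..N}) : psize mu = m ->
  #|[pred k | glw schurmod k == a]| = count (fun t => content N t == a) (tabs N mu).
Proof.
move=> hmu; rewrite card_imagew.
rewrite count_content //; have [ha|ha] := eqVneq (mdeg a) m; first exact: rank_wpiece_left.
rewrite (_ : wpiece _ _ _ = 0) ?mxrank0; last first.
  rewrite /wpiece (_ : wproj WL a = 0) ?mul0mx //; apply/matrixP => k l.
  rewrite !mxE; case: (k == l); last by rewrite mulr0n.
  case: eqP => // e; case/eqP: ha.
  by rewrite -e glw_symmod mdeg_left_weight mdeg_mon.
apply/esym/eqP; apply: contraNT ha => nz.
rewrite -hmu -(@schur_homogeneous _ a mu) // schur_cmon //.
by rewrite pnatr_eq0.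
Qed.

End Bimodule.

(** * The plethysm as a symmetric power *)

Lemma mdeg_expcmn (I : choiceType) (i : I) k : monalg.mdeg (expcmn (ucm i) k) = k.
Proof.
have -> : expcmn (ucm i) k = iterop k mmul (ucm i) mone by [].
rewrite Monoid.iteropE; elim: k => [|k IHk] /=; first exact: monalg.mdeg1.
by rewrite monalg.mdegM IHk monalg.mdegU.
Qed.

Section OneRow.

Lemma sum_finsupp (I : choiceType) (a : monalg.cmonom I) (r : seq I) (G : I -> nat) :
  uniq r -> {subset finsupp a <= r} ->
  (\sum_(t <- finsupp a) G t * a t = \sum_(t <- r) G t * a t)%N.
Proof.
move=> ur sub; rewrite [RHS](bigID (mem (finsupp a))) /= [X in (_ + X)%N]big1 ?addn0; last first.
  by move=> t; rewrite -cmE_eq0 => /eqP ->; rewrite muln0.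
rewrite -[RHS]big_filter; apply: perm_big; apply: uniq_perm; rewrite ?fset_uniq ?filter_uniq // => t.
by rewrite mem_filter; case: (boolP (t \in finsupp a)) => // /sub ->.
Qed.

(** A tableau with one row is the sorted list of its entries. *)
Lemma schur_rowpart n (c : monalg.cmonom nat) :
  schur (rowpart n) c = (monalg.mdeg c == n)%:R.
Proof.
pose r0 := sort leq (flatten [seq nseq (c i) i | i <- finsupp c]).
have cnt i : count_mem i r0 = c i.
  rewrite (seq.permP (permEl (perm_sort _ _))) count_flatten -map_comp sumnE big_map.
  rewrite (eq_bigr (fun j => (j == i) * c j)%N) => [|j _]; last by rewrite /= count_nseq.
  case: (boolP (i \in finsupp c)) => hi.
    rewrite (big_fsetD1 i) //= eqxx mul1n big_seq big1 ?addn0 // => j.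
    by rewrite in_fsetD1 => /andP[/negbTE->].
  rewrite big_seq big1 => [|j hj]; first by move: hi; rewrite -cmE_eq0 => /eqP.
  by case: eqP hi => [<-|//]; rewrite hj.
have sz : size r0 = monalg.mdeg c.
  rewrite size_sort size_flatten /shape -map_comp sumnE big_map monalg.mdegE.
  by apply: eq_bigr => i _; rewrite /= size_nseq.
have sr : sorted leq r0 := sort_sorted leq_total _.
have rowsE (t : ssyt (rowpart n)) : rows t = nseq (0 < n)%N (flatten t) /\
    sorted leq (flatten t) /\ size (flatten t) = n.
  case: t => t /= /and3P[/eqP e]; move: e; rewrite /=.
  case: (n) => [|k] /=; first by case: t.
  by case: t => // r [|r' t] //= [e] /andP[s1 _] _; rewrite cats0.
have memr (t : ssyt (rowpart n)) : tabmonom t = c -> flatten t = r0.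
  move=> e; have [_ [s1 _]] := rowsE t; apply: (sorted_eq leq_trans anti_leq) => //.
  apply/allP => i _ /=; apply/eqP; rewrite cnt -e tabmonomE //.
have [hn|hn] := eqVneq (monalg.mdeg c) n; last first.
  rewrite /schur (_ : [set t | _]%classic = set0) ?fsbig_set0 //.
  rewrite -subset0 => t /= e; case/eqP: hn; rewrite -sz -(memr t e).
  by case: (rowsE t) => _ [].
have ss : is_ssyt (rowpart n) (nseq (0 < n)%N r0).
  rewrite /is_ssyt; case: n hn {rowsE memr} => [|n] hn //=.
  by rewrite sz hn eqxx sr.
rewrite /schur; apply: (@fsbig_card _ [:: SSYT ss]) => // t.
rewrite inE; split=> [/eqP->|e].
  apply/eqP/cmP => i; rewrite tabmonomE -cnt /=.
  case: (n) hn ss => [|k] hn _ /=; last by rewrite cats0.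
  by move: sz; rewrite hn => /size0nil->.
by apply/eqP/val_inj; rewrite /= -(memr t e); case: (rowsE t).
Qed.

End OneRow.

Section PowerSum.

Variables (N n : nat).

Definition wsum d (x : 'I_d -> 'X_{1..N}) (z : 'X_{1..d}) : 'X_{1..N} :=
  [multinom (\sum_s z s * x s i)%N | i < N].

(** The complete homogeneous polynomial of degree n in the monomials of
    exponents x. *)
Definition hsum d (x : 'I_d -> 'X_{1..N}) : {mpoly rat[N]} :=
  \sum_(k < symdim d n) 'X_[wsum x (mon k)].

Lemma hsumE d (x : 'I_d -> 'X_{1..N}) :
  hsum x = \sum_(b : 'X_{1..d < n.+1} | mdeg b == n) 'X_[wsum x b].
Proof.
transitivity (\sum_(b in monset d n) 'X_[wsum x b] : {mpoly rat[N]}).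
  by rewrite big_enum_val.
by apply: eq_bigl => b; rewrite inE.
Qed.

Lemma hsum_perm d d' (x : 'I_d -> 'X_{1..N}) (x' : 'I_d' -> 'X_{1..N}) :
  perm_eq [seq x i | i : 'I_d] [seq x' i | i : 'I_d'] -> hsum x = hsum x'.
Proof.
move=> px; have e : d = d' by have := perm_size px; rewrite !size_map -!enumT !size_enum_ord.
subst d'; have /tuple_permP[s hs] : perm_eq [tuple x i | i < d] [tuple x' i | i < d] by [].
have xs i : x i = x' (s i).
  have := congr1 (fun t => nth 0%MM t i) hs.
  by rewrite !nth_mktuple tnth_mktuple.
have lt (b : 'X_{1..d < n.+1}) : (mdeg ((bmnm b)#s) < n.+1)%N by rewrite mdeg_mperm bmdeg.
rewrite !hsumE [LHS](reindex_inj (h := fun b => BMultinom (lt b))) /=; last first.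
  by move=> b c /(congr1 (@bmnm _ _)) /= /mperm_inj e; apply/eqP; rewrite bmeqP e.
apply: eq_big => [b|b _]; first by rewrite mdeg_mperm.
congr 'X_[_]; apply/mnmP => i; rewrite !mnmE [RHS](reindex_perm s).
by apply: eq_bigr => c _; rewrite mnmE xs.
Qed.

End PowerSum.

Section Plethysm.

Variables (N n : nat) (mu : part).
Hypothesis size_mu : (size mu <= N)%N.
Local Notation m := (psize mu).
Local Notation T := (tabs N mu).
Local Notation tab i := (tnth (in_tuple T) i).
Local Notation F := (plethysm (schur (rowpart n)) mu).

Definition tabcontent (i : 'I_(size T)) : 'X_{1..N} := content N (tab i).

(** Exponents in the variables indexed by all tableaux, from those in the
    finitely many variables indexed by tableaux with entries below N. *)
Definition tabmon (z : 'X_{1..size T}) : monalg.cmonom (ssyt mu) :=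
  \big[mmul/mone]_(i < size T) expcmn (ucm (tab i)) (z i).

Lemma tab_inj : injective (fun i : 'I_(size T) => tab i).
Proof. by apply/tuple_uniqP; apply: tabs_uniq. Qed.

Lemma tab_mem i : tab i \in T.
Proof. exact: mem_tnth. Qed.

Lemma tab_surj t : t \in T -> exists i : 'I_(size T), tab i = t.
Proof. by move=> ht; have /tnthP[i ->] : t \in in_tuple T by []; exists i. Qed.

Lemma tabmonE z i : tabmon z (tab i) = z i.
Proof.
rewrite /tabmon cm_prodE (bigD1 i) //= expcmE cmU eqxx mul1n big1 ?addn0 // => j nj.
by rewrite expcmE cmU (inj_eq tab_inj) (negbTE nj) mul0n.
Qed.

Lemma tabmon_out z t : t \notin T -> tabmon z t = 0%N.
Proof.
move=> ht; rewrite /tabmon cm_prodE big1 // => i _; rewrite expcmE cmU.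
by case: eqP => [e|]; rewrite ?mul0n //; case/negP: ht; rewrite -e tab_mem.
Qed.

Lemma tabmon_sub z : {subset finsupp (tabmon z) <= T}.
Proof.
by move=> t; rewrite -cmE_neq0; apply: contraNT => /(tabmon_out z) ->.
Qed.

Lemma sum_tabs (G : ssyt mu -> nat) : (\sum_(t <- T) G t = \sum_(i < size T) G (tab i))%N.
Proof. by rewrite [LHS](big_tuple _ _ (in_tuple T)). Qed.

Lemma substmonomE (a : monalg.cmonom (ssyt mu)) i :
  substmonom a i = (\sum_(t <- finsupp a) tabmonom t i * a t)%N.
Proof. by rewrite /substmonom cm_prodE; apply: eq_bigr => t _; rewrite expcmE. Qed.

Lemma mdeg_relabel (a : monalg.cmonom (ssyt mu)) :
  monalg.mdeg (relabel a) = monalg.mdeg a.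
Proof.
by rewrite /relabel monalg.mdeg_prod monalg.mdegE; apply: eq_bigr => t _; rewrite mdeg_expcmn.
Qed.

Lemma tabmonom_big (t : ssyt mu) i : t \in T -> (N <= i)%N -> tabmonom t i = 0%N.
Proof.
rewrite mem_tabs // => /allP h hi; rewrite tabmonomE; apply/count_memPn/negP => /h.
by rewrite ltnNge hi.
Qed.

Lemma substmonom_tabmon z : substmonom (tabmon z) = cmon (wsum tabcontent z).
Proof.
apply/eqP/cmP => i; rewrite substmonomE (sum_finsupp _ _ (@tabmon_sub z)) ?tabs_uniq //.
rewrite sum_tabs cmonE; case: (ltnP i N) => hi.
  rewrite -(mnm_nth 0%N _ (Ordinal hi)) mnmE; apply: eq_bigr => s _.
  by rewrite tabmonE mulnC mnmE.
by rewrite nth_mnm_big // big1 // => s _; rewrite tabmonom_big ?tab_mem.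
Qed.

Lemma mdeg_tabmon z : monalg.mdeg (tabmon z) = mdeg z.
Proof.
rewrite mdegE /tabmon monalg.mdeg_prod; apply: eq_bigr => i _.
exact: mdeg_expcmn.
Qed.

Lemma tabmon_surj (a : monalg.cmonom (ssyt mu)) (b : 'X_{1..N}) :
  substmonom a = cmon b -> exists z, tabmon z = a.
Proof.
move=> e; exists [multinom a (tab i) | i < size T]; apply/eqP/cmP => t.
case: (boolP (t \in T)) => ht; first by have [i <-] := tab_surj ht; rewrite tabmonE mnmE.
rewrite tabmon_out //; apply/esym/eqP; apply: contraNT ht => nz.
rewrite mem_tabs //; apply/allP => x xt; rewrite ltnNge; apply/negP => hx.
have hfin : t \in finsupp a by rewrite -cmE_neq0.
have := substmonomE a x; rewrite e cmonE nth_mnm_big // (big_fsetD1 t) //= => /esym/eqP.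
rewrite addn_eq0 muln_eq0 (negbTE nz) orbF tabmonomE => /andP[+ _].
by rewrite -leqn0 leqNgt -has_count has_pred1 xt.
Qed.

Lemma tabmon_inj : injective tabmon.
Proof. by move=> z y e; apply/mnmP => i; rewrite -!tabmonE e. Qed.

(** By [schur_rowpart] each exponent of degree n in the tableaux contributes 1;
    if the resulting content is supported on the first N variables, then so
    are all the tableaux involved. *)
Lemma plethysm_cmon (b : 'X_{1..N}) :
  F (cmon b) = #|[pred k : 'I_(symdim (size T) n) | wsum tabcontent (mon k) == b]|%:R.
Proof.
rewrite /plethysm (eq_fsbigr (fun a => if a \in [set a | monalg.mdeg a = n]%classic then 1 else 0)).
  rewrite -fsbig_mkcondr.
  pose L := [seq tabmon (mon k) |
    k <- enum [pred k : 'I_(symdim (size T) n) | wsum tabcontent (mon k) == b]].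
  rewrite (@fsbig_card _ L).
  - by rewrite size_map cardE.
  - by rewrite map_inj_uniq ?enum_uniq // => k l /tabmon_inj/mon_inj.
  move=> a; split=> [/mapP[k]|[/= e ha]].
    rewrite mem_enum inE => /eqP e ->; split=> /=.
      by rewrite substmonom_tabmon e.
    by rewrite mdeg_tabmon mdeg_mon.
  have [z hz] := tabmon_surj e; rewrite -hz mdeg_tabmon in ha.
  have [k hk] := monP ha; apply/mapP; exists k; last by rewrite hk hz.
  rewrite mem_enum inE hk; apply/eqP/mnmP => i.
  by rewrite !(mnm_nth 0%N) -!cmonE -substmonom_tabmon hz e.
move=> a _; rewrite schur_rowpart mdeg_relabel.
case: eqP => h; first by rewrite ifT // inE.
by rewrite ifF //; apply/negP; rewrite inE.
Qed.

Lemma mdeg_tabcontent i : mdeg (tabcontent i) = m.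
Proof.
apply: schur_homogeneous; rewrite schur_cmon // -count_tabs // pnatr_eq0 -lt0n -has_count.
apply/hasP; exists (tab i); first exact: tab_mem.
by apply/forallP => j; rewrite -(mnm_nth 0%N) mnmE.
Qed.

Lemma mdeg_wsum z : mdeg (wsum tabcontent z) = (m * mdeg z)%N.
Proof.
rewrite !mdegE big_distrr /=.
rewrite (eq_bigr (fun i => \sum_s z s * tabcontent s i))%N => [|i _]; last by rewrite mnmE.
rewrite exchange_big; apply: eq_bigr => s _ /=.
by rewrite -big_distrr /= -mdegE mdeg_tabcontent mulnC.
Qed.

Lemma serpoly_plethysm : serpoly N (m * n) F = hsum n tabcontent.
Proof.
apply/mpolyP => b; rewrite mcoeff_serpoly /hsum [RHS]raddf_sum /=.
rewrite [RHS](eq_bigr (fun k : 'I_(symdim (size T) n) =>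
  (wsum tabcontent (mon k) == b)%:R)) => [|k _]; last by rewrite mcoeffX.
case: eqP => hb; last first.
  rewrite big1 // => k _; case: eqP => // e; case: hb.
  by rewrite -e mdeg_wsum mdeg_mon.
rewrite plethysm_cmon mulrz_nat -sum1_card natr_sum big_mkcond /=.
by apply: eq_bigr => k _; rewrite inE; case: eqP.
Qed.

Lemma plethysm_homogeneous (b : 'X_{1..N}) : F (cmon b) != 0 -> mdeg b = (m * n)%N.
Proof.
rewrite plethysm_cmon pnatr_eq0 -lt0n => /card_gt0P[k]; rewrite inE => /eqP <-.
by rewrite mdeg_wsum mdeg_mon.
Qed.

Lemma count_content_perm (a : 'X_{1..N}) (s : 'S_N) :
  count (fun t => content N t == a#s) T = count (fun t => content N t == a) T.
Proof.
have /(congr1 (mcoeff a)) := schur_symmetric (mdeg a) s size_mu.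
rewrite mcoeff_sym !mcoeff_serpoly mdeg_mperm eqxx !schur_cmon // !mulrz_nat => /eqP.
by rewrite eqr_nat !count_content // => /eqP.
Qed.

Lemma count_tab (g : ssyt mu -> 'X_{1..N}) (a : 'X_{1..N}) :
  count_mem a [seq g (tab i) | i : 'I_(size T)] = count (fun t => g t == a) T.
Proof.
transitivity (count (fun t => g t == a) [seq tab i | i : 'I_(size T)]).
  by rewrite !count_map.
by congr count; apply: (map_tnth_enum (in_tuple T)).
Qed.

(** A permutation of the variables permutes the contents of the tableaux, with
    multiplicities, because s_mu is symmetric. *)
Lemma plethysm_symmetric (s : 'S_N) :
  msym s (serpoly N (m * n) F) = serpoly N (m * n) F.
Proof.
rewrite serpoly_plethysm.
have -> : msym s (hsum n tabcontent) = hsum n (fun i => (tabcontent i)#(s^-1)%g).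
  rewrite /hsum raddf_sum; apply: eq_bigr => k _ /=; rewrite msymX; congr 'X_[_].
  by apply/mnmP => i; rewrite !mnmE; apply: eq_bigr => c _; rewrite !mnmE.
apply: hsum_perm; apply/allP => a _ /=; apply/eqP.
rewrite (count_tab (fun t => (content N t)#(s^-1)%g)) (count_tab (@content N mu)).
rewrite -(count_content_perm a s); apply: eq_count => t /=.
apply/eqP/eqP => [<-|->]; first by rewrite mpermK.
by rewrite mpermKV.
Qed.

End Plethysm.

(** The plethysm is the character of Sym^n W, as both are complete homogeneous
    polynomials in the same multiset of monomials. *)
Lemma hall_plethysm N n (mu la : part) :
    (size mu <= N)%N -> (psize mu * n <= N)%N -> psize la = (psize mu * n)%N ->
  hall (plethysm (schur (rowpart n)) mu) (schur la) =
  (\rank (hwproj (symmod n (schurmod N (psize mu) mu)) (mnm_part N la)))%:R.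
Proof.
move=> sz hN hla; apply: (@intr_inj rat).
rewrite (@hall_altcoeff (psize mu * n) N _ hN _ _ N) //; last first.
- by move=> N' s h; apply: plethysm_symmetric; apply: leq_trans sz h.
- by move=> N' b h; apply: plethysm_homogeneous; apply: leq_trans sz h.
rewrite serpoly_plethysm // mulrz_nat rank_hwproj; last exact: dominant_mnm_part.
congr altcoeff.
transitivity (hsum n (glw (schurmod N (psize mu) mu))); last first.
  by apply: eq_bigr => k _; rewrite mxE eqxx scale1r.
apply: hsum_perm; apply/allP => a _ /=; apply/eqP.
rewrite (count_tab (@content N mu)) -(@card_schurmod N (psize mu) mu sz a erefl).
by rewrite count_map -size_filter cardE enumT.
Qed.

Theorem theorem1p3 (m n : nat) (mu la : part)
    (hmu : psize mu = m) (hla : psize la = (m * n)%N)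
    (n' : nat) (la' : part)
    (hn' : (0 < n')%N) (hla' : psize la' = (m * n')%N)
    (hpos : 1 <= hall (plethysm (schur (rowpart n')) mu) (schur la')) :
  hall (plethysm (schur (rowpart n)) mu) (schur la)
    <= hall (plethysm (schur (rowpart (n + n'))) mu) (schur (padd la la')).
Proof.
(* N bounds the sizes of the three partitions labelling Schur functions; it
   bounds that of mu because n' > 0. *)
subst m; pose N := (psize mu * (n + n'))%N.
have hN : (psize mu * n <= N)%N by rewrite leq_mul2l leq_addr orbT.
have hN' : (psize mu * n' <= N)%N by rewrite leq_mul2l leq_addl orbT.
have sz : (size mu <= N)%N.
  by apply: leq_trans (size_le_psize mu) _; rewrite -{1}[psize mu]muln1 leq_mul2l; lia.
have sla : (size la <= N)%N by rewrite (leq_trans (size_le_psize _)) // hla.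
have sla' : (size la' <= N)%N by rewrite (leq_trans (size_le_psize _)) // hla'.
have epadd : mnm_part N (padd la la') = (mnm_part N la + mnm_part N la')%MM.
  apply/mnmP => i; rewrite mnmDE !mnmE /= /add_parts.
  case: (ltnP i (maxn (size la) (size la'))) => h; first by rewrite nth_mkseq.
  rewrite !nth_default ?size_mkseq //.
  - by apply: leq_trans h; apply: leq_maxr.
  - by apply: leq_trans h; apply: leq_maxl.
have spadd : (size (padd la la') <= N)%N by rewrite size_mkseq geq_max sla.
have hpadd : psize (padd la la') = (psize mu * (n + n'))%N.
  by rewrite -(psize_mnm_part spadd) epadd mdegD !psize_mnm_part // hla hla' mulnDr.
rewrite (hall_plethysm sz hN hla) (hall_plethysm sz (leqnn N) hpadd) epadd ler_nat.
apply: rank_hwproj_mul; try exact: dominant_mnm_part.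
by move: hpos; rewrite (hall_plethysm sz hN' hla') -[1]/(1%:R) ler_nat.
Qed.
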